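(* Let $\lambda=e^{2i\pi(p/q)}$ with the rational number $p/q$ in lowest terms ($q\ge1$). If $\varphi$ is analytic (i.e. $\varphi\in H^2$) and continuously differentiable on $\mathbb T$, then the spectrum of $T_{\lambda,\varphi}$ is $$\sigma(T_{\lambda,\varphi})=\{\mu\in\mathbb C:\ \mu^q\in \operatorname{cl}(\hat\phi_{\overline\lambda+}(\mathbb D))\},$$ where $\operatorname{cl}$ denotes closure in $\mathbb C$.
   Context: $\mathbb D$ is the open unit disc, $\mathbb T$ the unit circle, $L^2(\mathbb T)$ carries the inner product $\langle f,g\rangle=\frac1{2\pi}\int_0^{2\pi}f\overline g\,d\theta$, and $H^2\subset L^2(\mathbb T)$ is the Hardy space of functions whose Fourier coefficients of negative index vanish, with orthonormal basis $e_n=e^{in\theta}$, $n\ge0$. A function on $\mathbb T$ is called analytic if its negative-index Fourier coefficients vanish. For $|\lambda|=1$ and $\varphi\sim\sum_{n\in\mathbb Z}a_ne^{in\theta}\in L^2(\mathbb T)$, the $\lambda$-Toeplitz operator $T_{\lambda,\varphi}$ on $H^2$ is the operator (when bounded) with matrix $\langle T_{\lambda,\varphi}e_m,e_n\rangle=\lambda^{\min(m,n)}a_{n-m}$, $m,n\ge0$. The function $\varphi_{\overline\lambda,+}\sim\sum_{n\in\mathbb Z} b_ne^{in\theta}$ is defined by $b_n=\overline\lambda^{\,n}a_n$ for $n\ge0$ and $b_n=a_n$ for $n<0$. One has $T_{\lambda,\varphi}=U_\lambda T_{\varphi_{\overline\lambda,+}}$, where $U_\lambda e_n=\lambda^ne_n$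 and $T_\psi f=P(\psi f)$ is the Toeplitz operator with symbol $\psi\in L^\infty(\mathbb T)$ ($P$ the orthogonal projection of $L^2(\mathbb T)$ onto $H^2$). With $\overline\tau(e^{i\theta})=\overline\lambda e^{i\theta}$ and $\overline\tau^{\,j}$ its $j$-th iterate, put $\phi_{\overline\lambda+}=\prod_{j=0}^{q-1}\varphi_{\overline\lambda,+}\circ\overline\tau^{\,j}$. For $f\in H^2$, the Gelfand transform is the analytic function on $\mathbb D$ given by $\hat f(z)=\frac1{2\pi}\int_0^{2\pi}\frac{f(e^{i\theta})}{1-ze^{-i\theta}}\,d\theta$, $|z|<1$ (so $\hat f(z)=\sum_{n\ge0}c_nz^n$ if $f\sim\sum_{n\ge0}c_ne^{in\theta}$). *)

(* Defs.v *)
From HB Require Import structures.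
From mathcomp Require Import all_boot all_order all_algebra.
From mathcomp Require Import complex.
From mathcomp Require Import all_classical all_reals all_analysis.

Set Implicit Arguments.
Unset Strict Implicit.
Unset Printing Implicit Defensive.

Import Order.TTheory GRing.Theory Num.Theory.
Import numFieldNormedType.Exports.

Local Open Scope classical_set_scope.
Local Open Scope ring_scope.

(* A function on the unit circle is represented by a total function
   f : R[i] -> R[i] of which only the values f (cis t), t in [0, 2 pi], matter.
   Elements of L^2(T) are such functions up to eq_circle, i.e. up to equality
   almost everywhere; operators act on representatives and identities between
   them are stated up to eq_circle. *)

Definition cis (R : realType) (t : R) : R[i] := Complex (cos t) (sin t).

Definition arc (R : realType) : set R := [set` `[(0 : R), pi *+ 2]].

Definition circle_mean (R : realType) (f : R[i] -> R[i]) : R[i] :=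
  Complex
    ((pi *+ 2)^-1 *
       Rintegral lebesgue_measure (@arc R) (fun t => complex.Re (f (cis t))))
    ((pi *+ 2)^-1 *
       Rintegral lebesgue_measure (@arc R) (fun t => complex.Im (f (cis t)))).

Definition eq_circle (R : realType) (f g : R[i] -> R[i]) : Prop :=
  ae_eq lebesgue_measure (@arc R) (f \o @cis R) (g \o @cis R).

(* |f|^2 = (Re f)^2 + (Im f)^2 is integrable iff both squares are. *)
Definition in_L2 (R : realType) (f : R[i] -> R[i]) : Prop :=
  let u t := complex.Re (f (cis t)) in
  let v t := complex.Im (f (cis t)) in
  [/\ measurable_fun (@arc R) u, measurable_fun (@arc R) v,
      lebesgue_measure.-integrable (@arc R) (fun t => ((u t) ^+ 2)%:E) &
      lebesgue_measure.-integrable (@arc R) (fun t => ((v t) ^+ 2)%:E)].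

Definition inner (R : realType) (f g : R[i] -> R[i]) : R[i] :=
  circle_mean (fun z => f z * (g z)^*).

Definition norm2 (R : realType) (f : R[i] -> R[i]) : R :=
  Num.sqrt (complex.Re (inner f f)).

Definition basis (R : realType) (n : int) (z : R[i]) : R[i] := z ^ n.

Definition fourier (R : realType) (f : R[i] -> R[i]) (n : int) : R[i] :=
  inner f (@basis R n).

Definition analytic (R : realType) (f : R[i] -> R[i]) : Prop :=
  forall n : int, n < 0 -> fourier f n = 0.

Definition in_H2 (R : realType) (f : R[i] -> R[i]) : Prop :=
  in_L2 f /\ analytic f.

Definition C1_fun (R : realType) (u : R -> R) : Prop :=
  (forall t, derivable u t 1) /\ continuous (derive1 u).

Definition C1_circle (R : realType) (f : R[i] -> R[i]) : Prop :=
  C1_fun (fun t : R => complex.Re (f (cis t))) /\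
  C1_fun (fun t : R => complex.Im (f (cis t))).

Record bounded_operator (R : realType)
    (T : (R[i] -> R[i]) -> (R[i] -> R[i])) : Prop := BoundedOperator {
  bounded_operator_H2 : forall f, in_H2 f -> in_H2 (T f);
  bounded_operator_eq : forall f g, in_H2 f -> in_H2 g ->
    eq_circle f g -> eq_circle (T f) (T g);
  bounded_operator_linear : forall (a : R[i]) f g, in_H2 f -> in_H2 g ->
    eq_circle (T (fun z => a * f z + g z)) (fun z => a * T f z + T g z);
  bounded_operator_bound : exists M : R, forall f, in_H2 f ->
    norm2 (T f) <= M * norm2 f
}.

Definition spectrum (R : realType) (T : (R[i] -> R[i]) -> (R[i] -> R[i])) :
    set R[i] :=
  [set mu | ~ exists S, [/\ bounded_operator S,
     (forall f, in_H2 f -> eq_circle (S (fun z => mu * f z - T f z)) f) &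
     (forall f, in_H2 f -> eq_circle (fun z => mu * S f z - T (S f) z) f)]].

Definition is_lambda_toeplitz (R : realType) (lam : R[i])
    (phi : R[i] -> R[i]) (T : (R[i] -> R[i]) -> (R[i] -> R[i])) : Prop :=
  bounded_operator T /\
  forall m n : nat, inner (T (basis m%:Z)) (@basis R n%:Z) =
    lam ^+ minn m n * fourier phi (n%:Z - m%:Z).

(* The operator is determined on H^2, up to eq_circle, by its matrix; when no
   bounded operator has this matrix, the value is the junk operator 0. *)
Definition lambda_toeplitz (R : realType) (lam : R[i])
    (phi : R[i] -> R[i]) : (R[i] -> R[i]) -> (R[i] -> R[i]) :=
  xget (fun _ _ => 0) [set T | is_lambda_toeplitz lam phi T].

Definition twisted_coef (R : realType) (lam : R[i]) (a : int -> R[i])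
    (n : int) : R[i] :=
  if 0 <= n then lam^* ^ n * a n else a n.

(* phi_{conj lam, +}: the element of L^2(T), unique up to eq_circle, with the
   Fourier coefficients b_n. *)
Definition twisted_symbol (R : realType) (lam : R[i])
    (phi : R[i] -> R[i]) : R[i] -> R[i] :=
  xget (fun _ => 0) [set psi | in_L2 psi /\
    forall n, fourier psi n = twisted_coef lam (fourier phi) n].

Definition symbol_product (R : realType) (lam : R[i]) (q : nat)
    (phi : R[i] -> R[i]) : R[i] -> R[i] :=
  fun z => \prod_(j < q)
    twisted_symbol lam phi (iter j (fun w => lam^* * w) z).

Definition gelfand (R : realType) (f : R[i] -> R[i]) (z : R[i]) : R[i] :=
  circle_mean (fun w => f w / (1 - z * w^-1)).

Definition unit_disc (R : realType) : set R[i] := [set z | `|z| < 1].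

(* R[i]^o is R[i] with the topology of its norm. *)
Definition complex_closure (R : realType) (A : set R[i]) : set R[i] :=
  closure (A : set (R[i])^o).

(* Main.v *)
From Pilot Require Import Defs.
From HB Require Import structures.
From mathcomp Require Import all_boot all_order all_algebra.
From mathcomp Require Import complex.
From mathcomp Require Import all_classical all_reals all_analysis.
From mathcomp Require Import measurable_realfun ring lra.

Import Order.TTheory GRing.Theory Num.Theory.
Import numFieldNormedType.Exports.
(* [arc] is the period of the circle rather than its homonym on sequences. *)
Import Pilot.Defs.

Local Open Scope classical_set_scope.
Local Open Scope ring_scope.

(** As [phi] is analytic, the lambda-Toeplitz operator is the weighted rotation
    [T f z = phi z * f (lam * z)]: column [n] of its matrix is [lam^n z^n phi]
    ([lambda_toeplitzP]). Since [lam^q = 1], its power [T^q] is the multiplication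
    by [Phi z = phi z * phi (lam z) * ... * phi (lam^(q-1) z)], written
    [orbit_prod], and this product has the same Gelfand transform as
    [symbol_product] ([gelfand_symbol_product]). The theorem amounts to the
    statement that [m - T] is invertible exactly when [m^q] stays at a positive
    distance from the values of the Gelfand transform of [Phi] on the disc.

    Two approximation results carry the analysis. The trigonometric polynomials
    are dense in mean square ([trig_dense]): the indicator of a ray is a dominated
    limit of the trigonometric polynomials [(1 - y^n)^(2^n)], with [y] affine in a
    translate of the cosine, and Dynkin's argument passes from rays to measurable
    sets. Projecting, the polynomials are dense in the Hardy space
    ([hardy_dense]); hence Fourier coefficients determine a function, and a bounded
    operator is determined by its matrix. Secondly, [phi] is a uniform limit of
    polynomials on the circle ([C1_disc_alg]): approximate [phi'] in mean square by
    polynomials and integrate. Uniform limits of polynomials, [disc_alg], are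
    closed under products, rotations and Neumann series. On them the Gelfand
    transform, which is the inner product with the reproducing kernel
    [kern w], is multiplicative ([gelfandM]) and satisfies the maximum principle
    ([gelfand_disc_alg_le]).

    Suppose [|m^q - Phi(w)| >= d > 0] in the disc. Then [1 / (m^q - Phi)] is again
    a uniform limit of polynomials ([disc_alg_inv]): a polynomial close to
    [m^q - Phi] has no zero in the closed disc, its linear factors are inverted by
    geometric series, and a last Neumann series corrects the error. As
    [m^q - T^q] is the product of [m - T] and its cofactor, [resol], composing the
    cofactor with the multiplication by [1 / (m^q - Phi)] inverts [m - T]
    ([invertible_of_bounded_below]).

    Conversely let [S] be a bounded inverse of [m - T]. Applying the cofactor to
    [f = m (S f) - T (S f)] gives [resol f = (m^q - Phi) (S f)]. Evaluate this at
    [w] for the kernel at [w] times the polynomial vanishing at the other points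
    of the orbit of [w]: only the first term of the cofactor survives, and
    [|m|^(q-1) |w|^(q-1) <= M |m^q - Phi(w)|] ([invertible_lower]). This degenerates
    at the origin, but [Phi(w) - Phi(0)] is of order [|w|^q], because [Phi] is
    invariant under a rotation of order [q] ([orbit_prod_flat]); so the inequality
    also excludes [m^q = Phi(0)] and a uniform lower bound follows
    ([bounded_below_of_invertible]). For [m = 0] the bound is trivial, and the
    kernel itself shows that [phi], hence [Phi], is bounded below. *)

Set Implicit Arguments.
Unset Strict Implicit.
Unset Printing Implicit Defensive.

(** * Moduli and points of the unit circle *)

(** The modulus with values in [R], where [`|z|] has values in [R[i]]: real
    inequalities between moduli can then be combined by linear arithmetic. *)
Notation cabs := (@ComplexField.Normc.normc _).

Section ComplexModulus.
Variable R : realType.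
Implicit Types (z w : R[i]) (x : R).

Lemma normE z : `|z| = (cabs z)%:C%C.
Proof. by case: z. Qed.

Lemma cabs_sqrE z : cabs z ^+ 2 = complex.Re z ^+ 2 + complex.Im z ^+ 2.
Proof. by case: z => a b /=; rewrite sqr_sqrtr// addr_ge0// sqr_ge0. Qed.

Lemma cabs_ge0 z : 0 <= cabs z.
Proof. by case: z => a b /=; rewrite sqrtr_ge0. Qed.

Lemma cabs_real x : cabs x%:C%C = `|x|.
Proof. by rewrite /= expr0n /= addr0 sqrtr_sqr. Qed.

Lemma cabs0 : cabs (0 : R[i]) = 0.
Proof. by rewrite (cabs_real 0) normr0. Qed.

Lemma cabs1 : cabs (1 : R[i]) = 1.
Proof. by rewrite (cabs_real 1) normr1. Qed.

Lemma cabs_eq0 z : (cabs z == 0) = (z == 0).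
Proof.
apply/eqP/eqP => [|->]; last exact: cabs0.
exact: ComplexField.Normc.eq0_normc.
Qed.

Lemma cabs_gt0 z : (0 < cabs z) = (z != 0).
Proof. by rewrite lt_def cabs_ge0 andbT cabs_eq0. Qed.

Lemma cabsM z w : cabs (z * w) = cabs z * cabs w.
Proof. exact: ComplexField.Normc.normcM. Qed.

Lemma cabsV z : cabs z^-1 = (cabs z)^-1.
Proof. exact: ComplexField.Normc.normcV. Qed.

Lemma cabsN z : cabs (- z) = cabs z.
Proof. by case: z => a b /=; rewrite !sqrrN. Qed.

Lemma cabsX z n : cabs (z ^+ n) = cabs z ^+ n.
Proof. by elim: n => [|n IH]; rewrite ?expr0 ?cabs1// !exprS cabsM IH. Qed.

Lemma cabsC z : cabs z^* = cabs z.
Proof. by case: z => a b /=; rewrite sqrrN. Qed.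

Lemma cabs_prod n (F : 'I_n -> R[i]) :
  cabs (\prod_(i < n) F i) = \prod_(i < n) cabs (F i).
Proof.
elim: n F => [|n IH] F; first by rewrite !big_ord0 cabs1.
by rewrite !big_ord_recl cabsM IH.
Qed.

Lemma cabsD z w : cabs (z + w) <= cabs z + cabs w.
Proof. exact: le_normcD. Qed.

Lemma cabsB z w : cabs (z - w) <= cabs z + cabs w.
Proof. by rewrite -(cabsN w) cabsD. Qed.

Lemma cabs_distC z w : cabs (z - w) = cabs (w - z).
Proof. by rewrite -cabsN opprB. Qed.

Lemma cabs_sub z w : cabs z - cabs w <= cabs (z - w).
Proof. by rewrite lerBlDr -{1}(subrK w z) cabsD. Qed.

Lemma cabs_sum n (F : 'I_n -> R[i]) :
  cabs (\sum_(i < n) F i) <= \sum_(i < n) cabs (F i).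
Proof.
elim: n F => [|n IH] F; first by rewrite !big_ord0 cabs0.
by rewrite !big_ord_recl (le_trans (cabsD _ _))// lerD2l.
Qed.

Lemma Re_le_cabs z : `|complex.Re z| <= cabs z.
Proof.
rewrite -(@ler_pXn2r _ 2)// ?nnegrE ?normr_ge0 ?cabs_ge0// cabs_sqrE.
by rewrite real_normK ?num_real// lerDl sqr_ge0.
Qed.

Lemma Im_le_cabs z : `|complex.Im z| <= cabs z.
Proof.
rewrite -(@ler_pXn2r _ 2)// ?nnegrE ?normr_ge0 ?cabs_ge0// cabs_sqrE.
by rewrite real_normK ?num_real// lerDr sqr_ge0.
Qed.

Lemma cabs_le_ReIm z : cabs z <= `|complex.Re z| + `|complex.Im z|.
Proof.
rewrite -(@ler_pXn2r _ 2)// ?nnegrE ?cabs_ge0 ?addr_ge0// cabs_sqrE.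
rewrite sqrrD !real_normK ?num_real//.
by rewrite lerD2r lerDl mulrn_wge0// mulr_ge0.
Qed.

Lemma mulC_conj z : z * z^* = (cabs z ^+ 2)%:C%C.
Proof. by rewrite -normCK normE rmorphXn. Qed.

Lemma ReD z w : complex.Re (z + w) = complex.Re z + complex.Re w.
Proof. by case: z; case: w. Qed.

Lemma ImD z w : complex.Im (z + w) = complex.Im z + complex.Im w.
Proof. by case: z; case: w. Qed.

Lemma ReN z : complex.Re (- z) = - complex.Re z.
Proof. by case: z. Qed.

Lemma ImN z : complex.Im (- z) = - complex.Im z.
Proof. by case: z. Qed.

Lemma ReM z w :
  complex.Re (z * w) = complex.Re z * complex.Re w - complex.Im z * complex.Im w.
Proof. by case: z; case: w. Qed.

Lemma ImM z w :
  complex.Im (z * w) = complex.Re z * complex.Im w + complex.Im z * complex.Re w.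
Proof. by case: z => a b; case: w => c d. Qed.

Lemma ReC z : complex.Re z^* = complex.Re z.
Proof. by case: z. Qed.

Lemma ImC z : complex.Im z^* = - complex.Im z.
Proof. by case: z. Qed.

Lemma complex_ext z w : complex.Re z = complex.Re w ->
  complex.Im z = complex.Im w -> z = w.
Proof. by case: z => a b; case: w => c d /= -> ->. Qed.

End ComplexModulus.

Section Circle.
Variable R : realType.
Implicit Types (s t : R) (n : nat).

Lemma cisD s t : cis (s + t) = cis s * cis t.
Proof.
apply: complex_ext; rewrite /= ?cosD ?sinD//.
by rewrite addrC.
Qed.

Lemma cis0 : cis (0 : R) = 1.
Proof. by rewrite /cis cos0 sin0. Qed.

Lemma cisN t : cis (- t) = (cis t)^*.
Proof. by apply: complex_ext; rewrite /= ?cosN ?sinN. Qed.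

Lemma cabs_cis t : cabs (cis t) = 1.
Proof. by rewrite /= cos2Dsin2 sqrtr1. Qed.

Lemma cis_neq0 t : cis t != 0.
Proof. by rewrite -cabs_eq0 cabs_cis oner_neq0. Qed.

Lemma cis_mulC t : cis t * (cis t)^* = 1.
Proof. by rewrite -cisN -cisD subrr cis0. Qed.

Lemma cisV t : (cis t)^-1 = (cis t)^*.
Proof. by apply: (mulfI (cis_neq0 t)); rewrite cis_mulC divff// cis_neq0. Qed.

Lemma cis2pi : cis (pi *+ 2 : R) = 1.
Proof. by rewrite /cis cos2pi sin2pi. Qed.

Lemma cisX t n : cis t ^+ n = cis (t *+ n).
Proof.
by elim: n => [|n IH]; rewrite ?expr0 ?mulr0n ?cis0// exprS IH mulrS cisD.
Qed.

Lemma cisXz t (n : int) : cis t ^ n = cis (t *~ n).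
Proof.
case: n => n; first by rewrite -exprnP cisX.
by rewrite NegzE -exprnN cisX mulrNz cisN cisV.
Qed.

Lemma cis_mulrz2pi (n : int) : cis ((pi *+ 2 : R) *~ n) = 1.
Proof. by rewrite -cisXz cis2pi exp1rz. Qed.

Lemma cis_arc t : exists2 s, s \in `[0, pi *+ 2[ & cis t = cis s.
Proof.
have p0 : 0 < pi *+ 2 :> R by rewrite mulrn_wgt0// pi_gt0.
pose k := Num.floor (t / (pi *+ 2)).
exists (t - (pi *+ 2) *~ k).
  have /andP[] := floor_itv (t / (pi *+ 2)).
  rewrite -/k ler_pdivlMr// ltr_pdivrMr// rmorphD/= mulrDl mul1r => h1 h2.
  by rewrite in_itv/= subr_ge0 -mulrzl h1/= ltrBlDl.
by rewrite cisD cisN cis_mulrz2pi conjC1 mulr1.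
Qed.

(** The cosine takes the value [1] only at [0] on [0, pi], and the other half of
    the period is its mirror image. *)
Lemma cis_eq1 s : s \in `[0, pi *+ 2[ -> cis s = 1 -> s = 0.
Proof.
rewrite in_itv/= => /andP[s0 s2] [cs _].
have p0 := @pi_gt0 R.
have [sp|sp] := leP s pi.
  by apply: cos_inj; rewrite ?in_itv/= ?s0 ?sp ?lexx ?ltW// cos0.
have : cos (pi *+ 2 - s) = 1 :> R.
  by rewrite cosB cos2pi sin2pi cs mul0r addr0 mulr1.
rewrite -(@cos0 R) => /cos_inj H.
have : pi *+ 2 - s = 0.
  by apply: H; rewrite in_itv/= ?lexx ?(ltW p0)//; apply/andP; split; lra.
lra.
Qed.

End Circle.

Section RootOfUnity.
Variables (R : realType) (p : int) (q : nat).
Hypotheses (q_ge1 : (1 <= q)%N) (pq : coprime `|p|%N q).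

Let lam : R[i] := cis (pi *+ 2 * (p%:~R / q%:R)).

Let q0 : (q%:R : R) != 0.
Proof. by rewrite pnatr_eq0 -lt0n. Qed.

Let qz : (q%:Z)%:~R = q%:R :> R.
Proof. by rewrite -pmulrn. Qed.

Lemma rootX n : lam ^+ n = cis (pi *+ 2 * ((p * n%:Z)%:~R / q%:R)).
Proof.
by rewrite cisX -mulr_natr intrM/=; congr cis; rewrite -pmulrn; ring.
Qed.

Lemma root_exp_order : lam ^+ q = 1.
Proof.
rewrite rootX intrM qz.
have -> : pi *+ 2 * (p%:~R * q%:R / q%:R) = (pi *+ 2) *~ p :> R.
  by rewrite -mulrzr; field.
exact: cis_mulrz2pi.
Qed.

(** Reducing the exponent [p k] modulo [q] puts the angle in a single period, where
    [cis] takes the value [1] only at [0]; so [q] divides [p k], hence [k]. *)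
Lemma root_exp_neq1 k : (0 < k < q)%N -> lam ^+ k != 1.
Proof.
move=> /andP[k0 kq]; apply/eqP; rewrite rootX => h.
have q1 : 0 < (q%:Z) by [].
set m := p * k%:Z in h.
pose r := (m %% q)%Z; have r0 : 0 <= r by rewrite modz_ge0// lt0r_neq0.
have rq : r < q%:Z by rewrite ltz_pmod.
have p0 : 0 < pi *+ 2 :> R by rewrite mulrn_wgt0// pi_gt0.
have : pi *+ 2 * (r%:~R / q%:R) = 0 :> R.
  apply: cis_eq1.
    rewrite in_itv/= mulr_ge0 ?divr_ge0 ?ler0n ?ler0z ?(ltW p0)//=.
    rewrite gtr_pMr// ltr_pdivrMr ?ltr0n// mul1r.
    by rewrite pmulrn ltr_int.
  have hm : m = (m %/ q)%Z * q%:Z + r by exact: divz_eq.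
  move: h; rewrite hm intrD intrM qz.
  have -> : pi *+ 2 * (((m %/ q)%Z%:~R * q%:R + r%:~R) / q%:R) =
      (pi *+ 2) *~ (m %/ q)%Z + pi *+ 2 * (r%:~R / q%:R) :> R.
    by rewrite -mulrzr; field.
  by rewrite cisD cis_mulrz2pi mul1r.
move/eqP; rewrite mulf_eq0 (gt_eqF p0)/= mulf_eq0 invr_eq0 (negPf q0) orbF.
rewrite intr_eq0 => /eqP/dvdz_mod0P.
rewrite dvdzE abszM/= Gauss_dvdr 1?coprime_sym//.
by move/dvdn_leq => /(_ k0); rewrite leqNgt kq.
Qed.

End RootOfUnity.

(** * Integration over a period *)

Section RealPeriod.
Variable R : realType.
Implicit Types (u v : R -> R) (t : R).
Local Notation mu := (@lebesgue_measure R).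

Lemma twopi_gt0 : 0 < pi *+ 2 :> R.
Proof. by rewrite mulrn_wgt0// pi_gt0. Qed.

Lemma arcP t : arc t <-> 0 <= t <= pi *+ 2.
Proof. by rewrite /arc /= in_itv. Qed.

Lemma measurable_arc : measurable (@arc R).
Proof. exact: measurable_itv. Qed.
#[local] Hint Resolve measurable_arc : core.

Lemma lebesgue_arc : mu (@arc R) = (pi *+ 2)%:E.
Proof. by rewrite lebesgue_measure_itv/= lte_fin twopi_gt0 oppr0 addr0. Qed.

Definition integrable_arc u := mu.-integrable (@arc R) (EFin \o u).

Lemma integrable_arc_meas u : integrable_arc u -> measurable_fun (@arc R) u.
Proof. by move=> /(measurable_int mu)/measurable_EFinP. Qed.

Lemma le_integrable_arc u v : measurable_fun (@arc R) u ->
  (forall t, arc t -> `|u t| <= v t) -> integrable_arc v -> integrable_arc u.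
Proof.
move=> mu0 uv; apply: le_integrable => //; first exact/measurable_EFinP.
by move=> t At /=; rewrite lee_fin (le_trans (uv t At))// ler_norm.
Qed.

Lemma eq_integrable_arc u v : (forall t, arc t -> u t = v t) ->
  integrable_arc u -> integrable_arc v.
Proof.
move=> uv; apply: eq_integrable => // t /set_mem At /=.
by rewrite uv.
Qed.

Lemma integrable_arcD u v : integrable_arc u -> integrable_arc v ->
  integrable_arc (fun t => u t + v t).
Proof. by move=> iu iv; exact: (integrableD _ iu iv). Qed.

Lemma integrable_arcZ a u : integrable_arc u ->
  integrable_arc (fun t => a * u t).
Proof. by move=> iu; exact: (integrableZl _ a iu). Qed.

Lemma integrable_arcN u : integrable_arc u -> integrable_arc (fun t => - u t).
Proof. by move=> iu; exact: (integrableN iu). Qed.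

Lemma integrable_arcB u v : integrable_arc u -> integrable_arc v ->
  integrable_arc (fun t => u t - v t).
Proof. by move=> iu iv; apply: integrable_arcD => //; exact: integrable_arcN. Qed.

Lemma integrable_arc_cst a : integrable_arc (cst a).
Proof.
apply: measurable_bounded_integrable => //.
  by rewrite [ltLHS]lebesgue_arc ltry.
by exists `|a|; split; [exact: num_real|move=> x /ltW ax t _ /=].
Qed.

Definition rmean u : R := (pi *+ 2)^-1 * Rintegral mu (@arc R) u.

Lemma eq_rmean u v : (forall t, arc t -> u t = v t) -> rmean u = rmean v.
Proof.
by move=> uv; congr (_ * _); apply: eq_Rintegral => t /set_mem; exact: uv.
Qed.

Lemma ae_eq_rmean u v : measurable_fun (@arc R) u ->
  measurable_fun (@arc R) v -> ae_eq mu (@arc R) u v -> rmean u = rmean v.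
Proof.
move=> mu0 mv uv; congr (_ * fine _).
apply: ae_eq_integral => //; try exact/measurable_EFinP.
exact: (ae_eq_comp EFin uv).
Qed.

Lemma rmeanD u v : integrable_arc u -> integrable_arc v ->
  rmean (fun t => u t + v t) = rmean u + rmean v.
Proof. by move=> iu iv; rewrite /rmean RintegralD// mulrDr. Qed.

Lemma rmeanZ a u : integrable_arc u -> rmean (fun t => a * u t) = a * rmean u.
Proof. by move=> iu; rewrite /rmean RintegralZl// mulrCA. Qed.

Lemma rmeanN u : integrable_arc u -> rmean (fun t => - u t) = - rmean u.
Proof.
move=> iu; rewrite -mulN1r -rmeanZ//.
by apply: eq_rmean => t _; rewrite mulN1r.
Qed.

Lemma rmeanB u v : integrable_arc u -> integrable_arc v ->
  rmean (fun t => u t - v t) = rmean u - rmean v.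
Proof. by move=> iu iv; rewrite rmeanD// ?rmeanN//; exact: integrable_arcN. Qed.

Lemma rmean_cst a : rmean (cst a) = a.
Proof.
rewrite /rmean Rintegral_cst// [X in fine X]lebesgue_arc /= mulrCA mulVf ?mulr1//.
by rewrite gt_eqF// twopi_gt0.
Qed.

Lemma rmean_ge0 u : (forall t, arc t -> 0 <= u t) -> 0 <= rmean u.
Proof.
by move=> u0; rewrite mulr_ge0 ?invr_ge0 ?(ltW twopi_gt0)// Rintegral_ge0.
Qed.

Lemma le_rmean u v : integrable_arc u -> integrable_arc v ->
  (forall t, arc t -> u t <= v t) -> rmean u <= rmean v.
Proof.
move=> iu iv uv; rewrite ler_pM2l ?invr_gt0 ?twopi_gt0//.
exact: le_Rintegral.
Qed.

Lemma rmean_eq0 u : integrable_arc u -> (forall t, arc t -> 0 <= u t) ->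
  rmean u = 0 -> ae_eq mu (@arc R) u (cst 0).
Proof.
move=> iu u0 /eqP; rewrite mulf_eq0 invr_eq0 gt_eqF ?twopi_gt0//= => /eqP h.
have mu0 : measurable_fun (@arc R) (EFin \o u) by exact: (measurable_int mu).
have : (\int[mu]_(t in @arc R) `|(EFin \o u) t|)%E = 0%E.
  under eq_integral => t /set_mem At do rewrite gee0_abs ?lee_fin ?u0//.
  rewrite -[LHS]fineK//; first by rewrite -[fine _]/(Rintegral mu _ _) h.
  exact: integrable_fin_num.
move/(ae_eq_integral_abs mu measurable_arc mu0).
by move=> /(ae_eq_comp fine).
Qed.

Lemma dominated_rmean (un : nat -> R -> R) u v :
  (forall n, measurable_fun (@arc R) (un n)) -> measurable_fun (@arc R) u ->
  {ae mu, forall t, arc t -> un ^~ t @ \oo --> u t} -> integrable_arc v ->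
  (forall n t, arc t -> `|un n t| <= v t) ->
  (fun n => rmean (un n)) @ \oo --> rmean u.
Proof.
move=> mun mu0 cu iv uv; apply: cvgMr.
have [iu _ h] : [/\ mu.-integrable (@arc R) (EFin \o u),
    [sequence \int[mu]_(x in @arc R) `|(un n x)%:E - (u x)%:E|]_n @ \oo --> 0 &
    [sequence \int[mu]_(x in @arc R) (un n x)%:E]_n @ \oo -->
    \int[mu]_(x in @arc R) (u x)%:E]%E.
  apply: (@dominated_convergence _ _ _ mu _ measurable_arc
      (fun n t => (un n t)%:E) (EFin \o u) (EFin \o v)) => //.
  - by move=> n; apply/measurable_EFinP; exact: mun.
  - by apply/measurable_EFinP; exact: mu0.
  - move: cu => [N [mN N0 sN]]; exists N; split => //.
    apply: subset_trans sN => t; apply: contra_not => h At.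
    by apply: cvg_EFin; [exact: nearW|exact: h].
  - by apply: aeW => t n At /=; rewrite lee_fin uv.
by apply: fine_cvg; rewrite fineK//; exact: integrable_fin_num.
Qed.

Definition rL2 u :=
  measurable_fun (@arc R) u /\ integrable_arc (fun t => u t ^+ 2).

(** From [2 |u v| <= u^2 + v^2]. *)
Lemma rL2M u v : rL2 u -> rL2 v -> integrable_arc (fun t => u t * v t).
Proof.
move=> [mu0 iu] [mv iv].
apply: (@le_integrable_arc _ (fun t => u t ^+ 2 + v t ^+ 2)).
- exact: measurable_funM.
- move=> t _; rewrite normrM.
  rewrite -(real_normK (num_real (u t))) -(real_normK (num_real (v t))).
  have := sqr_ge0 (`|u t| - `|v t|).
  have := mulr_ge0 (normr_ge0 (u t)) (normr_ge0 (v t)).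
  move: (`|u t|) (`|v t|) => a b; rewrite sqrrB; lra.
- exact: integrable_arcD.
Qed.

Lemma rL2D u v : rL2 u -> rL2 v -> rL2 (fun t => u t + v t).
Proof.
move=> h1 h2; have iuv := rL2M h1 h2; move: h1 h2 => [mu0 iu] [mv iv].
split; first exact: measurable_funD.
apply: (@eq_integrable_arc (fun t => (u t ^+ 2 + v t ^+ 2) + 2 * (u t * v t))).
- by move=> t _; ring.
- by apply: integrable_arcD; [exact: integrable_arcD|exact: integrable_arcZ].
Qed.

Lemma rL2_bounded (h : R -> R) M u : measurable_fun (@arc R) h ->
  (forall t, arc t -> `|h t| <= M) -> rL2 u -> rL2 (fun t => h t * u t).
Proof.
move=> mh hM [mu0 iu]; split; first exact: measurable_funM.
apply: (@le_integrable_arc _ (fun t => M ^+ 2 * u t ^+ 2)).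
- by apply: measurable_funX; exact: measurable_funM.
- move=> t At; rewrite exprMn normrM !normrX ler_pM//.
  + by rewrite lerXn2r ?nnegrE ?hM// (le_trans _ (hM t At)).
  + by rewrite real_normK ?num_real.
- exact: integrable_arcZ.
Qed.

Lemma rL2_cst a : rL2 (cst a).
Proof. by split; [exact: measurable_cst|exact: (integrable_arc_cst (a ^+ 2))]. Qed.

Lemma rL2Z a u : rL2 u -> rL2 (fun t => a * u t).
Proof. by apply: (@rL2_bounded (cst a) `|a|); [exact: measurable_cst|]. Qed.

Lemma rL2N u : rL2 u -> rL2 (fun t => - u t).
Proof.
move=> h; rewrite (_ : (fun _ => _) = (fun t => -1 * u t)); first exact: rL2Z.
by apply/funext => t; rewrite mulN1r.
Qed.

Lemma rL2_int u : rL2 u -> integrable_arc u.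
Proof.
move=> h; have := rL2M (rL2_cst 1) h.
by rewrite (_ : (fun t => cst 1 t * u t) = u)//; apply/funext => t; rewrite /= mul1r.
Qed.

End RealPeriod.
#[global] Hint Resolve measurable_arc : core.

(** * The Hilbert space of square-integrable functions on the circle *)

Section ComplexPeriod.
Variable R : realType.
Implicit Types (F G H : R -> R[i]) (t M : R) (z w : R[i]).
Local Notation mu := (@lebesgue_measure R).
Local Notation Re := (@complex.Re R).
Local Notation Im := (@complex.Im R).

Definition cmeas F := measurable_fun (@arc R) (fun t => Re (F t)) /\
  measurable_fun (@arc R) (fun t => Im (F t)).

Definition cint F := integrable_arc (fun t => Re (F t)) /\
  integrable_arc (fun t => Im (F t)).

(** Functions of the angle are the basic objects, so that functions on the circle
    and their derivatives in the angle are treated alike; [in_L2 f] is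
    [sqint (fun t => f (cis t))], and likewise for [inner] and [ip], [norm2] and
    [nrm], by conversion. *)
Definition sqint F :=
  let u t := Re (F t) in let v t := Im (F t) in
  [/\ measurable_fun (@arc R) u, measurable_fun (@arc R) v,
      mu.-integrable (@arc R) (fun t => ((u t) ^+ 2)%:E) &
      mu.-integrable (@arc R) (fun t => ((v t) ^+ 2)%:E)].

Definition mean F : R[i] :=
  Complex (rmean (fun t => Re (F t))) (rmean (fun t => Im (F t))).

Definition ip F G : R[i] := mean (fun t => F t * (G t)^*).

Definition n2 F : R := Re (ip F F).

Definition nrm F : R := Num.sqrt (n2 F).

Lemma sqintP F : sqint F <->
  rL2 (fun t => Re (F t)) /\ rL2 (fun t => Im (F t)).
Proof. by split=> [[]|[[] ? ? [] ? ?]]; split. Qed.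

Lemma sqint_meas F : sqint F -> cmeas F.
Proof. by case. Qed.

Lemma cmeasD F G : cmeas F -> cmeas G -> cmeas (fun t => F t + G t).
Proof.
move=> [F1 F2] [G1 G2]; split.
  under eq_fun do rewrite ReD; exact: measurable_funD.
under eq_fun do rewrite ImD; exact: measurable_funD.
Qed.

Lemma cmeasM F G : cmeas F -> cmeas G -> cmeas (fun t => F t * G t).
Proof.
move=> [F1 F2] [G1 G2]; split.
  under eq_fun do rewrite ReM; apply: measurable_funB; exact: measurable_funM.
under eq_fun do rewrite ImM; apply: measurable_funD; exact: measurable_funM.
Qed.

Lemma cmeasC F : cmeas F -> cmeas (fun t => (F t)^*).
Proof.
move=> [F1 F2]; split; first by under eq_fun do rewrite ReC.
by under eq_fun do rewrite ImC; exact: measurableT_comp.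
Qed.

Lemma cmeas_cst z : cmeas (cst z).
Proof. by split; exact: measurable_cst. Qed.

Lemma cmeas_cis (f : R -> R) : continuous f -> cmeas (fun t => cis (f t)).
Proof.
move=> cf; split; apply: measurable_funTS; apply: continuous_measurable_fun => t.
  by apply: continuous_comp; [exact: cf|exact: continuous_cos].
by apply: continuous_comp; [exact: cf|exact: continuous_sin].
Qed.

Lemma cintZ z F : cint F -> cint (fun t => z * F t).
Proof.
move=> [F1 F2]; split.
  by under eq_fun do rewrite ReM; apply: integrable_arcB; exact: integrable_arcZ.
by under eq_fun do rewrite ImM; apply: integrable_arcD; exact: integrable_arcZ.
Qed.

Lemma eq_mean F G : (forall t, arc t -> F t = G t) -> mean F = mean G.
Proof.
by move=> FG; congr Complex; apply: eq_rmean => t At; rewrite FG.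
Qed.

Lemma ae_eq_mean F G : cmeas F -> cmeas G -> ae_eq mu (@arc R) F G ->
  mean F = mean G.
Proof.
move=> [F1 F2] [G1 G2] FG; congr Complex; apply: ae_eq_rmean => //.
  exact: (ae_eq_comp Re FG).
exact: (ae_eq_comp Im FG).
Qed.

Lemma meanD F G : cint F -> cint G ->
  mean (fun t => F t + G t) = mean F + mean G.
Proof.
move=> [F1 F2] [G1 G2]; apply: complex_ext; rewrite ?ReD ?ImD /=.
  by rewrite -rmeanD//; apply: eq_rmean => t _; rewrite ReD.
by rewrite -rmeanD//; apply: eq_rmean => t _; rewrite ImD.
Qed.

Lemma meanZ z F : cint F -> mean (fun t => z * F t) = z * mean F.
Proof.
move=> [F1 F2]; apply: complex_ext; rewrite ?ReM ?ImM /=.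
  rewrite -!rmeanZ// -rmeanB; try exact: integrable_arcZ.
  by apply: eq_rmean => t _; rewrite ReM.
rewrite -!rmeanZ// -rmeanD; try exact: integrable_arcZ.
by apply: eq_rmean => t _; rewrite ImM.
Qed.

Lemma mean_cst z : mean (cst z) = z.
Proof. by apply: complex_ext; exact: rmean_cst. Qed.

Lemma mean0 : mean (fun=> 0) = 0.
Proof. exact: mean_cst. Qed.

Lemma meanC F : cint F -> mean (fun t => (F t)^*) = (mean F)^*.
Proof.
move=> [F1 F2]; apply: complex_ext; rewrite ?ReC ?ImC /=.
  by apply: eq_rmean => t _; rewrite ReC.
by rewrite -rmeanN//; apply: eq_rmean => t _; rewrite ImC.
Qed.

Lemma eq_sqint F G : (forall t, F t = G t) -> sqint F -> sqint G.
Proof. by move=> /funext ->. Qed.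

Lemma sqintD F G : sqint F -> sqint G -> sqint (fun t => F t + G t).
Proof.
move=> /sqintP[F1 F2] /sqintP[G1 G2]; apply/sqintP; split.
  by under eq_fun do rewrite ReD; exact: rL2D.
by under eq_fun do rewrite ImD; exact: rL2D.
Qed.

Lemma sqint_bounded H M F : cmeas H -> (forall t, arc t -> cabs (H t) <= M) ->
  sqint F -> sqint (fun t => H t * F t).
Proof.
move=> [H1 H2] HM /sqintP[F1 F2]; apply/sqintP.
have h1 t : arc t -> `|Re (H t)| <= M.
  by move=> At; exact: le_trans (Re_le_cabs _) (HM t At).
have h2 t : arc t -> `|Im (H t)| <= M.
  by move=> At; exact: le_trans (Im_le_cabs _) (HM t At).
split.
  under eq_fun do rewrite ReM; apply: rL2D; first exact: (rL2_bounded H1 h1).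
  by apply: rL2N; exact: (rL2_bounded H2 h2).
under eq_fun do rewrite ImM; apply: rL2D.
  exact: (rL2_bounded H1 h1).
exact: (rL2_bounded H2 h2).
Qed.

Lemma sqintZ z F : sqint F -> sqint (fun t => z * F t).
Proof. by apply: (@sqint_bounded _ (cabs z)) => //; exact: cmeas_cst. Qed.

Lemma sqintN F : sqint F -> sqint (fun t => - F t).
Proof.
by move=> /(sqintZ (-1)); apply: eq_sqint => t; rewrite mulN1r.
Qed.

Lemma sqintB F G : sqint F -> sqint G -> sqint (fun t => F t - G t).
Proof. by move=> sF sG; apply: sqintD => //; exact: sqintN. Qed.

Lemma sqintC F : sqint F -> sqint (fun t => (F t)^*).
Proof.
move=> /sqintP[F1 F2]; apply/sqintP; split.
  by under eq_fun do rewrite ReC.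
by under eq_fun do rewrite ImC; exact: rL2N.
Qed.

Lemma sqint_cst z : sqint (cst z).
Proof. by apply/sqintP; split; exact: rL2_cst. Qed.

Lemma bounded_sqint F M : cmeas F -> (forall t, arc t -> cabs (F t) <= M) ->
  sqint F.
Proof.
move=> mF FM; have := sqint_bounded mF FM (sqint_cst 1).
by apply: eq_sqint => t; rewrite mulr1.
Qed.

Lemma sqint_cintM F G : sqint F -> sqint G -> cint (fun t => F t * G t).
Proof.
move=> /sqintP[F1 F2] /sqintP[G1 G2]; split.
  by under eq_fun do rewrite ReM; apply: integrable_arcB; exact: rL2M.
by under eq_fun do rewrite ImM; apply: integrable_arcD; exact: rL2M.
Qed.

Lemma sqint_cintMC F G : sqint F -> sqint G -> cint (fun t => F t * (G t)^*).
Proof. by move=> sF sG; apply: sqint_cintM => //; exact: sqintC. Qed.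

Lemma sqint_cint F : sqint F -> cint F.
Proof.
move=> /sqint_cintM/(_ (sqint_cst 1)).
by congr cint; apply/funext => t; rewrite mulr1.
Qed.

Lemma ipDl F G H : sqint F -> sqint G -> sqint H ->
  ip (fun t => F t + G t) H = ip F H + ip G H.
Proof.
move=> sF sG sH; rewrite -meanD; try exact: sqint_cintMC.
by apply: eq_mean => t _; rewrite mulrDl.
Qed.

Lemma ipZl z F G : sqint F -> sqint G -> ip (fun t => z * F t) G = z * ip F G.
Proof.
move=> sF sG; rewrite -meanZ; last exact: sqint_cintMC.
by apply: eq_mean => t _; rewrite mulrA.
Qed.

Lemma ipC F G : sqint F -> sqint G -> ip F G = (ip G F)^*.
Proof.
move=> sF sG; rewrite -meanC; last exact: sqint_cintMC.
by apply: eq_mean => t _; rewrite rmorphM /= conjCK mulrC.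
Qed.

Lemma ipDr F G H : sqint F -> sqint G -> sqint H ->
  ip F (fun t => G t + H t) = ip F G + ip F H.
Proof.
move=> sF sG sH; rewrite ipC//; last exact: sqintD.
by rewrite ipDl// rmorphD /= -!ipC.
Qed.

Lemma ipZr z F G : sqint F -> sqint G ->
  ip F (fun t => z * G t) = z^* * ip F G.
Proof.
by move=> sF sG; rewrite ipC ?ipZl// ?rmorphM /= -?ipC//; exact: sqintZ.
Qed.

Lemma ipNl F G : sqint F -> sqint G -> ip (fun t => - F t) G = - ip F G.
Proof.
move=> sF sG; rewrite -mulN1r -ipZl//.
by apply: eq_mean => t _; rewrite mulN1r.
Qed.

Lemma ipBl F G H : sqint F -> sqint G -> sqint H ->
  ip (fun t => F t - G t) H = ip F H - ip G H.
Proof. by move=> sF sG sH; rewrite ipDl ?ipNl//; exact: sqintN. Qed.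

Lemma ae_eq_ip F G F' G' : cmeas F -> cmeas G -> cmeas F' -> cmeas G' ->
  ae_eq mu (@arc R) F F' -> ae_eq mu (@arc R) G G' -> ip F G = ip F' G'.
Proof.
move=> mF mG mF' mG' FF GG; apply: ae_eq_mean;
  try by apply: cmeasM => //; exact: cmeasC.
apply: (ae_eq_trans (ae_eq_mul2r _ FF)).
by apply: ae_eq_mul2l; exact: (ae_eq_comp (fun z => z^*) GG).
Qed.

Lemma n2E F : n2 F = rmean (fun t => cabs (F t) ^+ 2).
Proof. by apply: eq_rmean => t _; rewrite mulC_conj. Qed.

Lemma ip_selfE F : sqint F -> ip F F = (n2 F)%:C%C.
Proof.
move=> sF; apply: complex_ext => //=; rewrite -(rmean_cst 0).
by apply: eq_rmean => t _; rewrite mulC_conj.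
Qed.

Lemma cabs2_int F : sqint F -> integrable_arc (fun t => cabs (F t) ^+ 2).
Proof.
move=> sF; have [h _] := sqint_cintMC sF sF.
by apply: eq_integrable_arc h => t _; rewrite mulC_conj.
Qed.

Lemma n2_ge0 F : 0 <= n2 F.
Proof. by rewrite n2E; apply: rmean_ge0 => t _; rewrite sqr_ge0. Qed.

Lemma nrm_ge0 F : 0 <= nrm F.
Proof. exact: sqrtr_ge0. Qed.

Lemma nrm_sqr F : nrm F ^+ 2 = n2 F.
Proof. by rewrite sqr_sqrtr// n2_ge0. Qed.

Lemma nrm_eq0 F : sqint F -> nrm F = 0 -> ae_eq mu (@arc R) F (cst 0).
Proof.
move=> sF h; have /rmean_eq0 : rmean (fun t => cabs (F t) ^+ 2) = 0.
  by rewrite -n2E -nrm_sqr h expr0n.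
move=> /(_ (cabs2_int sF) (fun t _ => sqr_ge0 _)).
apply: filterS => t + At => /(_ At)/eqP.
by rewrite sqrf_eq0 cabs_eq0 => /eqP.
Qed.

Lemma le_n2 F G M : sqint F -> sqint G -> 0 <= M ->
  (forall t, arc t -> cabs (F t) <= M * cabs (G t)) ->
  n2 F <= M ^+ 2 * n2 G.
Proof.
move=> sF sG M0 FG; rewrite !n2E -rmeanZ; last exact: cabs2_int.
apply: le_rmean; first exact: cabs2_int.
  by apply: integrable_arcZ; exact: cabs2_int.
move=> t At; rewrite -exprMn lerXn2r ?nnegrE ?cabs_ge0 ?mulr_ge0 ?cabs_ge0//.
exact: FG.
Qed.

Lemma le_nrm F G M : sqint F -> sqint G -> 0 <= M ->
  (forall t, arc t -> cabs (F t) <= M * cabs (G t)) ->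
  nrm F <= M * nrm G.
Proof.
move=> sF sG M0 FG; rewrite -(@ler_pXn2r _ 2)// ?nnegrE ?mulr_ge0 ?nrm_ge0//.
by rewrite exprMn !nrm_sqr le_n2.
Qed.

Lemma nrm_cst z : nrm (cst z) = cabs z.
Proof.
rewrite /nrm n2E (_ : (fun _ => _) = cst (cabs z ^+ 2))// rmean_cst.
by rewrite sqrtr_sqr ger0_norm// cabs_ge0.
Qed.

Lemma nrm_bounded F M : sqint F -> 0 <= M ->
  (forall t, arc t -> cabs (F t) <= M) -> nrm F <= M.
Proof.
move=> sF M0 FM; have := le_nrm sF (sqint_cst 1) M0.
by rewrite nrm_cst cabs1 mulr1; apply.
Qed.

Lemma n2_lincomb (a : R) z F G : sqint F -> sqint G ->
  n2 (fun t => a%:C%C * F t + z * G t) =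
  a ^+ 2 * n2 F + cabs z ^+ 2 * n2 G + 2 * a * Re (z^* * ip F G).
Proof.
move=> sF sG.
have saF := sqintZ a%:C%C sF; have szG := sqintZ z sG.
rewrite /n2 ipDl ?ipDr//; try exact: sqintD.
rewrite !ipZl// !ipZr// (ipC sG sF) !ip_selfE//.
rewrite cabs_sqrE !ReD !(ReM, ImM, ReC, ImC) /=.
by ring.
Qed.

(** Positivity of the squared norm of [s F - <F,G> G] for every real [s] forces
    the Cauchy-Schwarz inequality, including when one of the norms is zero. *)
Lemma cauchy_schwarz F G : sqint F -> sqint G ->
  cabs (ip F G) <= nrm F * nrm G.
Proof.
move=> sF sG; rewrite -(@ler_pXn2r _ 2)// ?nnegrE ?cabs_ge0 ?mulr_ge0 ?nrm_ge0//.
rewrite exprMn !nrm_sqr.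
set x := cabs (ip F G) ^+ 2; set A := n2 F; set B := n2 G.
have x0 : 0 <= x by exact: sqr_ge0.
have A0 : 0 <= A by exact: n2_ge0.
have B0 : 0 <= B by exact: n2_ge0.
have key s : 0 <= s ^+ 2 * A + x * B - 2 * s * x.
  have := n2_ge0 (fun t => s%:C%C * F t + (- ip F G) * G t).
  rewrite n2_lincomb// cabsN -/x -/A -/B.
  by rewrite rmorphN mulNr ReN mulrC [(ip F G)^* * _]mulrC mulC_conj /= -/x; lra.
have [A1|A1] := eqVneq A 0.
  by have := key ((B + 1) / 2); rewrite A1; lra.
have Ap : 0 < A by rewrite lt_def A1.
have := key (x / A).
have -> : (x / A) ^+ 2 * A + x * B - 2 * (x / A) * x = x * (A * B - x) / A by field.
rewrite pmulr_lge0 ?invr_gt0//.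
have [->|x1] := eqVneq x 0; first by move=> _; rewrite mulr_ge0.
by rewrite pmulr_rge0 ?subr_ge0// lt_def x1.
Qed.

Lemma nrmD F G : sqint F -> sqint G ->
  nrm (fun t => F t + G t) <= nrm F + nrm G.
Proof.
move=> sF sG; rewrite -(@ler_pXn2r _ 2)// ?nnegrE ?addr_ge0 ?nrm_ge0//.
have := n2_lincomb 1 1 sF sG.
rewrite (_ : (fun t => _) = (fun t => F t + G t)); last first.
  by apply/funext => t; rewrite !mul1r.
rewrite nrm_sqr sqrrD !nrm_sqr => ->.
rewrite cabs1 expr1n !mul1r mulr1 conjC1 mul1r.
have := cauchy_schwarz sF sG; have := Re_le_cabs (ip F G).
by have := ler_norm (Re (ip F G)); rewrite mulr2n; lra.
Qed.

Lemma nrmZ z F : sqint F -> nrm (fun t => z * F t) = cabs z * nrm F.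
Proof.
move=> sF; apply/eqP; rewrite -(@eqrXn2 _ 2)// ?mulr_ge0 ?cabs_ge0 ?nrm_ge0//.
rewrite exprMn !nrm_sqr !n2E -rmeanZ; last exact: cabs2_int.
by apply/eqP; apply: eq_rmean => t _; rewrite cabsM exprMn.
Qed.

Lemma nrmN F : nrm (fun t => - F t) = nrm F.
Proof. by rewrite /nrm !n2E; congr Num.sqrt; apply: eq_rmean => t _; rewrite cabsN. Qed.

Lemma nrmB F G : sqint F -> sqint G ->
  nrm (fun t => F t - G t) <= nrm F + nrm G.
Proof. by move=> sF sG; rewrite -(nrmN G) nrmD//; exact: sqintN. Qed.

Lemma nrm0 : nrm (fun=> 0) = 0.
Proof. by rewrite nrm_cst cabs0. Qed.

Lemma ae_eq_nrm F G : cmeas F -> cmeas G -> ae_eq mu (@arc R) F G ->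
  nrm F = nrm G.
Proof. by move=> mF mG FG; rewrite /nrm /n2 (ae_eq_ip mF mF mG mG FG FG). Qed.

End ComplexPeriod.

(** * Density of the trigonometric polynomials *)

Section TrigonometricPolynomials.
Variable R : realType.
Implicit Types (F G : R -> R[i]) (t : R) (p : {poly R[i]}).

Lemma horner_bounded p : exists2 M, 0 <= M & forall t, cabs p.[cis t] <= M.
Proof.
elim/poly_ind: p => [|p c [M M0 h]].
  by exists 0 => // t; rewrite horner0 cabs0.
exists (M + cabs c) => [|t]; first by rewrite addr_ge0// cabs_ge0.
rewrite hornerMXaddC (le_trans (cabsD _ _))// lerD2r cabsM cabs_cis mulr1.
exact: h.
Qed.

Lemma cmeas_horner p : cmeas (fun t => p.[cis t]).
Proof.
elim/poly_ind: p => [|p c h].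
  by under eq_fun do rewrite horner0; exact: cmeas_cst.
under eq_fun do rewrite hornerMXaddC; apply: cmeasD; last exact: cmeas_cst.
by apply: cmeasM => //; apply: (@cmeas_cis _ idfun) => t; exact: cvg_id.
Qed.

Lemma sqint_horner p : sqint (fun t => p.[cis t]).
Proof.
have [M _ h] := horner_bounded p.
by apply: (@bounded_sqint _ _ M) => //; exact: cmeas_horner.
Qed.

(** A trigonometric polynomial is a polynomial in [z] divided by a power of [z],
    which on the circle is a power of the conjugate. *)
Definition tpoly N p t : R[i] := (cis t)^* ^+ N * p.[cis t].

Definition is_trig F := exists N p, forall t, F t = tpoly N p t.

Lemma is_trig_cst z : is_trig (cst z).
Proof. by exists 0, z%:P => t; rewrite /tpoly hornerC expr0 mul1r. Qed.

Lemma is_trig_cis : is_trig (@cis R).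
Proof. by exists 0, 'X => t; rewrite /tpoly hornerX expr0 mul1r. Qed.

Lemma is_trig_cisC : is_trig (fun t => (cis t)^*).
Proof. by exists 1, 1%:P => t; rewrite /tpoly hornerC expr1 mulr1. Qed.

Lemma tpoly_raise N M p t : tpoly N p t = tpoly (N + M) (p * 'X^M) t.
Proof.
rewrite /tpoly hornerM hornerXn exprD.
have -> : (cis t)^* ^+ N * (cis t)^* ^+ M * (p.[cis t] * cis t ^+ M) =
  (cis t)^* ^+ N * p.[cis t] * (cis t * (cis t)^*) ^+ M.
  by rewrite exprMn; ring.
by rewrite cis_mulC expr1n mulr1.
Qed.

Lemma is_trigD F G : is_trig F -> is_trig G -> is_trig (fun t => F t + G t).
Proof.
move=> [N [p Fp]] [M [r Gr]]; exists (N + M)%N, (p * 'X^M + r * 'X^N) => t.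
rewrite Fp Gr (tpoly_raise N M) (tpoly_raise M N) addnC.
by rewrite /tpoly hornerD mulrDr.
Qed.

Lemma is_trigM F G : is_trig F -> is_trig G -> is_trig (fun t => F t * G t).
Proof.
move=> [N [p Fp]] [M [r Gr]]; exists (N + M)%N, (p * r) => t.
by rewrite Fp Gr /tpoly hornerM exprD; ring.
Qed.

Lemma is_trigX F n : is_trig F -> is_trig (fun t => F t ^+ n).
Proof.
move=> tF; elim: n => [|n IH].
  by under eq_fun do rewrite expr0; exact: is_trig_cst.
by under eq_fun do rewrite exprS; exact: is_trigM.
Qed.

Lemma sqint_trig F : is_trig F -> sqint F.
Proof.
move=> [N [p Fp]]; rewrite (funext Fp).
apply: (@sqint_bounded _ _ 1); last exact: sqint_horner.
  elim: N {Fp} => [|N IH]; first by under eq_fun do rewrite expr0; exact: cmeas_cst.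
  under eq_fun do rewrite exprS; apply: cmeasM => //.
  by apply: cmeasC; apply: (@cmeas_cis _ idfun) => t; exact: cvg_id.
by move=> t _; rewrite cabsX cabsC cabs_cis expr1n.
Qed.

Definition trig_approx F := sqint F /\
  forall e : R, 0 < e -> exists2 G, is_trig G & nrm (fun t => F t - G t) <= e.

Lemma trig_approx_trig F : is_trig F -> trig_approx F.
Proof.
move=> tF; split; first exact: sqint_trig.
move=> e e0; exists F => //; rewrite (_ : (fun _ => _) = fun=> 0) ?nrm0 ?ltW//.
by apply/funext => t; rewrite subrr.
Qed.

Lemma trig_approx_lim F : sqint F ->
  (forall e : R, 0 < e -> exists2 G, trig_approx G &
    nrm (fun t => F t - G t) <= e) -> trig_approx F.
Proof.
move=> sF h; split => // e e0; have e2 : 0 < e / 2 by rewrite divr_gt0.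
have [G [sG aG] FG] := h _ e2; have [H tH GH] := aG _ e2.
exists H => //; have sH := sqint_trig tH.
rewrite (_ : (fun _ => _) = (fun t => (F t - G t) + (G t - H t))); last first.
  by apply/funext => t; rewrite addrA subrK.
rewrite (le_trans (nrmD _ _))//; try exact: sqintB.
by rewrite [leRHS](splitr e) lerD.
Qed.

Lemma trig_approxD F G : trig_approx F -> trig_approx G ->
  trig_approx (fun t => F t + G t).
Proof.
move=> [sF aF] [sG aG]; split; first exact: sqintD.
move=> e e0; have e2 : 0 < e / 2 by rewrite divr_gt0.
have [F' tF FF] := aF _ e2; have [G' tG GG] := aG _ e2.
exists (fun t => F' t + G' t); first exact: is_trigD.
have sF' := sqint_trig tF; have sG' := sqint_trig tG.
rewrite (_ : (fun _ => _) = (fun t => (F t - F' t) + (G t - G' t))); last first.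
  by apply/funext => t; ring.
rewrite (le_trans (nrmD _ _))//; try exact: sqintB.
by rewrite [leRHS](splitr e) lerD.
Qed.

Lemma trig_approxZ z F : trig_approx F -> trig_approx (fun t => z * F t).
Proof.
move=> [sF aF]; split; first exact: sqintZ.
move=> e e0; have m0 : 0 < cabs z + 1 by rewrite ltr_wpDl// cabs_ge0.
have [F' tF FF] := aF (e / (cabs z + 1)) (divr_gt0 e0 m0).
exists (fun t => z * F' t); first exact: is_trigM (is_trig_cst z) tF.
rewrite (_ : (fun _ => _) = (fun t => z * (F t - F' t))); last first.
  by apply/funext => t; rewrite mulrBr.
rewrite nrmZ; last by apply: sqintB => //; exact: sqint_trig.
rewrite (le_trans (ler_wpM2l (cabs_ge0 _) FF))// mulrA ler_pdivrMr// mulrC.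
by rewrite ler_pM2l// lerDl.
Qed.

End TrigonometricPolynomials.

Section RealApproximation.
Variable R : realType.
Implicit Types (u v : R -> R) (t x y : R).
Local Notation mu := (@lebesgue_measure R).
Local Notation Re := (@complex.Re R).
Local Notation Im := (@complex.Im R).

Lemma sqint_real u : rL2 u -> sqint (fun t => (u t)%:C%C).
Proof. by move=> h; apply/sqintP; split => //=; exact: (rL2_cst 0). Qed.

Lemma rL2_bnd u (M : R) : measurable_fun (@arc R) u ->
  (forall t, arc t -> `|u t| <= M) -> rL2 u.
Proof.
move=> mu0 uM; have := rL2_bounded mu0 uM (rL2_cst 1).
by rewrite (_ : (fun t => _) = u)//; apply/funext => t; rewrite mulr1.
Qed.

Lemma dominated_nrm (un : nat -> R -> R) u v :
  (forall n, rL2 (un n)) -> rL2 u -> rL2 v ->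
  {ae mu, forall t, arc t -> un ^~ t @ \oo --> u t} ->
  (forall n t, arc t -> `|u t - un n t| <= v t) ->
  forall e : R, 0 < e ->
    exists n, nrm (fun t => (u t)%:C%C - (un n t)%:C%C) <= e.
Proof.
move=> sun su sv cu uv e e0.
have sd n : rL2 (fun t => u t - un n t) by apply: rL2D => //; exact: rL2N.
have h : (fun n => rmean (fun t => (u t - un n t) ^+ 2)) @ \oo --> rmean (cst (0:R)).
  apply: (@dominated_rmean _ (fun n t => (u t - un n t) ^+ 2) _ (fun t => v t ^+ 2)).
  - by move=> n; apply: measurable_funX; have [] := sd n.
  - exact: measurable_cst.
  - move: cu => [N [mN N0 sN]]; exists N; split => //.
    apply: subset_trans sN => t; apply: contra_not => h At.
    have hh : (fun n => u t - un n t) @ \oo --> u t - u t.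
      by apply: cvgB; [exact: cvg_cst|exact: h].
    have hm : (fun n => (u t - un n t) * (u t - un n t)) @ \oo -->
        (u t - u t) * (u t - u t) by apply: cvgM.
    by rewrite subrr mulr0 in hm; exact: hm.
  - by case: sv.
  - move=> n t At; rewrite ger0_norm ?sqr_ge0// -real_normK ?num_real//.
    by rewrite lerXn2r ?nnegrE ?uv// (le_trans _ (uv n t At)).
rewrite rmean_cst in h.
have /cvgrPdist_le/(_ (e ^+ 2)) := h.
move=> /(_ (exprn_gt0 _ e0)) [n _ /(_ n (leqnn n))].
rewrite sub0r normrN => hn; exists n.
rewrite -(@ler_pXn2r _ 2)// ?nnegrE ?nrm_ge0 ?(ltW e0)// nrm_sqr n2E.
apply: le_trans hn; apply: le_trans (ler_norm _); rewrite le_eqVlt; apply/orP; left.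
by apply/eqP/eq_rmean => t _; rewrite -rmorphB cabs_real real_normK ?num_real.
Qed.

Lemma bernoulli_le (a : R) m : 0 <= a <= 1 -> 1 - m%:R * a <= (1 - a) ^+ m.
Proof.
move=> /andP[a0 a1]; elim: m => [|m IH]; first by rewrite mul0r subr0 expr0.
have m0 : 0 <= m%:R :> R by [].
rewrite exprS -natr1; apply: le_trans (ler_wpM2l _ IH); last by rewrite subr_ge0.
by have := mulr_ge0 m0 (sqr_ge0 a); move: (m%:R) => b; rewrite expr2; nra.
Qed.

(** From [1 + m a <= (1 + a)^m] and [(1 - a)(1 + a) <= 1]. *)
Lemma bernoulli_ge (a : R) m : 0 <= a <= 1 ->
  (1 - a) ^+ m * (1 + m%:R * a) <= 1.
Proof.
move=> /andP[a0 a1]; elim: m => [|m IH]; first by rewrite mul0r addr0 expr0 mulr1.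
have p0 : 0 <= (1 - a) ^+ m by rewrite exprn_ge0// subr_ge0.
have m0 : 0 <= m%:R :> R by [].
apply: le_trans IH; rewrite exprS -natr1.
have := mulr_ge0 p0 (mulr_ge0 (addr_ge0 m0 ler01) (sqr_ge0 a)).
by move: (m%:R) (_ ^+ m) => b c; rewrite expr2; nra.
Qed.

(** As [n] grows, [(1 - y^n)^(2^n)] converges to the indicator of [y < 1/2] on
    [0, 1], except at [y = 1/2]: by Bernoulli's inequality it is at least
    [1 - (2 y)^n] and at most [(2 y)^-n]. *)
Definition step_pow n y : R := (1 - y ^+ n) ^+ (2 ^ n).

Lemma step_pow_ge0 n y : 0 <= y <= 1 -> 0 <= step_pow n y <= 1.
Proof.
move=> /andP[y0 y1]; have yn : 0 <= y ^+ n <= 1.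
  by rewrite exprn_ge0//= exprn_ile1.
move/andP: yn => [a b].
by rewrite exprn_ge0 ?subr_ge0// exprn_ile1// ?subr_ge0// gerBl.
Qed.

Lemma step_pow_cvg1 y : 0 <= y < 1 / 2 -> (step_pow ^~ y) @ \oo --> (1 : R).
Proof.
move=> /andP[y0 y1]; have y2 : 0 <= y <= 1 by apply/andP; split; lra.
apply: (@squeeze_cvgr _ _ _ _ (fun n => 1 - (2 * y) ^+ n) (cst 1)).
- apply: nearW => n; have /andP[_ ->] := step_pow_ge0 n y2; rewrite andbT.
  rewrite exprMn -natrX; apply: bernoulli_le.
  by case/andP: y2 => *; rewrite exprn_ge0//= exprn_ile1.
- rewrite -[X in _ --> X](subr0 1); apply: cvgB; first exact: cvg_cst.
  by apply: cvg_expr; rewrite ger0_norm; lra.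
- exact: cvg_cst.
Qed.

Lemma step_pow_cvg0 y : 1 / 2 < y <= 1 -> (step_pow ^~ y) @ \oo --> (0 : R).
Proof.
move=> /andP[y1 y2]; have y01 : 0 <= y <= 1 by apply/andP; split; lra.
have c0 : 0 < 2 * y by lra.
apply: (@squeeze_cvgr _ _ _ _ (cst 0) (fun n => (2 * y)^-1 ^+ n)).
- apply: nearW => n; have /andP[s0 _] := step_pow_ge0 n y01; rewrite s0 /=.
  have yn : 0 <= y ^+ n <= 1 by case/andP: y01 => *; rewrite exprn_ge0//= exprn_ile1.
  have := bernoulli_ge (2 ^ n) yn; rewrite -/(step_pow n y) natrX -exprMn => h.
  rewrite exprVn -[leRHS]mul1r ler_pdivlMr ?exprn_gt0//.
  by apply: le_trans h; rewrite ler_wpM2l// lerDr.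
- exact: cvg_cst.
- apply: cvg_expr; rewrite ger0_norm ?invr_ge0 ?(ltW c0)// invf_lt1//; lra.
Qed.

(** For [t] inside the period, [sin (t/2)] is positive and [sin ((x-t)/2)] has the sign of
    [x - t], so the value exceeds [1/2] exactly beyond [x]; being affine in
    [cos (t - x/2)], this is a trigonometric polynomial with values in [0, 1]. *)
Definition threshold x t : R := 1 / 2 - sin (t / 2) * sin ((x - t) / 2) / 2.

Lemma thresholdE x t :
  threshold x t = 1 / 2 + (cos (x / 2) - cos (t - x / 2)) / 4.
Proof.
rewrite /threshold.
have e1 : x / 2 = t / 2 + (x - t) / 2 by field.
have e2 : t - x / 2 = t / 2 - (x - t) / 2 by field.
rewrite [in RHS]e2 [X in cos X - _]e1 cosD cosB; lra.
Qed.

Lemma threshold_bnd x t : 0 <= threshold x t <= 1.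
Proof.
rewrite thresholdE; have := cos_geN1 (x / 2); have := cos_le1 (x / 2).
have := cos_geN1 (t - x / 2); have := cos_le1 (t - x / 2) => *.
by apply/andP; split; lra.
Qed.

Lemma threshold_lt x t : 0 < t -> t < x -> x <= pi *+ 2 -> threshold x t < 1 / 2.
Proof.
move=> t0 tx x2; have p0 := @pi_gt0 R; rewrite mulr2n in x2.
have s1 : 0 < sin (t / 2) by apply: sin_gt0_pi; apply/andP; split; lra.
have s2 : 0 < sin ((x - t) / 2) by apply: sin_gt0_pi; apply/andP; split; lra.
by have := mulr_gt0 s1 s2; rewrite /threshold; lra.
Qed.

Lemma threshold_gt x t : 0 <= x -> x < t -> t < pi *+ 2 -> 1 / 2 < threshold x t.
Proof.
move=> x0 xt t2; have p0 := @pi_gt0 R; rewrite mulr2n in t2.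
have s1 : 0 < sin (t / 2) by apply: sin_gt0_pi; apply/andP; split; lra.
have s2 : 0 < sin ((t - x) / 2) by apply: sin_gt0_pi; apply/andP; split; lra.
have := mulr_gt0 s1 s2; rewrite /threshold.
by rewrite -[x - t]opprB mulNr sinN mulrN; lra.
Qed.

Lemma is_trig_step n x : is_trig (fun t => (step_pow n (threshold x t))%:C%C).
Proof.
have -> : (fun t => (step_pow n (threshold x t))%:C%C) =
    (fun t => (1 + -1 * ((threshold x t)%:C%C) ^+ n) ^+ (2 ^ n)).
  by apply/funext => t; rewrite !(rmorphXn, rmorphB) rmorph1 mulN1r.
apply: is_trigX; apply: is_trigD; first exact: is_trig_cst.
apply: is_trigM; first exact: is_trig_cst.
apply: is_trigX.
pose c : R[i] := cis (x / 2).
have -> : (fun t => (threshold x t)%:C%C) =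
    (fun t => (1 / 2 + cos (x / 2) / 4)%:C%C +
      ((- (1 / 8))%:C%C * c^* * cis t + (- (1 / 8))%:C%C * c * (cis t)^*)).
  apply/funext => t; rewrite thresholdE cosB; apply: complex_ext.
    by rewrite !(ReD, ImD, ReM, ImM, ReC, ImC) /=; field.
  by rewrite !(ReD, ImD, ReM, ImM, ReC, ImC) /=; field.
apply: is_trigD; first exact: is_trig_cst.
apply: is_trigD; apply: is_trigM; try exact: is_trig_cst.
  exact: is_trig_cis.
exact: is_trig_cisC.
Qed.

End RealApproximation.

Section Density.
Variable R : realType.
Implicit Types (F G : R -> R[i]) (u v : R -> R) (t x y : R) (p : {poly R[i]}).
Local Notation mu := (@lebesgue_measure R).

Definition indic (A : set R) t : R := \1_A t.

Lemma indicE (A : set R) t : indic A t = (t \in A)%:R.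
Proof. by rewrite /indic indicE. Qed.

Lemma indic01 (A : set R) t : 0 <= indic A t <= 1.
Proof. by rewrite indicE; case: (_ \in _); rewrite /= ?ler01 lexx. Qed.

Lemma rL2_indic (A : set R) : measurable A -> rL2 (indic A).
Proof.
move=> mA; apply: (@rL2_bnd _ _ 1).
  exact: measurable_indic.
by move=> t _; have /andP[a0 a1] := indic01 A t; rewrite ger0_norm.
Qed.

Definition approx_set (A : set R) :=
  measurable A /\ trig_approx (fun t => (indic A t)%:C%C).

Lemma trig_approx_real_lim (un : nat -> R -> R) u v :
  (forall n, trig_approx (fun t => (un n t)%:C%C)) ->
  (forall n, rL2 (un n)) -> rL2 u -> rL2 v ->
  {ae mu, forall t, arc t -> un ^~ t @ \oo --> u t} ->
  (forall n t, arc t -> `|u t - un n t| <= v t) ->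
  trig_approx (fun t => (u t)%:C%C).
Proof.
move=> aun sun su sv cu uv; apply: trig_approx_lim; first exact: sqint_real.
move=> e e0; have [n hn] := dominated_nrm sun su sv cu uv e0.
by exists (fun t => (un n t)%:C%C).
Qed.

Lemma ae_except (s : seq R) (P : R -> Prop) :
  (forall t, t \notin s -> P t) -> {ae mu, forall t, P t}.
Proof.
move=> h; exists [set` s]; split.
- apply: countable_measurable => [x|]; first exact: measurable_set1.
  by apply: finite_set_countable; exact: finite_seq.
- by apply: countable_lebesgue_measure0; apply: finite_set_countable; exact: finite_seq.
- by move=> t /= nP; apply/negPn/negP => ns; exact: nP (h t ns).
Qed.

(** The indicator of a ray is the limit of [1 - step_pow n (threshold x t)], which
    is dominated by [1]; the convergence fails at most at [0], [x] and [2 pi]. *)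
Lemma trig_approx_below x : 0 <= x <= pi *+ 2 ->
  trig_approx (fun t => (indic `]x, +oo[%classic t)%:C%C).
Proof.
move=> /andP[x0 x2].
apply: (@trig_approx_real_lim (fun n t => 1 - step_pow n (threshold x t)) _ (cst 1)).
- move=> n; apply: trig_approx_trig.
  have -> : (fun t => (1 - step_pow n (threshold x t))%:C%C) =
      (fun t => 1 + -1 * (step_pow n (threshold x t))%:C%C).
    by apply/funext => t; rewrite rmorphB rmorph1 mulN1r.
  apply: is_trigD; first exact: is_trig_cst.
  by apply: is_trigM; [exact: is_trig_cst|exact: is_trig_step].
- move=> n; apply: rL2D; first exact: rL2_cst.
  apply: rL2N; have /sqintP[h _] := sqint_trig (is_trig_step n x).
  exact: h.
- by apply: rL2_indic; exact: measurable_itv.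
- exact: rL2_cst.
- apply: (@ae_except [:: 0; x; pi *+ 2]) => t.
  rewrite !inE !negb_or => /and3P[t0 tx t2] /arcP/andP[t0' t2'].
  have tp : 0 < t by rewrite lt_def t0.
  have tq : t < pi *+ 2 by rewrite lt_def eq_sym t2.
  have /andP[b0 b1] := threshold_bnd x t.
  case: (ltP t x) => [tlx|xlt].
    rewrite indicE memNset; last by rewrite /= in_itv/= andbT; apply/negP; rewrite -leNgt ltW.
    rewrite [X in _ --> X](_ : _ = 1 - 1); last by rewrite subrr.
    apply: cvgB; first exact: cvg_cst.
    by apply: step_pow_cvg1; rewrite b0 threshold_lt.
  have xt : x < t by rewrite lt_def tx.
  rewrite indicE mem_set; last by rewrite /= in_itv/= xt.
  rewrite [X in _ --> X](_ : _ = 1 - 0); last by rewrite subr0.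
  apply: cvgB; first exact: cvg_cst.
  by apply: step_pow_cvg0; rewrite b1 threshold_gt.
- move=> n t _; have /andP[s0 s1] := step_pow_ge0 n (threshold_bnd x t).
  have /andP[i0 i1] := indic01 `]x, +oo[%classic t.
  by rewrite ler_norml /=; apply/andP; split; lra.
Qed.

Lemma eq_trig_approx F G : (forall t, arc t -> F t = G t) -> sqint G ->
  trig_approx F -> trig_approx G.
Proof.
move=> FG sG [sF aF]; apply: trig_approx_lim => // e e0; exists F => //.
rewrite (_ : nrm _ = 0) ?ltW// /nrm (_ : n2 _ = 0) ?sqrtr0//.
rewrite n2E -[RHS]rmean_cst; apply: eq_rmean => t At.
by rewrite FG// subrr cabs0 expr0n.
Qed.

Lemma approx_set_ray x : approx_set `]x, +oo[%classic.
Proof.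
have m : measurable (`]x, +oo[%classic : set R) by exact: measurable_itv.
split => //; have sI := sqint_real (rL2_indic m).
have [x0|x0] := ltP x 0.
  apply: (@eq_trig_approx (cst 1)) => //; last exact: trig_approx_trig (is_trig_cst _).
  move=> t /arcP/andP[t0 _].
  by rewrite indicE mem_set//= in_itv/= (lt_le_trans x0).
have [x2|x2] := leP x (pi *+ 2); first by apply: trig_approx_below; rewrite x0.
apply: (@eq_trig_approx (cst 0)) => //; last exact: trig_approx_trig (is_trig_cst _).
move=> t /arcP/andP[_ t2].
by rewrite indicE memNset//= in_itv/= andbT; apply/negP; rewrite -leNgt (le_trans t2)// ltW.
Qed.

Lemma approx_set_lambda : lambda_system setT approx_set.
Proof.
split => //.
- split; first exact: measurableT.
  have -> : (fun t => (indic setT t)%:C%C) = cst 1.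
    by apply/funext => t; rewrite indicE mem_set.
  exact: trig_approx_trig (is_trig_cst _).
- move=> A B BA [mA aA] [mB aB]; split; first exact: measurableD.
  have -> : (fun t => (indic (A `\` B) t)%:C%C) =
      (fun t => (indic A t)%:C%C + -1 * (indic B t)%:C%C).
    apply/funext => t; rewrite mulN1r -rmorphB; congr (_%:C%C).
    rewrite !indicE in_setD; case: (boolP (t \in B)) => tB.
      by rewrite andbF (mem_set (BA _ (set_mem tB))) subrr.
    by rewrite andbT subr0.
  by apply: trig_approxD => //; exact: trig_approxZ.
- move=> A ndA hA; have mU : measurable (\bigcup_i A i).
    by apply: bigcupT_measurable => i; have [] := hA i.
  split => //.
  apply: (@trig_approx_real_lim (fun n => indic (A n)) _ (cst 1)).
  - by move=> n; have [] := hA n.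
  - by move=> n; apply: rL2_indic; have [] := hA n.
  - exact: rL2_indic.
  - exact: rL2_cst.
  - apply: aeW => t _; apply: cvg_near_cst.
    case: (pselect ((\bigcup_i A i) t)) => [[n _ Ant]|nU].
      near=> m; rewrite !indicE !mem_set//; first by exists n.
      have nm : (n <= m)%N by near: m; exact: nbhs_infty_ge.
      by have /subsetPset := ndA _ _ nm; apply.
    by apply: nearW => m; rewrite !indicE !memNset// => Amt; apply: nU; exists m.
  - move=> n t _; have /andP[a0 a1] := indic01 (A n) t.
    have /andP[b0 b1] := indic01 (\bigcup_i A i) t.
    by rewrite ler_norml /=; apply/andP; split; lra.
Unshelve. all: by end_near. Qed.

(** Sierpinski-Dynkin: the sets with approximable indicator form a lambda-system
    containing the pi-system of open rays. *)
Lemma approx_set_measurable (A : set R) : measurable A -> approx_set A.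
Proof.
move=> mA; have : <<s (@RGenOInfty.G R) >> A.
  by rewrite -[<<s _ >>]/((@RGenOInfty.G R).-sigma.-measurable) -RGenOInfty.measurableE.
apply: (@lambda_system_subset _ _ _ setT) => //.
- move=> _ _ [x ->] [y ->]; exists (Num.max x y).
  by apply/seteqP; split => t /=; rewrite !in_itv/= !andbT gt_max;
    [move=> [-> ->]|move=> /andP[]].
- exact: approx_set_lambda.
- by move=> _ [x ->]; exact: approx_set_ray.
Qed.

Import HBNNSimple.

Lemma trig_approx_nnsfun (g : {nnsfun R >-> R}) :
  trig_approx (fun t => (g t)%:C%C).
Proof.
have -> : (fun t => (g t)%:C%C) = (fun t =>
    \sum_(y <- finmap.enum_fset (fset_set (range g))) y%:C%C * (indic (g @^-1` [set y]) t)%:C%C).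
  apply/funext => t; rewrite fimfunE fsbig_finite//= rmorph_sum.
  by apply: eq_bigr => y _; rewrite rmorphM.
elim: (finmap.enum_fset _) => [|y s IH].
  have -> : (fun t : R => \sum_(y <- [::]) y%:C%C * (indic (g @^-1` [set y]) t)%:C%C)
      = cst 0 by apply/funext => t; rewrite big_nil.
  exact: trig_approx_trig (is_trig_cst _).
under eq_fun do rewrite big_cons.
apply: trig_approxD; last exact: IH.
apply: trig_approxZ.
have mS : measurable (g @^-1` [set y]) by exact: measurable_sfunP.
exact: (approx_set_measurable mS).2.
Qed.

(** A function is the increasing limit of simple functions below it, so the square
    of the difference is dominated by [u^2]. *)
Lemma trig_approx_nonneg u : rL2 u -> (forall t, 0 <= u t) ->
  trig_approx (fun t => (u t)%:C%C).
Proof.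
move=> su u0; have [mu0 _] := su.
have mf : measurable_fun (@arc R) (EFin \o u) by exact/measurable_EFinP.
have f0 t : arc t -> (0 <= (EFin \o u) t)%E by rewrite /= lee_fin u0.
pose g := nnsfun_approx (@measurable_arc R) mf.
have gu n t : arc t -> g n t <= u t.
  move=> At; rewrite -lee_fin /g nnsfun_approxE.
  exact: (le_approx n f0 At).
apply: (@trig_approx_real_lim (fun n => g n) _ u) => //.
- by move=> n; exact: (trig_approx_nnsfun (g n)).
- by move=> n; have [/sqintP[h _] _] := trig_approx_nnsfun (g n); exact: h.
- apply: aeW => t At.
  have := cvg_nnsfun_approx (@measurable_arc R) mf f0 At.
  by move=> /fine_cvgP[].
- move=> n t At; rewrite ger0_norm ?subr_ge0 ?gu//.
  by rewrite gerBl; exact: fun_ge0.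
Qed.

Lemma trig_approx_real u : rL2 u -> trig_approx (fun t => (u t)%:C%C).
Proof.
move=> su; have sa : rL2 (fun t => `|u t|).
  have [mu0 iu] := su; split; first exact: measurableT_comp.
  apply: eq_integrable_arc iu => t _; by rewrite real_normK ?num_real.
have -> : (fun t => (u t)%:C%C) = (fun t => (2^-1 * (`|u t| + u t))%:C%C +
    -1 * (2^-1 * (`|u t| - u t))%:C%C).
  apply/funext => t; rewrite mulN1r -rmorphB; congr (_%:C%C); lra.
apply: trig_approxD; last apply: trig_approxZ.
  apply: (@trig_approx_nonneg (fun t => 2^-1 * (`|u t| + u t))).
    by apply: rL2Z; exact: rL2D.
  by move=> t; have := ler_norm (- u t); rewrite normrN; lra.
apply: (@trig_approx_nonneg (fun t => 2^-1 * (`|u t| - u t))).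
  by apply: rL2Z; apply: rL2D => //; exact: rL2N.
by move=> t; have := ler_norm (u t); lra.
Qed.

Lemma trig_dense F : sqint F -> trig_approx F.
Proof.
move=> /sqintP[sR sI].
have -> : F = (fun t => (complex.Re (F t))%:C%C +
    (Complex 0 1) * (complex.Im (F t))%:C%C).
  apply/funext => t; apply: complex_ext.
    by rewrite !(ReD, ReM)/=; ring.
  by rewrite !(ImD, ImM)/=; ring.
by apply: trig_approxD; last apply: trig_approxZ; exact: trig_approx_real.
Qed.

End Density.

(** * Rotation invariance *)

Section Translation.
Variable R : realType.
Implicit Types (u : R -> R) (s t : R) (D : set R).
Local Notation mu := (@lebesgue_measure R).

Definition shiftr s : R -> measurableTypeR R := fun t => t + s.

Lemma measurable_shift s : measurable_fun setT (shiftr s).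
Proof. by apply: measurable_funD => //; exact: measurable_cst. Qed.

Lemma preimage_shift (b1 b2 : bool) (a b s : R) :
  shiftr s @^-1` [set` Interval (BSide b1 a) (BSide b2 b)] =
  [set` Interval (BSide b1 (a - s)) (BSide b2 (b - s))].
Proof.
apply/seteqP; split => t /=; rewrite !in_itv/=;
  by case: b1; case: b2; rewrite /= ?lerBlDr ?lerBrDr ?ltrBlDr ?ltrBrDr.
Qed.

Lemma lebesgue_measure_shift s (A : set R) : measurable A ->
  pushforward mu (shiftr s) A = mu A.
Proof.
move=> mA; apply/esym/lebesgue_measure_unique => //=.
  exact: measurable_shift.
move=> ms _ [[a b]] _ <-.
rewrite /pushforward preimage_shift/= !lebesgue_measure_itv/=.
rewrite !lte_fin ltrD2r; case: ifP => // _.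
by congr (_%:E); ring.
Qed.

Lemma ge0_integral_shift s D (f : R -> \bar R) : measurable D ->
  measurable_fun D f -> {in D, forall t, (0 <= f t)%E} ->
  (\int[mu]_(t in shiftr s @^-1` D) (f \o shiftr s) t = \int[mu]_(t in D) f t)%E.
Proof.
move=> mD mf f0.
rewrite -ge0_integral_pushforward//=; last exact: measurable_shift.
apply: eq_measure_integral => /=; first exact: measurable_shift.
by move=> ms A mA _; exact: lebesgue_measure_shift.
Qed.

Lemma integral_shift s D u : measurable D -> measurable_fun D u ->
  (\int[mu]_(t in shiftr s @^-1` D) (u (t + s)%R)%:E =
   \int[mu]_(t in D) (u t)%:E)%E.
Proof.
move=> mD mu0; have mE : measurable_fun D (EFin \o u) by exact/measurable_EFinP.
transitivity (\int[mu]_(t in shiftr s @^-1` D) ((EFin \o u) \o shiftr s) t)%E => //.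
rewrite integralE [RHS]integralE.
under [X in (X - _ = _)%E]eq_integral do rewrite funepos_comp.
under [X in (_ - X = _)%E]eq_integral do rewrite funeneg_comp.
congr (_ - _)%E.
  exact: (ge0_integral_shift s mD (measurable_funepos mE) (fun t _ => funepos_ge0 _ t)).
exact: (ge0_integral_shift s mD (measurable_funeneg mE) (fun t _ => funeneg_ge0 _ t)).
Qed.

Lemma measurable_fun_shift s D u : measurable D -> measurable_fun D u ->
  measurable_fun (shiftr s @^-1` D) (fun t => u (t + s)).
Proof.
move=> mD mu0; apply: (@measurable_comp _ _ _ _ _ _ D u _ (shiftr s)) => //.
  by move=> _ [t Dt <-].
exact: measurable_funTS (measurable_shift s).
Qed.

Lemma integrable_shift s D u : measurable D ->
  mu.-integrable D (EFin \o u) ->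
  mu.-integrable (shiftr s @^-1` D) (EFin \o (fun t => u (t + s))).
Proof.
move=> mD /integrableP[/measurable_EFinP mu0 iu].
apply/integrableP; split.
  by apply/measurable_EFinP; exact: measurable_fun_shift.
apply: le_lt_trans iu.
have := @ge0_integral_shift s D (fun t => `|(u t)%:E|%E) mD.
move=> <- //.
by apply: measurableT_comp => //; exact/measurable_EFinP.
Qed.

End Translation.

(** A rotation by [s] cuts the period at [2 pi - s]; the first piece is translated
    onto the part of the period beyond [s] and the second one, by periodicity,
    onto the part before [s]. *)
Section Periodic.
Variable R : realType.
Implicit Types (u : R -> R) (s t : R).
Local Notation mu := (@lebesgue_measure R).

Variable u : R -> R.
Hypothesis perio : forall t, u (t + pi *+ 2) = u t.
Variable s : R.
Hypothesis s_arc : s \in `[0, pi *+ 2[.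

Let s0 : 0 <= s. Proof. by move: s_arc; rewrite in_itv/= => /andP[]. Qed.
Let s2 : s < pi *+ 2. Proof. by move: s_arc; rewrite in_itv/= => /andP[]. Qed.

Let D1 : set R := [set` `[s, pi *+ 2]].
Let D2 : set R := [set` `]0, s]].
Let E1 : set R := [set` `[0, pi *+ 2 - s]].
Let E2 : set R := [set` `]pi *+ 2 - s, pi *+ 2]].

Let mD1 : measurable D1. Proof. exact: measurable_itv. Qed.
Let mD2 : measurable D2. Proof. exact: measurable_itv. Qed.

Let pre1 : shiftr s @^-1` D1 = E1.
Proof. by rewrite /D1 preimage_shift subrr. Qed.

Let pre2 : shiftr (s - pi *+ 2) @^-1` D2 = E2.
Proof.
by rewrite /D2 preimage_shift sub0r opprB (_ : s + _ = pi *+ 2)//; ring.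
Qed.

Let arcE : @arc R = E1 `|` E2.
Proof.
apply/seteqP; split => t /=; rewrite /E1 /E2 /arc /= !in_itv/=.
  move=> /andP[t0 t2]; case: (leP t (pi *+ 2 - s)) => h; [left|right].
    by rewrite t0.
  by rewrite t2.
have := s0; have := s2 => a b [/andP[t0 t2]|/andP[t0 t2]]; apply/andP; split; lra.
Qed.

Let arcE' : @arc R = [set` `[0, s]] `|` [set` `]s, pi *+ 2]].
Proof.
apply/seteqP; split => t /=; rewrite /arc /= !in_itv/=.
  move=> /andP[t0 t2]; case: (leP t s) => h; [left|right]; last by rewrite t2.
  by rewrite t0.
have := s0; have := s2 => a b [/andP[t0 t2]|/andP[t0 t2]]; apply/andP; split; lra.
Qed.

Let shift2 t : u (t + (s - pi *+ 2)) = u (t + s).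
Proof. by rewrite -perio; congr u; ring. Qed.

Let sub1 : D1 `<=` @arc R.
Proof.
move=> t /=; rewrite /D1 /arc /= !in_itv/= => /andP[st ->].
by rewrite (le_trans s0 st).
Qed.

Let sub2 : D2 `<=` @arc R.
Proof.
move=> t /=; rewrite /D2 /arc /= !in_itv/= => /andP[t0 ts].
by rewrite (ltW t0) (le_trans ts (ltW s2)).
Qed.

Lemma measurable_rot : measurable_fun (@arc R) u ->
  measurable_fun (@arc R) (fun t => u (t + s)).
Proof.
move=> mu0; rewrite arcE; apply/measurable_funU.
- exact: measurable_itv.
- exact: measurable_itv.
split.
  rewrite -pre1; apply: measurable_fun_shift => //.
  exact: (measurable_funS (@measurable_arc R) sub1 mu0).
under eq_fun do rewrite -shift2.
rewrite -pre2; apply: measurable_fun_shift => //.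
exact: (measurable_funS (@measurable_arc R) sub2 mu0).
Qed.

Lemma integrable_rot : integrable_arc u -> integrable_arc (fun t => u (t + s)).
Proof.
move=> iu; have mu0 := measurable_rot (integrable_arc_meas iu).
have [i1 i2] : mu.-integrable E1 (EFin \o (fun t => u (t + s))) /\
    mu.-integrable E2 (EFin \o (fun t => u (t + s))).
  split.
    have := @integrable_shift R s D1 u mD1.
    rewrite pre1; apply.
    exact: (@integrableS _ _ _ mu _ _ (EFin \o u) (@measurable_arc R) mD1 sub1 iu).
  have -> : (fun t => u (t + s)) = (fun t => u (t + (s - pi *+ 2))).
    by apply/funext => t; rewrite shift2.
  have := @integrable_shift R (s - pi *+ 2) D2 u mD2.
  rewrite pre2; apply.
  exact: (@integrableS _ _ _ mu _ _ (EFin \o u) (@measurable_arc R) mD2 sub2 iu).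
have mE1 : measurable E1 by exact: measurable_itv.
have mE2 : measurable E2 by exact: measurable_itv.
rewrite /integrable_arc; apply/integrableP; split; first exact/measurable_EFinP.
rewrite arcE ge0_integral_setU//.
- by apply: lte_add_pinfty; [case/integrableP: i1|case/integrableP: i2].
- by rewrite -arcE; apply: measurableT_comp => //; exact/measurable_EFinP.
- apply/disj_setPS => t [/=]; rewrite /E1 /E2 /= !in_itv/= => /andP[_ h] /andP[].
  by rewrite ltNge h.
Qed.

Lemma rmean_rot : integrable_arc u -> rmean (fun t => u (t + s)) = rmean u.
Proof.
move=> iu; have iru := integrable_rot iu; rewrite /rmean; congr (_ * _).
have dE : [disjoint E1 & E2].
  apply/disj_setPS => t [/=]; rewrite /E1 /E2 /= !in_itv/= => /andP[_ h] /andP[].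
  by rewrite ltNge h.
have dE' : [disjoint [set` `[0, s]] & [set` `]s, pi *+ 2]]].
  apply/disj_setPS => t [/=]; rewrite !in_itv/= => /andP[_ h] /andP[].
  by rewrite ltNge h.
have mu0 := integrable_arc_meas iu.
have iu' : mu.-integrable [set` `[0, s]] (EFin \o u).
  apply: (@integrableS _ _ _ mu _ _ (EFin \o u) (@measurable_arc R) _ _ iu).
    exact: measurable_itv.
  by rewrite arcE'; exact: subsetUl.
have iu1 : mu.-integrable D1 (EFin \o u).
  exact: (@integrableS _ _ _ mu _ _ (EFin \o u) (@measurable_arc R) mD1 sub1 iu).
rewrite [in LHS]arcE [in RHS]arcE' !Rintegral_setU//; try exact: measurable_itv;
  [|by rewrite -arcE'|by rewrite -arcE].
rewrite addrC; congr (_ + _).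
  have -> : \int[mu]_(t in E2) u (t + s) = \int[mu]_(t in D2) u t.
    rewrite -pre2 /Rintegral -(integral_shift (s - pi *+ 2) mD2).
      by congr fine; apply: eq_integral => t _; rewrite shift2.
    exact: (measurable_funS (@measurable_arc R) sub2 mu0).
  rewrite Rintegral_itv_obnd_cbnd//.
  exact: (@integrableS _ _ _ mu _ _ (EFin \o u) (@measurable_arc R) mD2 sub2 iu).
rewrite Rintegral_itv_obnd_cbnd; last first.
  apply: (@integrableS _ _ _ mu _ _ (EFin \o u) (@measurable_arc R) _ _ iu).
    exact: measurable_itv.
  by rewrite arcE'; exact: subsetUr.
rewrite -pre1 /Rintegral -(integral_shift s mD1)//.
exact: (measurable_funS (@measurable_arc R) sub1 mu0).
Qed.

End Periodic.

Section Rotation.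
Variable R : realType.
Implicit Types (f g : R[i] -> R[i]) (s t : R).

(** Only the class of [s] modulo [2 pi] matters, so [s] may be taken in the period. *)
Lemma integrable_arc_rot (h : R[i] -> R) s :
  integrable_arc (fun t => h (cis t)) ->
  integrable_arc (fun t => h (cis s * cis t)) /\
  rmean (fun t => h (cis s * cis t)) = rmean (fun t => h (cis t)).
Proof.
move=> ih; have [r r_arc ->] := cis_arc s.
have perio t : h (cis (t + pi *+ 2)) = h (cis t) by rewrite cisD cis2pi mulr1.
have -> : (fun t => h (cis r * cis t)) = (fun t => h (cis (t + r))).
  by apply/funext => t; rewrite cisD mulrC.
split; first exact: (integrable_rot perio r_arc).
exact: (rmean_rot perio r_arc).
Qed.

Lemma mean_rot f s : cint (fun t => f (cis t)) ->
  mean (fun t => f (cis s * cis t)) = mean (fun t => f (cis t)).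
Proof.
move=> [i1 i2]; apply: complex_ext => /=.
  exact: (@integrable_arc_rot (fun z => complex.Re (f z)) s i1).2.
exact: (@integrable_arc_rot (fun z => complex.Im (f z)) s i2).2.
Qed.

Lemma rL2_rot (h : R[i] -> R) s : rL2 (fun t => h (cis t)) ->
  rL2 (fun t => h (cis s * cis t)).
Proof.
move=> sh; have [_ ih2] := sh; have ih := rL2_int sh.
have [ih' _] := @integrable_arc_rot h s ih.
have [ih2' _] := @integrable_arc_rot (fun z => h z ^+ 2) s ih2.
by split => //; exact: integrable_arc_meas ih'.
Qed.

Lemma sqint_rot f s : sqint (fun t => f (cis t)) ->
  sqint (fun t => f (cis s * cis t)).
Proof.
move=> /sqintP[h1 h2]; apply/sqintP; split.
  exact: (@rL2_rot (fun z => complex.Re (f z))).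
exact: (@rL2_rot (fun z => complex.Im (f z))).
Qed.

Lemma nrm_rot f s : sqint (fun t => f (cis t)) ->
  nrm (fun t => f (cis s * cis t)) = nrm (fun t => f (cis t)).
Proof.
move=> sf; rewrite /nrm /n2 /ip.
by rewrite (@mean_rot (fun z => f z * (f z)^*) s)//; exact: sqint_cintMC.
Qed.

End Rotation.

(** * The Hardy space *)

Section Hardy.
Variable R : realType.
Implicit Types (F G : R -> R[i]) (t s : R) (p r : {poly R[i]}) (n m : int).
Local Notation mu := (@lebesgue_measure R).

Lemma measurable_cis : cmeas (@cis R).
Proof. by apply: (@cmeas_cis _ idfun) => t; exact: cvg_id. Qed.

Lemma cmeas_cisz n : cmeas (fun t : R => cis t ^ n).
Proof.
under eq_fun do rewrite cisXz; apply: (@cmeas_cis _ (fun t => t *~ n)) => t.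
under eq_fun do rewrite -mulrzl.
by apply: cvgMr; exact: cvg_id.
Qed.

Lemma cabs_cisz n t : cabs (cis t ^ n) = 1.
Proof. by rewrite cisXz cabs_cis. Qed.

Lemma sqint_cisz n : sqint (fun t : R => cis t ^ n).
Proof.
apply: (@bounded_sqint _ _ 1); first exact: cmeas_cisz.
by move=> t _; rewrite cabs_cisz.
Qed.

Lemma conj_cisz n t : (cis t ^ n)^* = cis t ^ (- n).
Proof. by rewrite !cisXz mulrNz cisN. Qed.

Lemma mean_cisz n : mean (fun t : R => cis t ^ n) = (n == 0)%:R.
Proof.
have [->|n0] := eqVneq n 0; first by under eq_fun do rewrite expr0z; exact: mean_cst.
have nR : (n%:~R : R) != 0 by rewrite intr_eq0.
have ic := sqint_cint (sqint_cisz n).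
(* Rotating by [pi / n] changes the sign of the integrand. *)
have h : mean (fun t : R => -1 * cis t ^ n) = mean (fun t : R => cis t ^ n).
  rewrite -[RHS](@mean_rot R (fun z => z ^ n) (pi / n%:~R))//.
  apply: eq_mean => t _; rewrite -cisD !cisXz mulrzDl -[pi / _ *~ n]mulrzr divfK//.
  by rewrite cisD; congr (_ * _); apply: complex_ext; rewrite /= ?cospi ?sinpi ?oppr0.
have : 2 * mean (fun t : R => cis t ^ n) = 0.
  by rewrite mulr_natl mulr2n -{1}h meanZ// mulN1r addNr.
by move=> /eqP; rewrite mulf_eq0 pnatr_eq0 => /eqP.
Qed.

Definition coef F n := ip F (fun t => cis t ^ n).

Definition hardy F := sqint F /\ forall n, n < 0 -> coef F n = 0.

Lemma coefE F n : coef F n = mean (fun t => F t * cis t ^ (- n)).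
Proof. by apply: eq_mean => t _; rewrite conj_cisz. Qed.

Lemma coefD F G n : sqint F -> sqint G ->
  coef (fun t => F t + G t) n = coef F n + coef G n.
Proof. by move=> sF sG; rewrite /coef ipDl//; exact: sqint_cisz. Qed.

Lemma coefZ z F n : sqint F -> coef (fun t => z * F t) n = z * coef F n.
Proof. by move=> sF; rewrite /coef ipZl//; exact: sqint_cisz. Qed.

Lemma coef_cst z n : coef (cst z) n = z * (n == 0)%:R.
Proof.
rewrite coefE meanZ; last exact: sqint_cint (sqint_cisz _).
by rewrite mean_cisz oppr_eq0.
Qed.

Lemma coef_shift F n m : coef (fun t => cis t ^ m * F t) n = coef F (n - m).
Proof.
rewrite !coefE; apply: eq_mean => t _.
by rewrite mulrAC -expfzDr ?cis_neq0// mulrC opprB.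
Qed.

Lemma coef_le F n : sqint F -> cabs (coef F n) <= nrm F.
Proof.
move=> sF; apply: le_trans (cauchy_schwarz sF (sqint_cisz n)) _.
apply: ler_piMr; first exact: nrm_ge0.
by apply: nrm_bounded => //; [exact: sqint_cisz|move=> t _; rewrite cabs_cisz].
Qed.

Lemma hardyD F G : hardy F -> hardy G -> hardy (fun t => F t + G t).
Proof.
move=> [sF hF] [sG hG]; split; first exact: sqintD.
by move=> n n0; rewrite coefD// hF// hG// addr0.
Qed.

Lemma hardyZ z F : hardy F -> hardy (fun t => z * F t).
Proof.
move=> [sF hF]; split; first exact: sqintZ.
by move=> n n0; rewrite coefZ// hF// mulr0.
Qed.

Lemma hardyB F G : hardy F -> hardy G -> hardy (fun t => F t - G t).
Proof.
move=> hF /(hardyZ (-1)) hG; have := hardyD hF hG.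
by congr hardy; apply/funext => t; rewrite mulN1r.
Qed.

Lemma hardy_cst z : hardy (cst z).
Proof.
split=> [|n n0]; first exact: sqint_cst.
by rewrite coef_cst lt_eqF// mulr0.
Qed.

Lemma hardy_cis F : hardy F -> hardy (fun t => cis t * F t).
Proof.
move=> [sF hF]; split.
  apply: (@sqint_bounded _ _ 1) => //; first exact: measurable_cis.
  by move=> t _; rewrite cabs_cis.
by move=> n n0; rewrite (coef_shift F n 1) hF// (lt_trans _ n0)// gtrBl.
Qed.

Lemma hardy_hornerM p F : hardy F -> hardy (fun t => p.[cis t] * F t).
Proof.
move=> hF; elim/poly_ind: p => [|p c IH].
  by under eq_fun do rewrite horner0 mul0r; exact: hardy_cst.
have -> : (fun t => (p * 'X + c%:P).[cis t] * F t) =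
    (fun t => cis t * (p.[cis t] * F t) + c * F t).
  by apply/funext => t; rewrite hornerMXaddC; ring.
by apply: hardyD; [exact: hardy_cis|exact: hardyZ].
Qed.

Lemma hardy_horner p : hardy (fun t => p.[cis t]).
Proof.
have := hardy_hornerM p (hardy_cst 1).
by congr hardy; apply/funext => t; rewrite mulr1.
Qed.

Lemma hardy_lim F : sqint F ->
  (forall e : R, 0 < e -> exists2 G, hardy G & nrm (fun t => F t - G t) <= e) ->
  hardy F.
Proof.
move=> sF h; split => // n n0; apply/eqP; rewrite -cabs_eq0 eq_le cabs_ge0 andbT.
apply/ler_addgt0Pr => e /h[G [sG hG] FG]; rewrite add0r.
have -> : F = (fun t => (F t - G t) + G t) by apply/funext => t; rewrite subrK.
have sD := sqintB sF sG.
by rewrite coefD// hG// addr0 (le_trans (coef_le _ _)).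
Qed.

Lemma ip_sumr N F (c : nat -> R[i]) (e : nat -> R -> R[i]) : sqint F ->
  (forall i, sqint (e i)) ->
  sqint (fun t => \sum_(i < N) c i * e i t) /\
  ip F (fun t => \sum_(i < N) c i * e i t) = \sum_(i < N) (c i)^* * ip F (e i).
Proof.
move=> sF se; elim: N => [|N [IH1 IH2]].
  have -> : (fun t : R => \sum_(i < 0) c i * e i t) = cst 0.
    by apply/funext => t; rewrite big_ord0.
  split; first exact: sqint_cst.
  rewrite big_ord0 -[RHS](@mean0 R).
  by apply: eq_mean => t _; rewrite /= conjC0 mulr0.
have -> : (fun t => \sum_(i < N.+1) c i * e i t) =
    (fun t => \sum_(i < N) c i * e i t + c N * e N t).
  by apply/funext => t; rewrite big_ord_recr.
have sN := sqintZ (c N) (se N).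
split; first exact: sqintD.
by rewrite big_ord_recr /= ipDr// IH2 ipZr.
Qed.

(** Cutting a trigonometric polynomial close to [F] at degree zero only brings
    it closer, as the discarded part is orthogonal to the Hardy space. *)
Lemma hardy_dense F : hardy F -> forall e : R, 0 < e ->
  exists p, nrm (fun t => F t - p.[cis t]) <= e.
Proof.
move=> hF e e0; have [sF _] := hF.
have [_ /(_ e e0)[T [N [r Gr]] FG]] := trig_dense sF.
pose p := drop_poly N r; exists p.
pose Q t : R[i] := \sum_(i < N) r`_i * cis t ^ (i%:Z - N%:Z).
have hG t : tpoly N r t = p.[cis t] + Q t.
  rewrite /tpoly -{1}(poly_take_drop N r) hornerD hornerM hornerXn mulrDr addrC.
  congr (_ + _).
    by rewrite mulrC -mulrA -exprMn cis_mulC expr1n mulr1.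
  rewrite horner_poly mulr_sumr; apply: eq_bigr => i _.
  by rewrite mulrCA expfzDr ?cis_neq0// [X in _ * X]mulrC -exprnN -exprnP -cisV exprVn.
have hFp := hardyB hF (hardy_horner p); have [sFp cFp] := hFp.
have [sQ ipQ] := @ip_sumr N _ (fun i => r`_i) (fun i t => cis t ^ (i%:Z - N%:Z)) sFp
  (fun i => sqint_cisz _).
rewrite big1 in ipQ; last first.
  by move=> i _; rewrite [ip _ _]cFp ?mulr0// subr_lt0 ltz_nat.
apply: le_trans FG; rewrite ler_sqrt ?n2_ge0//.
have -> : (fun t => F t - T t) =
    (fun t => (1 : R)%:C%C * (F t - p.[cis t]) + (-1) * Q t).
  by apply/funext => t; rewrite Gr hG rmorph1; ring.
rewrite n2_lincomb// [ip _ Q]ipQ mulr0 /= mulr0 addr0 expr1n mul1r lerDl.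
by rewrite mulr_ge0 ?sqr_ge0// n2_ge0.
Qed.

Lemma ip_horner F p : hardy F -> (forall n : nat, coef F n%:Z = 0) ->
  ip F (fun t => p.[cis t]) = 0.
Proof.
move=> [sF _] c0.
have [_] := @ip_sumr (size p) _ (fun i => p`_i) (fun i t => cis t ^ i%:Z) sF
  (fun i => sqint_cisz _).
rewrite big1; last by move=> i _; rewrite [ip _ _]c0 mulr0.
by move=> <-; apply: eq_mean => t _; rewrite horner_coef.
Qed.

(** Such a function is orthogonal to the polynomials, hence to itself. *)
Lemma hardy_coef0 F : hardy F -> (forall n : nat, coef F n%:Z = 0) -> nrm F = 0.
Proof.
move=> hF c0; have [sF _] := hF; apply/eqP; rewrite eq_le nrm_ge0 andbT leNgt.
apply/negP => F0; have e0 : 0 < nrm F / 2 by rewrite divr_gt0.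
have [p hp] := hardy_dense hF e0.
have sp := sqint_horner p; have sd := sqintB sF sp.
have : n2 F <= nrm F * (nrm F / 2).
  rewrite /n2 (_ : ip F F = ip F (fun t => F t - p.[cis t])); last first.
    rewrite [in LHS](_ : ip F F = ip F (fun t => (F t - p.[cis t]) + p.[cis t])).
      by rewrite ipDr// ip_horner// addr0.
    by congr ip; apply/funext => t; rewrite subrK.
  apply: le_trans (ler_norm _) _; apply: le_trans (Re_le_cabs _) _.
  apply: le_trans (cauchy_schwarz sF sd) _.
  by rewrite ler_pM2l.
rewrite -nrm_sqr expr2 ler_pM2l//.
by move: F0; lra.
Qed.

End Hardy.

(** * Uniform limits of polynomials on the circle *)

Section DiscAlgebra.
Variable R : realType.
Implicit Types (f g b u : R[i] -> R[i]) (t s : R) (p r : {poly R[i]}) (z w : R[i]).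
Local Notation mu := (@lebesgue_measure R).

Lemma in_H2E f : in_H2 f <-> hardy (fun t => f (cis t)).
Proof. by []. Qed.

Lemma norm2E f : norm2 f = nrm (fun t => f (cis t)).
Proof. by []. Qed.

(** The restrictions to the circle of the functions of the disc algebra. *)
Definition disc_alg f := forall e : R, 0 < e ->
  exists p, forall t, cabs (f (cis t) - p.[cis t]) <= e.

Lemma disc_alg_horner p : disc_alg (fun z => p.[z]).
Proof. by move=> e e0; exists p => t; rewrite subrr cabs0 ltW. Qed.

Lemma disc_alg_cst z : disc_alg (fun=> z).
Proof.
have := disc_alg_horner z%:P.
by congr disc_alg; apply/funext => w; rewrite hornerC.
Qed.

Lemma disc_alg_id : disc_alg id.
Proof.
have := disc_alg_horner 'X.
by congr disc_alg; apply/funext => w; rewrite hornerX.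
Qed.

Lemma disc_alg_bounded f : disc_alg f ->
  exists2 M : R, 0 <= M & forall t, cabs (f (cis t)) <= M.
Proof.
move=> /(_ 1 ltr01)[p hp]; have [M M0 pM] := horner_bounded p.
exists (1 + M) => [|t]; first by rewrite addr_ge0.
by rewrite -(subrK p.[cis t] (f (cis t))) (le_trans (cabsD _ _))// lerD.
Qed.

Lemma disc_alg_lim f :
  (forall e : R, 0 < e -> exists2 g, disc_alg g &
    forall t, cabs (f (cis t) - g (cis t)) <= e) -> disc_alg f.
Proof.
move=> h e e0; have e2 : 0 < e / 2 by rewrite divr_gt0.
have [g ag fg] := h _ e2; have [p gp] := ag _ e2; exists p => t.
have -> : f (cis t) - p.[cis t] = (f (cis t) - g (cis t)) + (g (cis t) - p.[cis t]).
  by rewrite addrA subrK.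
by rewrite (le_trans (cabsD _ _))// [leRHS](splitr e) lerD.
Qed.

Lemma eq_disc_alg f g : (forall t, f (cis t) = g (cis t)) ->
  disc_alg f -> disc_alg g.
Proof. by move=> fg af e /af[p hp]; exists p => t; rewrite -fg. Qed.

Lemma disc_algD f g : disc_alg f -> disc_alg g -> disc_alg (fun z => f z + g z).
Proof.
move=> af ag e e0; have e2 : 0 < e / 2 by rewrite divr_gt0.
have [p fp] := af _ e2; have [r gr] := ag _ e2; exists (p + r) => t.
rewrite hornerD opprD addrACA (le_trans (cabsD _ _))//.
by rewrite [leRHS](splitr e) lerD.
Qed.

Lemma disc_algM f g : disc_alg f -> disc_alg g -> disc_alg (fun z => f z * g z).
Proof.
move=> af ag; have [M M0 fM] := disc_alg_bounded af.
apply: disc_alg_lim => e e0; have e2 : 0 < e / (M + 1) by rewrite divr_gt0// ltr_wpDl.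
have [r gr] := ag _ e2; exists (fun z => f z * r.[z]); last first.
  move=> t; rewrite -mulrBr cabsM.
  apply: (@le_trans _ _ (M * (e / (M + 1)))); first by rewrite ler_pM ?cabs_ge0.
  by rewrite mulrA ler_pdivrMr ?ltr_wpDl// mulrC ler_pM2l// lerDl.
have [N N0 rN] := horner_bounded r => d d0.
have d2 : 0 < d / (N + 1) by rewrite divr_gt0// ltr_wpDl.
have [p fp] := af _ d2; exists (p * r) => t.
rewrite hornerM -mulrBl cabsM.
apply: (@le_trans _ _ (d / (N + 1) * N)); first by rewrite ler_pM ?cabs_ge0.
by rewrite mulrAC ler_pdivrMr ?ltr_wpDl// ler_pM2l// lerDl.
Qed.

Lemma disc_algZ z f : disc_alg f -> disc_alg (fun w => z * f w).
Proof. by move=> af; apply: disc_algM => //; exact: disc_alg_cst. Qed.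

Lemma disc_algB f g : disc_alg f -> disc_alg g -> disc_alg (fun z => f z - g z).
Proof.
move=> af /(disc_algZ (-1)) ag; have := disc_algD af ag.
by congr disc_alg; apply/funext => z; rewrite mulN1r.
Qed.

Lemma disc_algX f n : disc_alg f -> disc_alg (fun z => f z ^+ n).
Proof.
move=> af; elim: n => [|n IH].
  by under eq_fun do rewrite expr0; exact: disc_alg_cst.
by under eq_fun do rewrite exprS; exact: (disc_algM af IH).
Qed.

Lemma disc_alg_sum n (F : nat -> R[i] -> R[i]) : (forall i, disc_alg (F i)) ->
  disc_alg (fun z => \sum_(i < n) F i z).
Proof.
move=> aF; elim: n => [|n IH].
  by under eq_fun do rewrite big_ord0; exact: disc_alg_cst.
by under eq_fun do rewrite big_ord_recr; exact: (disc_algD IH (aF n)).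
Qed.

Lemma disc_alg_prod n (F : nat -> R[i] -> R[i]) : (forall i, disc_alg (F i)) ->
  disc_alg (fun z => \prod_(i < n) F i z).
Proof.
move=> aF; elim: n => [|n IH].
  by under eq_fun do rewrite big_ord0; exact: disc_alg_cst.
by under eq_fun do rewrite big_ord_recr; exact: (disc_algM IH (aF n)).
Qed.

Lemma disc_alg_rot f s : disc_alg f -> disc_alg (fun z => f (cis s * z)).
Proof.
move=> af e /af[p hp]; exists (p \Po (cis s *: 'X)) => t.
by rewrite horner_comp hornerZ hornerX -cisD hp.
Qed.

(** The partial sums of the Neumann series converge uniformly on the circle. *)
Lemma disc_alg_inv_1sub u (rho : R) : disc_alg u -> rho < 1 ->
  (forall t, cabs (u (cis t)) <= rho) -> disc_alg (fun z => (1 - u z)^-1).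
Proof.
move=> au rho1 uM; have rho0 : 0 <= rho by apply: le_trans (uM 0); exact: cabs_ge0.
apply: disc_alg_lim => e e0; have r0 : 0 < 1 - rho by rewrite subr_gt0.
have [N hN] : exists N, rho ^+ N <= e * (1 - rho).
  have /cvgrPdist_le/(_ (e * (1 - rho))) : (GRing.exp rho : R^nat) @ \oo --> 0.
    by apply: cvg_expr; rewrite ger0_norm.
  move=> /(_ (mulr_gt0 e0 r0))[N _ /(_ N (leqnn N))].
  by rewrite sub0r normrN ger0_norm ?exprn_ge0// => h; exists N.
exists (fun z => \sum_(k < N) u z ^+ k) => [|t].
  by apply: (@disc_alg_sum N (fun k z => u z ^+ k)) => k; exact: disc_algX.
have b : 1 - rho <= cabs (1 - u (cis t)).
  by apply: le_trans (cabs_sub _ _); rewrite cabs1 lerD2l lerN2.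
have b0 : 1 - u (cis t) != 0 by rewrite -cabs_gt0 (lt_le_trans r0).
have -> : (1 - u (cis t))^-1 - \sum_(k < N) u (cis t) ^+ k =
    u (cis t) ^+ N / (1 - u (cis t)).
  apply: (mulIf b0); rewrite mulrBl mulVf// divfK//.
  by rewrite -[_ ^+ N in RHS](subrK 1) subrX1; ring.
rewrite cabsM cabsV cabsX ler_pdivrMr ?cabs_gt0//.
apply: (@le_trans _ _ (rho ^+ N)); first by rewrite lerXn2r ?nnegrE ?cabs_ge0.
by rewrite (le_trans hN)// ler_pM2l.
Qed.

(** Pointwise limits of measurable functions are measurable. *)
Lemma disc_alg_cmeas f : disc_alg f -> cmeas (fun t => f (cis t)).
Proof.
move=> af; have hn n : 0 < (n.+1%:R)^-1 :> R by rewrite invr_gt0.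
pose p n := xget 0 [set p : {poly R[i]} | forall t, cabs (f (cis t) - p.[cis t]) <= (n.+1%:R)^-1].
have hp n t : cabs (f (cis t) - (p n).[cis t]) <= (n.+1%:R)^-1.
  have [r hr] := af _ (hn n).
  by have := @xgetI _ 0 [set p : {poly R[i]} | forall t,
    cabs (f (cis t) - p.[cis t]) <= (n.+1%:R)^-1] r hr; exact.
have c0 : (fun n => (n.+1%:R)^-1 : R) @ \oo --> 0 by exact: cvg_harmonic.
have cvgl (P : R[i] -> R) : (forall z w, `|P z - P w| <= cabs (z - w)) ->
    forall t, (fun n => P (p n).[cis t]) @ \oo --> P (f (cis t)).
  move=> hP t; apply/cvgrPdist_le => e e0.
  move/cvgrPdist_le : c0 => /(_ e e0); apply: filterS => n.
  rewrite sub0r normrN ger0_norm; last by rewrite invr_ge0.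
  by move=> h; rewrite (le_trans (hP _ _))// (le_trans (hp n t)).
split.
  apply: (@measurable_fun_cvg _ _ _ _ (fun n t => complex.Re (p n).[cis t])) => [n|t _].
    by have [] := cmeas_horner (p n).
  by apply: (cvgl (@complex.Re R)) => z w; rewrite -ReN -ReD Re_le_cabs.
apply: (@measurable_fun_cvg _ _ _ _ (fun n t => complex.Im (p n).[cis t])) => [n|t _].
  by have [] := cmeas_horner (p n).
by apply: (cvgl (@complex.Im R)) => z w; rewrite -ImN -ImD Im_le_cabs.
Qed.

Lemma disc_alg_L2 f : disc_alg f -> in_L2 f.
Proof.
move=> af; have [M _ fM] := disc_alg_bounded af.
by apply: (@bounded_sqint _ _ M) => //; exact: disc_alg_cmeas.
Qed.

Lemma disc_algM_L2 b f : disc_alg b -> in_L2 f -> in_L2 (fun z => b z * f z).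
Proof.
move=> ab sf; have [M _ bM] := disc_alg_bounded ab.
by apply: (@sqint_bounded _ _ M) => //; exact: disc_alg_cmeas.
Qed.

Lemma disc_algM_norm2 b f (M : R) : disc_alg b -> in_L2 f -> 0 <= M ->
  (forall t, cabs (b (cis t)) <= M) ->
  norm2 (fun z => b z * f z) <= M * norm2 f.
Proof.
move=> ab sf M0 bM; apply: le_nrm => //; first exact: disc_algM_L2.
by move=> t _; rewrite cabsM ler_wpM2r ?cabs_ge0.
Qed.

(** The product is the limit in mean square of the [p f], for polynomials [p]
    converging uniformly to [b]. *)
Lemma disc_algM_H2 b f : disc_alg b -> in_H2 f -> in_H2 (fun z => b z * f z).
Proof.
move=> ab hf; have [sf _] := hf.
apply/in_H2E/hardy_lim; first exact: disc_algM_L2.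
move=> e e0; have n0 : 0 < norm2 f + 1 by rewrite ltr_wpDl// norm2E nrm_ge0.
have d0 := divr_gt0 e0 n0.
have [p bp] := ab _ d0.
exists (fun t => p.[cis t] * f (cis t)); first exact: hardy_hornerM.
have := disc_algM_norm2 (disc_algB ab (disc_alg_horner p)) sf (ltW d0) bp.
rewrite norm2E; under eq_fun do rewrite mulrBl.
move/le_trans; apply; rewrite mulrAC ler_pdivrMr// ler_pM2l//.
by rewrite lerDl.
Qed.

Lemma disc_alg_H2 f : disc_alg f -> in_H2 f.
Proof.
move=> af; have := disc_algM_H2 af (hardy_cst 1 : in_H2 (fun=> 1)).
by congr in_H2; apply/funext => z; rewrite mulr1.
Qed.

(** A polynomial without zeros in the closed disc is a product of factors
    [z - a] with [|a| > 1], each inverted by a Neumann series. *)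
Lemma disc_alg_inv_horner p : (forall z, cabs z <= 1 -> p.[z] != 0) ->
  disc_alg (fun z => p.[z]^-1).
Proof.
move=> pn0; have p0 : p != 0.
  by apply/eqP => p0; have := pn0 0; rewrite cabs0 ler01 p0 horner0 eqxx => /(_ isT).
have [rs prs] := closed_field_poly_normal p.
have lc0 : lead_coef p != 0 by rewrite lead_coef_eq0.
have hz z : p.[z] = lead_coef p * \prod_(a <- rs) (z - a).
  rewrite {1}prs hornerZ horner_prod; congr (_ * _).
  by apply: eq_bigr => a _; rewrite hornerXsubC.
have rs1 a : a \in rs -> 1 < cabs a.
  move=> ars; rewrite ltNge; apply/negP => /pn0; rewrite hz.
  by rewrite (perm_big _ (perm_to_rem ars))/= big_cons subrr mul0r mulr0 eqxx.
have -> : (fun z => p.[z]^-1) =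
    (fun z => (lead_coef p)^-1 * \prod_(a <- rs) (z - a)^-1).
  by apply/funext => z; rewrite hz invfM prodfV.
apply: disc_algZ; elim: rs rs1 {prs hz} => [|a rs IH] rs1.
  by under eq_fun do rewrite big_nil; exact: disc_alg_cst.
apply: (@eq_disc_alg (fun z => (z - a)^-1 * \prod_(c <- rs) (z - c)^-1)) => [t|].
  by rewrite big_cons.
apply: disc_algM; last by apply: IH => c crs; apply: rs1; rewrite inE crs orbT.
have a1 := rs1 a (mem_head _ _); have a0 : a != 0.
  by rewrite -cabs_gt0 (lt_trans ltr01).
have -> : (fun z => (z - a)^-1) = (fun z => - a^-1 * (1 - a^-1 * z)^-1).
  apply/funext => z; rewrite mulNr -invfM mulrBr mulr1 mulVKf// -invrN opprB.
  by [].
apply: disc_algZ.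
apply: (@disc_alg_inv_1sub (fun z => a^-1 * z) (cabs a)^-1).
- by apply: disc_algZ; exact: disc_alg_id.
- by rewrite invf_lt1// (lt_trans ltr01).
- by move=> t; rewrite cabsM cabs_cis mulr1 cabsV.
Qed.

End DiscAlgebra.

(** * The reproducing kernel and the Gelfand transform *)

Section Gelfand.
Variable R : realType.
Implicit Types (f g b : R[i] -> R[i]) (t s : R) (p : {poly R[i]}) (z w : R[i]).
Local Notation mu := (@lebesgue_measure R).

(** The reproducing kernel of the Hardy space at [w]. *)
Definition kern w z : R[i] := (1 - w^* * z)^-1.

Lemma disc_alg_kern w : cabs w < 1 -> disc_alg (kern w).
Proof.
move=> w1; apply: (@disc_alg_inv_1sub _ (fun z => w^* * z) (cabs w)) => //.
  by apply: disc_algZ; exact: disc_alg_id.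
by move=> t; rewrite cabsM cabs_cis mulr1 cabsC.
Qed.

Lemma kern_neq0 w t : cabs w < 1 -> 1 - w^* * cis t != 0.
Proof.
move=> w1; rewrite -cabs_gt0; apply: lt_le_trans (cabs_sub _ _).
by rewrite cabs1 cabsM cabs_cis mulr1 cabsC subr_gt0.
Qed.

Lemma gelfandE f w : gelfand f w = inner f (kern w).
Proof.
apply: eq_mean => t _; congr (_ * _).
by rewrite /kern fmorphV rmorphB rmorph1 rmorphM /= conjCK cisV.
Qed.

Variable w : R[i].
Hypothesis w1 : cabs w < 1.

Let sK : sqint (fun t => kern w (cis t)).
Proof. exact: disc_alg_L2 (disc_alg_kern w1). Qed.

Lemma gelfandD f g : in_L2 f -> in_L2 g ->
  gelfand (fun z => f z + g z) w = gelfand f w + gelfand g w.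
Proof.
move=> sf sg; rewrite !gelfandE.
exact: (@ipDl R (fun t => f (cis t)) (fun t => g (cis t))).
Qed.

Lemma gelfandZ z f : in_L2 f ->
  gelfand (fun x => z * f x) w = z * gelfand f w.
Proof. by move=> sf; rewrite !gelfandE; exact: (@ipZl R z (fun t => f (cis t))). Qed.

Lemma gelfandB f g : in_L2 f -> in_L2 g ->
  gelfand (fun z => f z - g z) w = gelfand f w - gelfand g w.
Proof.
move=> sf sg; rewrite !gelfandE.
exact: (@ipBl R (fun t => f (cis t)) (fun t => g (cis t))).
Qed.

Lemma eq_gelfand f g : (forall t, f (cis t) = g (cis t)) ->
  gelfand f w = gelfand g w.
Proof. by move=> fg; apply: eq_mean => t _; rewrite fg. Qed.

Lemma ae_eq_gelfand f g : cmeas (fun t => f (cis t)) ->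
  cmeas (fun t => g (cis t)) -> eq_circle f g -> gelfand f w = gelfand g w.
Proof.
move=> mf mg fg; rewrite !gelfandE.
have mK := sqint_meas sK.
apply: (ae_eq_ip mf mK mg mK fg).
exact: ae_eq_refl.
Qed.

Lemma gelfand_le f : in_L2 f ->
  cabs (gelfand f w) <= norm2 f * norm2 (kern w).
Proof. by move=> sf; rewrite gelfandE; exact: cauchy_schwarz. Qed.

(** [z - w] times the conjugate kernel is [z] on the circle, and [z f] has mean
    zero for [f] in the Hardy space. *)
Lemma gelfand_shift f : in_H2 f ->
  gelfand (fun z => z * f z) w = w * gelfand f w.
Proof.
move=> hf; have [sf cf] := hf.
have szf : in_L2 (fun z => z * f z) := disc_algM_L2 (@disc_alg_id R) sf.
have swf : in_L2 (fun z => w * f z) by exact: sqintZ.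
apply/eqP; rewrite -subr_eq0 -gelfandZ// -gelfandB//; apply/eqP.
rewrite -(cf (-1)) ?oppr_lt0// [RHS]coefE opprK; apply: eq_mean => t _.
rewrite -mulrBl expr1z; set c := cis t.
have c0 : c != 0 by exact: cis_neq0.
have : 1 - w * c^-1 != 0.
  have := @kern_neq0 w t w1; rewrite -conjC_eq0 rmorphB rmorph1 rmorphM /= conjCK.
  by rewrite -/c -cisV.
move=> h; apply: (mulIf h); rewrite divfK//.
by rewrite -!mulrA mulrBr mulr1 mulrCA divff// mulr1; ring.
Qed.

Lemma gelfand_hornerM p f : in_H2 f ->
  gelfand (fun z => p.[z] * f z) w = p.[w] * gelfand f w.
Proof.
move=> hf; elim/poly_ind: p => [|p c IH].
  rewrite horner0 mul0r -[RHS](@mean0 R).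
  by apply: eq_mean => t _; rewrite horner0 !mul0r.
have [sf _] := hf; have hp : in_H2 (fun z => p.[z] * f z) by exact: hardy_hornerM.
transitivity (gelfand (fun z => z * (p.[z] * f z) + c * f z) w).
  by apply: eq_gelfand => t; rewrite hornerMXaddC; ring.
rewrite gelfandD ?gelfandZ ?gelfand_shift ?IH ?hornerMXaddC//; first by ring.
  by have [] : in_H2 (fun z => z * (p.[z] * f z)) by exact: hardy_cis.
exact: sqintZ.
Qed.

(** Since [k = 1 + conj w z k] for the kernel [k], and [z k] has mean zero,
    the mean of [k] is [1]. *)
Lemma gelfand1 : gelfand (fun=> 1) w = 1.
Proof.
have s1 : sqint (cst 1 : R -> R[i]) by exact: sqint_cst.
rewrite gelfandE [LHS](ipC s1 sK).
have [_ cK] := disc_alg_H2 (disc_alg_kern w1).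
have : coef (fun t => kern w (cis t)) 0 =
    coef (fun t => 1 + w^* * (cis t ^ 1 * kern w (cis t))) 0.
  rewrite !coefE; apply: eq_mean => t _; congr (_ * _).
  have h := @kern_neq0 w t w1.
  apply: (mulIf h); rewrite /kern mulVf// mulrDl expr1z.
  by rewrite -!mulrA mulVf//; ring.
have sz : sqint (fun t => cis t ^ 1 * kern w (cis t)).
  apply: (@sqint_bounded _ _ 1) => //; first exact: cmeas_cisz.
  by move=> t _; rewrite cabs_cisz.
rewrite (@coefD R (cst 1)) ?(@coef_cst R) ?coefZ//; last exact: sqintZ.
have cm1 : coef (fun t => kern w (cis t)) (-1) = 0 := cK (-1) (ltrN10 _).
rewrite coef_shift sub0r cm1 mulr0 addr0 mul1r /=.
have -> : coef (fun t => kern w (cis t)) 0 = ip (fun t => kern w (cis t)) (cst 1).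
  by apply: eq_mean => t _; rewrite expr0z.
by move=> ->; rewrite conjC1.
Qed.

Lemma gelfand_horner p : gelfand (fun z => p.[z]) w = p.[w].
Proof.
have := gelfand_hornerM p (hardy_cst 1 : in_H2 (fun=> 1)).
by rewrite gelfand1 mulr1 => <-; apply: eq_gelfand => t; rewrite mulr1.
Qed.

Lemma gelfand_cst z : gelfand (fun=> z) w = z.
Proof.
by have := gelfand_horner z%:P; rewrite hornerC => {2}<-;
  apply: eq_gelfand => t; rewrite hornerC.
Qed.

(** Polynomials are multipliers by [gelfand_hornerM], and [b] is a uniform limit of
    polynomials. *)
Lemma gelfandM b f : disc_alg b -> in_H2 f ->
  gelfand (fun z => b z * f z) w = gelfand b w * gelfand f w.
Proof.
move=> ab hf; have [sf _] := hf; have sb := disc_alg_L2 ab.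
apply/eqP; rewrite -subr_eq0 -cabs_eq0 eq_le cabs_ge0 andbT.
apply/ler_addgt0Pr => e e0; rewrite add0r.
set K := norm2 (kern w); have K0 : 0 <= K by exact: nrm_ge0.
have N0 : 0 <= norm2 f by exact: nrm_ge0.
set C := norm2 f * K + K * cabs (gelfand f w) + 1.
have C0 : 0 < C by rewrite ltr_wpDl// addr_ge0// mulr_ge0// cabs_ge0.
have d0 := divr_gt0 e0 C0; have [p bp] := ab _ d0.
have ap := disc_alg_horner p; have sp := disc_alg_L2 ap.
have abp := disc_algB ab ap; have sbp := disc_alg_L2 abp.
have -> : gelfand (fun z => b z * f z) w - gelfand b w * gelfand f w =
    gelfand (fun z => (b z - p.[z]) * f z) w
    - gelfand (fun z => b z - p.[z]) w * gelfand f w.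
  rewrite gelfandB// gelfand_horner.
  transitivity (gelfand (fun z => b z * f z - p.[z] * f z) w
    - (gelfand b w - p.[w]) * gelfand f w).
    rewrite gelfandB ?gelfand_hornerM//; try exact: disc_algM_L2.
    by ring.
  by congr (_ - _); apply: eq_gelfand => t; rewrite mulrBl.
have h1 := gelfand_le (disc_algM_L2 abp sf).
have h2 := disc_algM_norm2 abp sf (ltW d0) bp.
have h3 := gelfand_le sbp.
have h4 : norm2 (fun z => b z - p.[z]) <= e / C.
  by apply: nrm_bounded => //; exact: ltW.
apply: le_trans (cabsB _ _) _; rewrite cabsM.
apply: (@le_trans _ _ (e / C * norm2 f * K + e / C * K * cabs (gelfand f w))).
  apply: lerD.
    by apply: le_trans h1 _; rewrite ler_wpM2r.
  by rewrite ler_wpM2r ?cabs_ge0// (le_trans h3)// ler_wpM2r.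
rewrite (_ : _ + _ = e / C * (norm2 f * K + K * cabs (gelfand f w))); last by ring.
by rewrite mulrAC ler_pdivrMr// ler_pM2l// lerDl.
Qed.

Let W : 0 < 1 - cabs w ^+ 2.
Proof. by rewrite subr_gt0 expr_lt1// cabs_ge0. Qed.

(** Multiplicativity applied to [(1 - conj v z) k = 1] for the kernel [k] at [v]. *)
Lemma gelfand_kern v : cabs v < 1 ->
  gelfand (kern v) w = (1 - v^* * w)^-1.
Proof.
move=> v1; have hK := disc_alg_H2 (disc_alg_kern v1).
have n0 : 1 - v^* * w != 0.
  rewrite -cabs_gt0; apply: lt_le_trans (cabs_sub _ _).
  rewrite cabs1 cabsM cabsC subr_gt0 mulr_ilt1 ?cabs_ge0//.
apply: (mulfI n0); rewrite divff//.
have <- : (1 - v^* *: 'X).[w] = 1 - v^* * w.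
  by rewrite hornerD hornerN hornerZ hornerX hornerC.
rewrite -gelfand_hornerM// -[RHS]gelfand1; apply: eq_gelfand => t.
rewrite hornerD hornerN hornerZ hornerX hornerC /kern divff//.
exact: kern_neq0.
Qed.

Lemma norm2_kern : norm2 (kern w) ^+ 2 = (1 - cabs w ^+ 2)^-1.
Proof.
rewrite norm2E nrm_sqr /n2 -[ip _ _]/(inner (kern w) (kern w)) -gelfandE.
rewrite gelfand_kern// mulrC mulC_conj.
by rewrite -(rmorph1 (@real_complex_def R (Phant R))) -rmorphB -fmorphV.
Qed.

(** The maximum principle, read off from [<b k, k> = b(w) <k, k>] for the
    kernel [k] at [w]. *)
Lemma gelfand_disc_alg_le b (M : R) : disc_alg b -> 0 <= M ->
  (forall t, cabs (b (cis t)) <= M) -> cabs (gelfand b w) <= M.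
Proof.
move=> ab M0 bM; have aK := disc_alg_kern w1; have hK := disc_alg_H2 aK.
have := gelfand_le (disc_algM_L2 ab (disc_alg_L2 aK)).
rewrite gelfandM// cabsM => h.
have h2 := disc_algM_norm2 ab (disc_alg_L2 aK) M0 bM.
have g0 : cabs (gelfand (kern w) w) = norm2 (kern w) ^+ 2.
  rewrite norm2_kern gelfand_kern// mulrC mulC_conj.
  rewrite -(rmorph1 (@real_complex_def R (Phant R))) -rmorphB cabsV cabs_real.
  by rewrite ger0_norm// ltW.
have k0 : 0 < norm2 (kern w) ^+ 2 by rewrite norm2_kern invr_gt0.
rewrite g0 in h; rewrite -(ler_pM2r k0); apply: le_trans h _.
by rewrite expr2 mulrA ler_wpM2r//; exact: nrm_ge0.
Qed.

(** The kernel at [cis s * w] is the rotated kernel at [w]. *)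
Lemma gelfand_rot f s : in_L2 f ->
  gelfand (fun z => f (cis s * z)) w = gelfand f (cis s * w).
Proof.
move=> sf; have sw1 : cabs (cis s * w) < 1 by rewrite cabsM cabs_cis mul1r.
have := @mean_rot R (fun z => f z * (kern (cis s * w) z)^*) s.
move=> h; rewrite [RHS]gelfandE -[RHS]h; last first.
  exact: (sqint_cintMC sf (disc_alg_L2 (disc_alg_kern sw1))).
rewrite gelfandE; apply: eq_mean => t _; congr (_ * _^*).
rewrite /kern rmorphM /= mulrACA [_^* * cis s]mulrC cis_mulC mul1r.
by [].
Qed.

End Gelfand.

(** * Continuously differentiable functions of the Hardy space *)

Section RealDerivative.
Variable R : realType.
Implicit Types (u v du dv : R -> R) (t x : R).
Local Notation mu := (@lebesgue_measure R).

Definition rderiv u du := forall t, is_derive t (1 : R) u (du t).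

Lemma eq_rderiv u du v dv : (forall t, u t = v t) -> (forall t, du t = dv t) ->
  rderiv u du -> rderiv v dv.
Proof. by move=> /funext -> /funext ->. Qed.

Lemma rderiv_continuous u du : rderiv u du -> continuous u.
Proof.
move=> h t; apply: differentiable_continuous; apply/derivable1_diffP.
by have := h t => -[].
Qed.

Lemma rderiv_cst (c : R) : rderiv (cst c) (cst 0).
Proof. by move=> t; exact: is_derive_cst. Qed.

Lemma rderivD u du v dv : rderiv u du -> rderiv v dv ->
  rderiv (fun t => u t + v t) (fun t => du t + dv t).
Proof. by move=> hu hv t; exact: is_deriveD. Qed.

Lemma rderivN u du : rderiv u du -> rderiv (fun t => - u t) (fun t => - du t).
Proof. by move=> hu t; exact: is_deriveN. Qed.

Lemma rderivM u du v dv : rderiv u du -> rderiv v dv ->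
  rderiv (fun t => u t * v t) (fun t => u t * dv t + v t * du t).
Proof. by move=> hu hv t; exact: is_deriveM. Qed.

Lemma continuous_rL2 u : continuous u -> rL2 u.
Proof.
move=> cu; split.
  by apply: measurable_funTS; exact: continuous_measurable_fun.
apply: (@continuous_compact_integrable R (fun t => u t ^+ 2)).
  exact: segment_compact.
by apply: continuous_subspaceT => t; apply: cvgM; exact: cu.
Qed.

Lemma rderiv_integral u du x : rderiv u du -> continuous du -> 0 < x ->
  Rintegral mu [set` `[0, x]] du = u x - u 0.
Proof.
move=> h cdu x0; rewrite /Rintegral.
have cu := rderiv_continuous h.
rewrite (@continuous_FTC2 _ du u 0 x)//.
- exact: continuous_subspaceT.
- split.
  + by move=> t _; have := h t => -[].
  + by apply: cvg_at_right_filter; exact: cu.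
  + by apply: cvg_at_left_filter; exact: cu.
- by move=> t _; rewrite derive1E; have := h t => -[].
Qed.

Lemma rderiv_mean0 u du : rderiv u du -> continuous du ->
  u (pi *+ 2) = u 0 -> rmean du = 0.
Proof.
move=> h cdu per; rewrite /rmean (rderiv_integral h cdu) ?twopi_gt0//.
by rewrite per subrr mulr0.
Qed.

(** The oscillation of [u] is at most the total integral of [|u'|]. *)
Lemma rderiv_bound u du t : rderiv u du -> continuous du -> arc t ->
  `|u t - u 0| <= pi *+ 2 * rmean (fun x => `|du x|).
Proof.
move=> h cdu At; have p0 := @twopi_gt0 R.
rewrite /rmean mulrA divff ?gt_eqF// mul1r.
have idu := rL2_int (continuous_rL2 cdu).
have iadu : integrable_arc (fun x => `|du x|) by exact: integrable_norm.
move/arcP: (At) => /andP[]; rewrite le_eqVlt => /predU1P[<- _|t0 t2].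
  by rewrite subrr normr0 Rintegral_ge0.
rewrite -(rderiv_integral h cdu t0).
have mt : measurable ([set` `[0, t]] : set R) by exact: measurable_itv.
have sub : [set` `[0, t]] `<=` @arc R.
  by move=> x /=; rewrite /arc /= !in_itv/= => /andP[-> /le_trans]; exact.
have idut := @integrableS _ _ _ mu _ _ (EFin \o du) (@measurable_arc R) mt sub idu.
apply: le_trans (le_normr_Rintegral _ idut) _ => //.
rewrite -subr_ge0 /arc Rintegral_itvB//.
- by apply: Rintegral_ge0.
- by rewrite bnd_simp ltW.
Qed.

End RealDerivative.

Section ComplexDerivative.
Variable R : realType.
Implicit Types (F G dF dG : R -> R[i]) (t : R) (p r : {poly R[i]}).
Local Notation mu := (@lebesgue_measure R).
Local Notation Re := (@complex.Re R).
Local Notation Im := (@complex.Im R).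

Definition cderiv F dF := rderiv (fun t => Re (F t)) (fun t => Re (dF t)) /\
  rderiv (fun t => Im (F t)) (fun t => Im (dF t)).

Definition ccont F := continuous (fun t => Re (F t)) /\
  continuous (fun t => Im (F t)).

Lemma eq_cderiv F dF dG : (forall t, dF t = dG t) -> cderiv F dF -> cderiv F dG.
Proof. by move=> /funext ->. Qed.

Lemma cderiv_cont F dF : cderiv F dF -> ccont F.
Proof.
by move=> [a b]; split; [exact: (rderiv_continuous a)|exact: (rderiv_continuous b)].
Qed.

Lemma continuousD2 (u v : R -> R) : continuous u -> continuous v ->
  continuous (fun t => u t + v t).
Proof. by move=> cu cv t; apply: cvgD; [exact: cu|exact: cv]. Qed.

Lemma continuousN2 (u : R -> R) : continuous u -> continuous (fun t => - u t).
Proof. by move=> cu t; apply: cvgN; exact: cu. Qed.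

Lemma continuousM2 (u v : R -> R) : continuous u -> continuous v ->
  continuous (fun t => u t * v t).
Proof. by move=> cu cv t; apply: cvgM; [exact: cu|exact: cv]. Qed.

Lemma ccontM F G : ccont F -> ccont G -> ccont (fun t => F t * G t).
Proof.
move=> [F1 F2] [G1 G2]; split.
  rewrite (_ : (fun t => _) =
    (fun t => Re (F t) * Re (G t) + - (Im (F t) * Im (G t)))); last first.
    by apply/funext => t; rewrite ReM.
  by apply: continuousD2; last apply: continuousN2; exact: continuousM2.
rewrite (_ : (fun t => _) =
  (fun t => Re (F t) * Im (G t) + Im (F t) * Re (G t))); last first.
  by apply/funext => t; rewrite ImM.
by apply: continuousD2; exact: continuousM2.
Qed.

Lemma ccontD F G : ccont F -> ccont G -> ccont (fun t => F t + G t).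
Proof.
move=> [F1 F2] [G1 G2]; split.
  rewrite (_ : (fun t => _) = (fun t => Re (F t) + Re (G t))); last first.
    by apply/funext => t; rewrite ReD.
  exact: continuousD2.
rewrite (_ : (fun t => _) = (fun t => Im (F t) + Im (G t))); last first.
  by apply/funext => t; rewrite ImD.
exact: continuousD2.
Qed.

Lemma ccont_sqint F : ccont F -> sqint F.
Proof. by move=> [F1 F2]; apply/sqintP; split; exact: continuous_rL2. Qed.

Lemma cderivD F dF G dG : cderiv F dF -> cderiv G dG ->
  cderiv (fun t => F t + G t) (fun t => dF t + dG t).
Proof.
move=> [F1 F2] [G1 G2]; split.
  by apply: eq_rderiv (rderivD F1 G1) => t; rewrite ReD.
by apply: eq_rderiv (rderivD F2 G2) => t; rewrite ImD.
Qed.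

Lemma cderivM F dF G dG : cderiv F dF -> cderiv G dG ->
  cderiv (fun t => F t * G t) (fun t => F t * dG t + G t * dF t).
Proof.
move=> [F1 F2] [G1 G2]; split.
  apply: eq_rderiv (rderivD (rderivM F1 G1) (rderivN (rderivM F2 G2))) => t.
    by rewrite ReM.
  by rewrite ReD !ReM; ring.
apply: eq_rderiv (rderivD (rderivM F1 G2) (rderivM F2 G1)) => t.
  by rewrite ImM.
by rewrite ImD !ImM; ring.
Qed.

Lemma cderiv_cst z : cderiv (cst z) (cst 0).
Proof. by split; exact: rderiv_cst. Qed.

Lemma cderivZ z F dF : cderiv F dF ->
  cderiv (fun t => z * F t) (fun t => z * dF t).
Proof.
move=> h; apply: eq_cderiv (cderivM (cderiv_cst z) h) => t.
by rewrite /= mulr0 addr0.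
Qed.

Lemma cderivC F dF : cderiv F dF ->
  cderiv (fun t => (F t)^*) (fun t => (dF t)^*).
Proof.
move=> [F1 F2]; split; first by apply: eq_rderiv F1 => t; rewrite ReC.
by apply: eq_rderiv (rderivN F2) => t; rewrite ImC.
Qed.

Lemma cderiv_cis : cderiv (@cis R) (fun t => 'i%C * cis t).
Proof.
split; apply: eq_rderiv.
- by move=> t; reflexivity.
- move=> t; rewrite ReM /= mul0r mul1r sub0r; reflexivity.
- by move=> t; exact: is_derive_cos.
- by move=> t; reflexivity.
- move=> t; rewrite ImM /= mul0r mul1r add0r; reflexivity.
- by move=> t; exact: is_derive_sin.
Qed.

Lemma cderiv_horner p : cderiv (fun t => p.[cis t])
  (fun t => 'i%C * (cis t * p^`().[cis t])).
Proof.
elim/poly_ind: p => [|p c IH].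
  have -> : (fun t : R => (0 : {poly R[i]}).[cis t]) = cst 0.
    by apply/funext => t; rewrite horner0.
  by apply: eq_cderiv (cderiv_cst 0) => t; rewrite deriv0 horner0 !mulr0.
have -> : (fun t => (p * 'X + c%:P).[cis t]) = (fun t => p.[cis t] * cis t + c).
  by apply/funext => t; rewrite hornerMXaddC.
apply: eq_cderiv (cderivD (cderivM IH cderiv_cis) (cderiv_cst c)) => t.
by rewrite derivMXaddC hornerD hornerMX /cst; ring.
Qed.

Lemma cderiv_cisz n : cderiv (fun t : R => cis t ^ n)
  (fun t => n%:~R * 'i%C * cis t ^ n).
Proof.
have h (k : nat) : cderiv (fun t : R => cis t ^ k%:Z)
    (fun t => (k%:Z)%:~R * 'i%C * cis t ^ k%:Z).
  have -> : (fun t : R => cis t ^ k%:Z) = (fun t => ('X^k).[cis t]).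
    by apply/funext => t; rewrite hornerXn.
  apply: eq_cderiv (cderiv_horner _) => t.
  rewrite derivXn hornerMn hornerXn -pmulrn -exprnP.
  case: k => [|k]; first by rewrite !mulr0n !mulr0 !mul0r.
  by rewrite /= exprS -[cis t ^+ k *+ _]mulr_natl; ring.
case: n => k; first exact: h.
have := cderivC (h k.+1).
have -> : (fun t : R => (cis t ^ k.+1%:Z)^*) = (fun t => cis t ^ Negz k).
  by apply/funext => t; rewrite conj_cisz NegzE.
apply: eq_cderiv => t; rewrite NegzE -conj_cisz !rmorphM rmorph_int mulrNz.
have ci : ('i%C : R[i])^* = - 'i%C by apply: complex_ext; rewrite ?ReN ?ImN /= ?oppr0.
by rewrite [X in _ * X * _]ci; ring.
Qed.

(** Integration by parts. *)
Lemma coef_cderiv F dF n : cderiv F dF -> ccont dF -> F (pi *+ 2) = F 0 ->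
  coef dF n = n%:~R * 'i%C * coef F n.
Proof.
move=> hF cdF per.
have cF := cderiv_cont hF; have sF := ccont_sqint cF; have sdF := ccont_sqint cdF.
have he := cderiv_cisz (- n); have ce := cderiv_cont he.
have hp := cderivM hF he.
set D := (fun t => _ + _) in hp.
have cD : ccont D.
  apply: ccontD; last exact: ccontM.
  apply: ccontM => //; apply: ccontM => //.
  exact: (cderiv_cont (cderiv_cst _)).
have m0 : mean D = 0.
  move: hp cD => [h1 h2] [c1 c2]; apply: complex_ext; apply: rderiv_mean0; try eassumption.
    by rewrite /= per cis2pi cis0.
  by rewrite /= per cis2pi cis0.
have : mean D = coef dF n - n%:~R * 'i%C * coef F n.
  rewrite !coefE -mulNr -meanZ; last by apply: sqint_cintM => //; exact: sqint_cisz.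
  rewrite -meanD.
  - by apply: eq_mean => t _; rewrite /D mulrNz; ring.
  - by apply: sqint_cintM => //; exact: sqint_cisz.
  - by apply: cintZ; apply: sqint_cintM => //; exact: sqint_cisz.
by rewrite m0 => /esym/eqP; rewrite subr_eq0 => /eqP.
Qed.

Lemma nrm_abs_le F : sqint F ->
  rmean (fun t => `|Re (F t)|) <= nrm F /\ rmean (fun t => `|Im (F t)|) <= nrm F.
Proof.
move=> sF; have [sR sI] := (sqintP F).1 sF.
have key u : rL2 u -> (forall t, `|u t| <= cabs (F t)) ->
    rmean (fun t => `|u t|) <= nrm F.
  move=> su uF; have sa : rL2 (fun t => `|u t|).
    have [mu0 iu] := su; split; first exact: measurableT_comp.
    by apply: eq_integrable_arc iu => t _; rewrite real_normK ?num_real.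
  have s1 := sqint_cst (1 : R[i]); have := cauchy_schwarz (sqint_real sa) s1.
  rewrite nrm_cst cabs1 mulr1 => h.
  have h2 : nrm (fun t => (`|u t|)%:C%C) <= 1 * nrm F.
    apply: le_nrm => //; first exact: sqint_real.
    by move=> t _; rewrite cabs_real normr_id mul1r uF.
  rewrite mul1r in h2; apply: le_trans h2; apply: le_trans h.
  apply: le_trans (Re_le_cabs _); apply: le_trans (ler_norm _).
  rewrite le_eqVlt; apply/orP; left; apply/eqP/eq_rmean => t _.
  by rewrite conjC1 mulr1.
by split; apply: key => // t; [exact: Re_le_cabs|exact: Im_le_cabs].
Qed.

Lemma cderiv_bound F dF t : cderiv F dF -> ccont dF -> arc t ->
  cabs (F t - F 0) <= pi *+ 4 * nrm dF.
Proof.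
move=> [h1 h2] cdF At; have [c1 c2] := cdF.
have [b1 b2] := nrm_abs_le (ccont_sqint cdF).
apply: le_trans (cabs_le_ReIm _) _.
rewrite !(ReD, ImD, ReN, ImN).
have e1 := rderiv_bound h1 c1 At; have e2 := rderiv_bound h2 c2 At.
have p0 := ltW (@twopi_gt0 R).
rewrite [leRHS](_ : _ = pi *+ 2 * nrm dF + pi *+ 2 * nrm dF); last first.
  by rewrite -mulrDl -mulrnDr.
apply: lerD.
  exact: (le_trans e1 (ler_wpM2l p0 b1)).
exact: (le_trans e2 (ler_wpM2l p0 b2)).
Qed.

Lemma poly_antideriv p : exists r, r^`() = p.
Proof.
exists (\poly_(i < (size p).+1) (p`_i.-1 / i%:R)); apply/polyP => i.
rewrite coef_deriv coef_poly ltnS; case: ltnP => [ip|ip] /=.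
  by rewrite -[LHS]mulr_natr divfK// pnatr_eq0.
by rewrite mul0rn nth_default.
Qed.

(** Since [phi'] is [z] times a Hardy function, approximating it in mean square
    by [z p] and integrating approximates [phi] uniformly. *)
Lemma C1_disc_alg (phi : R[i] -> R[i]) : in_H2 phi -> C1_circle phi ->
  disc_alg phi.
Proof.
move=> [sphi aphi] [[d1 c1] [d2 c2]].
pose F t := phi (cis t).
pose dF t : R[i] := Complex (derive1 (fun t => Re (phi (cis t))) t)
  (derive1 (fun t => Im (phi (cis t))) t).
have hF : cderiv F dF.
  by split=> t /=; rewrite derive1E; apply/derivableP.
have cdF : ccont dF := conj c1 c2.
have per : F (pi *+ 2) = F 0 by rewrite /F cis2pi cis0.
(* At index zero this is the periodicity of [phi], not its analyticity. *)
have cdFn n : n <= 0 -> coef dF n = 0.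
  rewrite le_eqVlt => /predU1P[->|n0]; rewrite (coef_cderiv _ hF cdF per).
    by rewrite !mul0r.
  by rewrite [coef F n]aphi// mulr0.
have sdF := ccont_sqint cdF.
have hG : hardy (fun t => cis t ^ (-1) * dF t).
  split.
    apply: (@sqint_bounded _ _ 1) => //; first exact: cmeas_cisz.
    by move=> t _; rewrite cabs_cisz.
  by move=> n n0; rewrite coef_shift opprK cdFn// -ltzD1 ltrD2r.
move=> e e0; have p4 : 0 < pi *+ 4 :> R by rewrite mulrn_wgt0// pi_gt0.
have [p hp] := hardy_dense hG (divr_gt0 e0 p4).
(* The derivative of [r (cis t)] is ['i cis t r'(cis t)]. *)
have [r rp] := poly_antideriv (- 'i%C *: p).
have hr : cderiv (fun t => r.[cis t]) (fun t => cis t * p.[cis t]).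
  apply: eq_cderiv (cderiv_horner r) => t.
  rewrite rp hornerZ.
  transitivity (- ('i%C ^+ 2) * (cis t * p.[cis t])); first by ring.
  by rewrite sqr_i; ring.
have cp : ccont (fun t => cis t * p.[cis t]).
  by apply: ccontM; [exact: cderiv_cont cderiv_cis|exact: cderiv_cont (cderiv_horner p)].
have hD := cderivD hF (cderivZ (-1) hr).
have cD := ccontD cdF (ccontM (cderiv_cont (cderiv_cst (-1))) cp).
have nD : nrm (fun t => dF t + -1 * (cis t * p.[cis t])) <= e / (pi *+ 4).
  apply: le_trans hp; rewrite -[leRHS]mul1r; apply: le_nrm => //.
  - exact: ccont_sqint cD.
  - by apply: sqintB; [have [] := hG|exact: sqint_horner].
  - move=> t _; rewrite mul1r -[leRHS]mul1r -(cabs_cis t) -cabsM.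
    rewrite le_eqVlt; apply/orP; left; apply/eqP; congr cabs.
    have e1 : cis t * cis t ^ (-1) = 1 by rewrite exprN1 divff// cis_neq0.
    by rewrite mulrBr [in RHS]mulrA e1; ring.
exists (r + (F 0 - r.[1])%:P) => t.
have [s s_arc ->] := cis_arc t.
have As : arc s by apply/arcP; move: s_arc; rewrite in_itv/= => /andP[-> /ltW].
have := cderiv_bound hD cD As.
rewrite cis0 hornerD hornerC.
have -> : F s + -1 * r.[cis s] - (F 0 + -1 * r.[1]) =
  phi (cis s) - (r.[cis s] + (F 0 - r.[1])) by rewrite /F; ring.
move/le_trans; apply; rewrite mulrC -ler_pdivlMr//.
Qed.

End ComplexDerivative.

(** * Inversion of uniform limits of polynomials *)

Section Inversion.
Variable R : realType.
Implicit Types (f g : R[i] -> R[i]) (t : R) (p : {poly R[i]}) (z w : R[i]).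

(** A joint induction on the polynomial, since the Lipschitz constant along radii
    of [z p] involves the bound of [p]. *)
Lemma horner_radial p : exists C M : R, [/\ 0 <= C, 0 <= M,
  forall z, cabs z <= 1 -> cabs p.[z] <= M &
  forall z (r : R), cabs z <= 1 -> 0 <= r <= 1 ->
    cabs (p.[z] - p.[r%:C%C * z]) <= C * (1 - r)].
Proof.
elim/poly_ind: p => [|p c [C [M [C0 M0 pM pC]]]].
  by exists 0, 0; split=> // z *; rewrite !horner0 ?subrr cabs0 ?mul0r.
exists (C + M), (M + cabs c); split.
- exact: addr_ge0.
- by rewrite addr_ge0// cabs_ge0.
- move=> z z1; rewrite hornerMXaddC (le_trans (cabsD _ _))// lerD2r cabsM.
  by rewrite -[leRHS]mulr1 ler_pM ?cabs_ge0// pM.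
- move=> z r z1 /andP[r0 r1]; rewrite !hornerMXaddC.
  have rz : cabs (r%:C%C * z) <= 1.
    by rewrite cabsM cabs_real ger0_norm// mulr_ile1 ?cabs_ge0.
  have -> : p.[z] * z + c - (p.[r%:C%C * z] * (r%:C%C * z) + c) =
      (p.[z] - p.[r%:C%C * z]) * z + p.[r%:C%C * z] * ((1 - r)%:C%C * z).
    by rewrite rmorphB rmorph1; ring.
  have s0 : 0 <= 1 - r by rewrite subr_ge0.
  rewrite (le_trans (cabsD _ _))// [leRHS]mulrDl !cabsM cabs_real (ger0_norm s0).
  have h1 : cabs (p.[z] - p.[r%:C%C * z]) <= C * (1 - r) by rewrite pC ?r0.
  have h2 := pM _ rz.
  apply: lerD; first by rewrite -[leRHS]mulr1 ler_pM ?cabs_ge0.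
  rewrite ler_pM ?cabs_ge0 ?mulr_ge0 ?cabs_ge0//.
  by rewrite -[leRHS]mulr1 ler_pM ?cabs_ge0.
Qed.

(** Move radially into the open disc and use [horner_radial]. *)
Lemma horner_lower p (d : R) : (forall w, cabs w < 1 -> d <= cabs p.[w]) ->
  forall z, cabs z <= 1 -> d <= cabs p.[z].
Proof.
move=> pd z z1; have [C [M [C0 M0 _ pC]]] := horner_radial p.
apply/ler_addgt0Pr => e e0; have c1 : 0 < C + 1 by rewrite ltr_wpDl.
(* The radial step [s] costs at most [C s <= e]. *)
pose s := Num.min 1 (e / (C + 1)).
have s0 : 0 < s by rewrite lt_min ltr01 divr_gt0.
have s1 : s <= 1 by rewrite ge_min lexx.
have se : C * s <= e.
  have : s <= e / (C + 1) by rewrite ge_min lexx orbT.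
  move=> /(ler_wpM2l C0)/le_trans; apply.
  by rewrite mulrCA ler_piMr ?(ltW e0)// ler_pdivrMr// mul1r lerDl.
have r0 : 0 <= 1 - s by rewrite subr_ge0.
have r1 : 1 - s < 1 by rewrite gtrBl.
have := pC z (1 - s) z1; rewrite r0 (ltW r1) subKr => /(_ isT) h.
have w1 : cabs ((1 - s)%:C%C * z) < 1.
  by rewrite cabsM cabs_real ger0_norm// (le_lt_trans _ r1)// ler_piMr.
rewrite (le_trans (pd _ w1))// -(subrK p.[z] p.[(1 - s)%:C%C * z]).
by rewrite (le_trans (cabsD _ _))// addrC lerD2l cabs_distC (le_trans h).
Qed.

(** [1/g] is obtained from the inverse of a nearby polynomial by a Neumann
    series; the maximum principle carries the lower bound of the Gelfand
    transform of [g] over to the polynomial. *)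
Lemma disc_alg_inv g (d : R) : disc_alg g -> 0 < d ->
  (forall w, cabs w < 1 -> d <= cabs (gelfand g w)) ->
  disc_alg (fun z => (g z)^-1) /\ forall t, g (cis t) != 0.
Proof.
move=> ag d0 gd; have d3 : 0 < d / 3 by rewrite divr_gt0.
have [p gp] := ag _ d3.
have ap := disc_alg_horner p; have agp := disc_algB ag ap.
have pw w : cabs w < 1 -> 2 * (d / 3) <= cabs p.[w].
  move=> w1; have := gelfand_disc_alg_le w1 agp (ltW d3) gp.
  rewrite gelfandB ?gelfand_horner//; try exact: disc_alg_L2.
  move=> h; have := gd w w1; have := cabs_sub (gelfand g w) p.[w].
  by move: h; lra.
have pz := horner_lower pw.
have pn0 z : cabs z <= 1 -> p.[z] != 0.
  by move=> /pz h; rewrite -cabs_gt0 (lt_le_trans _ h)// mulr_gt0.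
have pc0 t : p.[cis t] != 0 by rewrite pn0 ?cabs_cis.
have aip := disc_alg_inv_horner pn0.
have au : disc_alg (fun z => (p.[z] - g z) * p.[z]^-1).
  by apply: disc_algM => //; exact: disc_algB.
have uM t : cabs ((p.[cis t] - g (cis t)) * p.[cis t]^-1) <= 1 / 2.
  rewrite cabsM cabsV ler_pdivrMr ?cabs_gt0// cabs_distC.
  have := pz (cis t); rewrite cabs_cis => /(_ (lexx _)).
  by have := gp t; lra.
have h2 : (1 / 2 : R) < 1 by lra.
have ai := disc_alg_inv_1sub au h2 uM.
have e t : g (cis t) = p.[cis t] * (1 - (p.[cis t] - g (cis t)) * p.[cis t]^-1).
  by rewrite mulrBr mulr1 mulrCA divff// mulr1 opprB addrC subrK.
split.
  apply: (eq_disc_alg _ (disc_algM aip ai)) => t /=.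
  by rewrite [in RHS]e invfM.
move=> t; rewrite e mulf_neq0// -cabs_gt0.
apply: lt_le_trans (cabs_sub _ _); rewrite cabs1 subr_gt0.
exact: le_lt_trans (uM t) h2.
Qed.

End Inversion.

(** * Operators on the Hardy space *)

Section Operators.
Variable R : realType.
Implicit Types (f g h b : R[i] -> R[i]) (t s : R) (p : {poly R[i]}) (z w : R[i]).
Implicit Types (T S : (R[i] -> R[i]) -> (R[i] -> R[i])).
Local Notation mu := (@lebesgue_measure R).

Lemma eq_circle_refl f : eq_circle f f.
Proof. exact: ae_eq_refl. Qed.

Lemma eq_circle_sym f g : eq_circle f g -> eq_circle g f.
Proof. exact: ae_eq_sym. Qed.

Lemma eq_circle_trans g f h : eq_circle f g -> eq_circle g h -> eq_circle f h.
Proof. exact: ae_eq_trans. Qed.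

Lemma eq_circleP f g : (forall t, f (cis t) = g (cis t)) -> eq_circle f g.
Proof. by move=> fg; apply: aeW => t _ /=; rewrite fg. Qed.

Lemma eq_circleD f g f' g' : eq_circle f g -> eq_circle f' g' ->
  eq_circle (fun z => f z + f' z) (fun z => g z + g' z).
Proof.
by apply: filterS2 => t /= h1 h2 At; rewrite h1// h2.
Qed.

Lemma eq_circleZ z f g : eq_circle f g ->
  eq_circle (fun x => z * f x) (fun x => z * g x).
Proof. by apply: filterS => t /= h1 At; rewrite h1. Qed.

Lemma eq_circleN f g : eq_circle f g ->
  eq_circle (fun x => - f x) (fun x => - g x).
Proof. by apply: filterS => t /= h1 At; rewrite h1. Qed.

Lemma eq_circle_norm2 f g : in_L2 f -> in_L2 g ->
  eq_circle f g <-> norm2 (fun z => f z - g z) = 0.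
Proof.
move=> sf sg; have sfg := sqintB sf sg; split => [fg|].
  have h : ae_eq mu (@arc R) (fun t => f (cis t) - g (cis t)) (cst 0).
    by apply: filterS fg => t /= h At; rewrite h// subrr.
  rewrite norm2E (ae_eq_nrm _ _ h); [exact: nrm0|exact: sqint_meas|exact: cmeas_cst].
move=> /(nrm_eq0 sfg); apply: filterS => t /= h At.
by apply/eqP; rewrite -subr_eq0 h.
Qed.

Lemma ae_eq_norm2 f g : in_L2 f -> in_L2 g -> eq_circle f g -> norm2 f = norm2 g.
Proof.
by move=> sf sg fg; exact: (ae_eq_nrm (sqint_meas sf) (sqint_meas sg) fg).
Qed.

Lemma in_L2Z z f : in_L2 f -> in_L2 (fun x => z * f x).
Proof. exact: sqintZ. Qed.

Lemma in_L2B f g : in_L2 f -> in_L2 g -> in_L2 (fun z => f z - g z).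
Proof. exact: sqintB. Qed.

Lemma in_H2D f g : in_H2 f -> in_H2 g -> in_H2 (fun z => f z + g z).
Proof. exact: hardyD. Qed.

Lemma in_H2Z z f : in_H2 f -> in_H2 (fun x => z * f x).
Proof. exact: hardyZ. Qed.

Lemma in_H2B f g : in_H2 f -> in_H2 g -> in_H2 (fun z => f z - g z).
Proof. exact: hardyB. Qed.

Lemma norm2_ge0 f : 0 <= norm2 f.
Proof. exact: nrm_ge0. Qed.

Lemma norm2D f g : in_L2 f -> in_L2 g ->
  norm2 (fun z => f z + g z) <= norm2 f + norm2 g.
Proof. exact: nrmD. Qed.

Lemma in_L2_rot f s : in_L2 f -> in_L2 (fun z => f (cis s * z)).
Proof. exact: sqint_rot. Qed.

Lemma norm2_rot f s : in_L2 f -> norm2 (fun z => f (cis s * z)) = norm2 f.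
Proof. exact: nrm_rot. Qed.

Lemma eq_circle_rot f g s : in_L2 f -> in_L2 g -> eq_circle f g ->
  eq_circle (fun z => f (cis s * z)) (fun z => g (cis s * z)).
Proof.
move=> sf sg fg; apply/eq_circle_norm2; try exact: in_L2_rot.
have := norm2_rot s (in_L2B sf sg); rewrite /= => ->.
exact/eq_circle_norm2.
Qed.

Lemma fourier_rot f s n : in_L2 f ->
  fourier (fun z => f (cis s * z)) n = cis s ^ n * fourier f n.
Proof.
move=> sf; have sn := @sqint_cisz R n.
have h := @mean_rot R (fun z => f z * (z ^ n)^*) s (sqint_cintMC sf sn).
rewrite [fourier f n](esym h : _ = mean _).
rewrite -meanZ; last first.
  exact: (sqint_cintMC (sqint_rot s sf) (@sqint_rot R (fun z => z ^ n) s sn)).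
apply: eq_mean => t _; rewrite [RHS]mulrCA; congr (_ * _).
by rewrite expfzMl rmorphM mulrA [cis s ^ n]cisXz cis_mulC mul1r.
Qed.

Lemma in_H2_rot f s : in_H2 f -> in_H2 (fun z => f (cis s * z)).
Proof.
move=> [sf hf]; split; first exact: in_L2_rot.
by move=> n n0; rewrite fourier_rot// hf// mulr0.
Qed.

Lemma bounded_operator_intro T (M : R) :
  (forall f, in_H2 f -> in_H2 (T f)) ->
  (forall (a : R[i]) f g, T (fun z => a * f z + g z) = (fun z => a * T f z + T g z)) ->
  (forall f, in_H2 f -> norm2 (T f) <= M * norm2 f) ->
  bounded_operator T.
Proof.
move=> TH TL TM; split => //.
- move=> f g hf hg; have [sf _] := hf; have [sg _] := hg.
  have [sTf _] := TH f hf; have [sTg _] := TH g hg.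
  move=> /(eq_circle_norm2 sf sg) n0; apply/eq_circle_norm2 => //.
  have e : (fun z => T f z - T g z) = T (fun z => -1 * g z + f z).
    by rewrite TL; apply/funext => z; rewrite mulN1r addrC.
  have e' : (fun z => -1 * g z + f z) = (fun z => f z - g z).
    by apply/funext => z; rewrite mulN1r addrC.
  apply/eqP; rewrite e e' eq_le norm2_ge0 andbT.
  by have := TM _ (in_H2B hf hg); rewrite n0 mulr0.
- by move=> a f g _ _; rewrite TL; exact: eq_circle_refl.
- by exists M.
Qed.

Lemma H2_dense f (e : R) : in_H2 f -> 0 < e ->
  exists p, norm2 (fun z => f z - p.[z]) <= e.
Proof. by move=> hf e0; exact: (hardy_dense hf e0). Qed.

(** By linearity the operators agree on polynomials, which are dense. *)
Lemma bounded_operator_ext T T' : bounded_operator T -> bounded_operator T' ->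
  (forall m : nat, eq_circle (T (basis m%:Z)) (T' (basis m%:Z))) ->
  forall f, in_H2 f -> eq_circle (T f) (T' f).
Proof.
move=> [TH TE TL [M TM]] [TH' TE' TL' [M' TM']] TT f hf.
have hz (m : nat) : in_H2 (@basis R m%:Z).
  by have := hardy_horner ('X^m : {poly R[i]}); under eq_fun do rewrite hornerXn.
pose P N (c : nat -> R[i]) z := \sum_(i < N) c i * basis i%:Z z.
have hP N c : in_H2 (P N c).
  elim: N => [|N IH].
    by rewrite (_ : P 0%N c = fun=> 0); [exact: (hardy_cst 0)|apply/funext => z; rewrite /P big_ord0].
  have -> : P N.+1 c = (fun z => c N * basis N%:Z z + P N c z).
    by apply/funext => z; rewrite /P big_ord_recr addrC.
  by apply: in_H2D => //; exact: in_H2Z.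
have T0 U : (forall (a : R[i]) f g, in_H2 f -> in_H2 g ->
    eq_circle (U (fun z => a * f z + g z)) (fun z => a * U f z + U g z)) ->
    eq_circle (U (fun=> 0)) (fun=> 0).
  move=> UL; have h0 : in_H2 (fun=> 0 : R[i]) by exact: (hardy_cst 0).
  have := UL (-1) _ _ h0 h0.
  rewrite (_ : (fun z : R[i] => -1 * 0 + 0) = fun=> 0); last first.
    by apply/funext => z; rewrite mulr0 addr0.
  by move/eq_circle_trans; apply; apply: eq_circleP => t; rewrite mulN1r addNr.
have TP N c : eq_circle (T (P N c)) (T' (P N c)).
  elim: N => [|N IH].
    rewrite (_ : P 0%N c = fun=> 0); last by apply/funext => z; rewrite /P big_ord0.
    exact: eq_circle_trans (T0 _ TL) (eq_circle_sym (T0 _ TL')).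
  have -> : P N.+1 c = (fun z => c N * basis N%:Z z + P N c z).
    by apply/funext => z; rewrite /P big_ord_recr addrC.
  apply: eq_circle_trans (TL _ _ _ (hz N) (hP N c)) _.
  apply: eq_circle_sym; apply: eq_circle_trans (TL' _ _ _ (hz N) (hP N c)) _.
  by apply: eq_circle_sym; apply: eq_circleD IH; apply: eq_circleZ.
have [sTf _] := TH f hf; have [sTf' _] := TH' f hf.
apply/eq_circle_norm2 => //; apply/eqP; rewrite eq_le norm2_ge0 andbT.
apply/ler_addgt0Pr => e e0; rewrite add0r.
have C0 : 0 < `|M| + `|M'| + 1 by rewrite ltr_wpDl// addr_ge0.
have [p fp] := H2_dense hf (divr_gt0 e0 C0).
pose g z := f z - p.[z].
have hp : in_H2 (fun z => p.[z]) by exact: hardy_horner.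
have hg : in_H2 g by exact: in_H2B.
have pP : (fun z => p.[z]) = P (size p) (fun i => p`_i).
  by apply/funext => z; rewrite horner_coef.
have fE : f = (fun z => 1 * g z + p.[z]).
  by apply/funext => z; rewrite mul1r /g subrK.
have [sTg _] := TH g hg; have [sTg' _] := TH' g hg.
have [sTp _] := TH _ hp; have [sTp' _] := TH' _ hp.
have eq1 : eq_circle (fun z => T f z - T' f z) (fun z => T g z - T' g z).
  have h1 := TL 1 _ _ hg hp; rewrite -fE in h1.
  have h2 := TL' 1 _ _ hg hp; rewrite -fE in h2.
  have h3 : eq_circle (T (fun z => p.[z])) (T' (fun z => p.[z])) by rewrite pP.
  have := eq_circleD h1 (eq_circleN h2).
  move/eq_circle_trans; apply.
  by apply: filterS h3 => t /= h3 At; rewrite h3// !mul1r; ring.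
have s1 := in_L2B sTf sTf'; have s2 := in_L2B sTg sTg'.
rewrite (ae_eq_norm2 s1 s2 eq1).
apply: (@le_trans _ _ ((`|M| + `|M'|) * norm2 g)).
  apply: le_trans (nrmB sTg sTg') _; rewrite mulrDl; apply: lerD.
    by apply: le_trans (TM g hg) _; rewrite ler_wpM2r ?norm2_ge0// ler_norm.
  by apply: le_trans (TM' g hg) _; rewrite ler_wpM2r ?norm2_ge0// ler_norm.
apply: (@le_trans _ _ ((`|M| + `|M'|) * (e / (`|M| + `|M'| + 1)))).
  by rewrite ler_wpM2l ?addr_ge0.
by rewrite mulrCA ler_piMr ?(ltW e0)// ler_pdivrMr// mul1r lerDl.
Qed.

End Operators.

(** * The lambda-Toeplitz operator *)

Section LambdaToeplitz.
Variables (R : realType) (th : R) (q : nat) (phi : R[i] -> R[i]).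
Implicit Types (f g h b : R[i] -> R[i]) (t s : R) (z w m : R[i]).
Implicit Types (T S : (R[i] -> R[i]) -> (R[i] -> R[i])).
Local Notation mu := (@lebesgue_measure R).
Local Notation lam := (cis th).
Hypotheses (q_ge1 : (1 <= q)%N) (lam_q : lam ^+ q = 1).
Hypothesis phi_H2 : in_H2 phi.
Hypothesis phi_da : disc_alg phi.

(** With [phi] analytic, column [n] of the matrix of the lambda-Toeplitz operator
    is [lam^n z^n phi]; hence the operator is [f |-> phi (f o lam)]. *)
Definition weighted_rot f z : R[i] := phi z * f (lam * z).

Lemma weighted_rot_H2 f : in_H2 f -> in_H2 (weighted_rot f).
Proof. by move=> hf; apply: disc_algM_H2 => //; exact: in_H2_rot. Qed.

Lemma weighted_rot_linear (a : R[i]) f g :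
  weighted_rot (fun z => a * f z + g z) =
  (fun z => a * weighted_rot f z + weighted_rot g z).
Proof. by apply/funext => z; rewrite /weighted_rot; ring. Qed.

Lemma weighted_rot_bounded : bounded_operator weighted_rot.
Proof.
have [M M0 pM] := disc_alg_bounded phi_da.
apply: (@bounded_operator_intro _ _ M).
- exact: weighted_rot_H2.
- exact: weighted_rot_linear.
- move=> f [sf _]; rewrite -(norm2_rot th sf).
  by apply: disc_algM_norm2 => //; exact: in_L2_rot.
Qed.

Lemma weighted_rot_toeplitz : is_lambda_toeplitz lam phi weighted_rot.
Proof.
split; first exact: weighted_rot_bounded.
move=> i n; have [sphi aphi] := phi_H2.
have -> : inner (weighted_rot (basis i%:Z)) (basis n%:Z) =
    coef (fun t => lam ^+ i * (cis t ^ i%:Z * phi (cis t))) n%:Z.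
  apply: eq_mean => t _; congr (_ * _).
  by rewrite /weighted_rot /basis -!exprnP exprMn; ring.
rewrite coefZ; last first.
  by apply: (@sqint_bounded _ _ 1) => //; [exact: cmeas_cisz|move=> t _; rewrite cabs_cisz].
rewrite coef_shift -[coef _ _]/(fourier phi (n%:Z - i%:Z)).
case: (leqP i n) => [//|lt_ni].
by rewrite aphi ?mulr0// subr_lt0 ltz_nat.
Qed.

Lemma fourier_eq_circle f g : in_H2 f -> in_H2 g ->
  (forall n : nat, fourier f n%:Z = fourier g n%:Z) -> eq_circle f g.
Proof.
move=> hf hg fg; have [sf _] := hf; have [sg _] := hg.
apply/eq_circle_norm2 => //; apply: (hardy_coef0 (in_H2B hf hg)) => n.
have := @ipBl R _ _ _ sf sg (@sqint_cisz R n%:Z).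
rewrite -[ip (fun t => f (cis t)) _]/(fourier f n%:Z).
by rewrite -[ip (fun t => g (cis t)) _]/(fourier g n%:Z) fg subrr.
Qed.

Lemma lambda_toeplitzP : bounded_operator (lambda_toeplitz lam phi) /\
  forall f, in_H2 f -> eq_circle (lambda_toeplitz lam phi f) (weighted_rot f).
Proof.
have [bT mT] : is_lambda_toeplitz lam phi (lambda_toeplitz lam phi).
  exact: (@xgetI _ _ [set T | is_lambda_toeplitz lam phi T] _ weighted_rot_toeplitz).
have [bW mW] := weighted_rot_toeplitz.
split => //; apply: bounded_operator_ext => // i.
have hi : in_H2 (@basis R i%:Z).
  by have := hardy_horner ('X^i : {poly R[i]}); under eq_fun do rewrite hornerXn.
apply: fourier_eq_circle => [||n].
- exact: (bounded_operator_H2 bT).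
- exact: (bounded_operator_H2 bW).
- by rewrite /fourier mT mW.
Qed.

(** The coefficients [conj lam^n a_n] are those of the rotated symbol: at
    negative indices both families vanish, [phi] being analytic. *)
Lemma twisted_symbolP : in_L2 (twisted_symbol lam phi) /\
  eq_circle (twisted_symbol lam phi) (fun z => phi (lam^* * z)).
Proof.
have [sphi aphi] := phi_H2.
have cN : lam^* = cis (- th) by rewrite cisN.
have s0 : in_L2 (fun z => phi (lam^* * z)) by rewrite cN; exact: in_L2_rot.
have c0 n : fourier (fun z => phi (lam^* * z)) n = lam^* ^ n * fourier phi n.
  by rewrite cN fourier_rot.
have h0 : in_H2 (fun z => phi (lam^* * z)).
  by split => // n n0; rewrite c0 aphi// mulr0.
have [sT cT] : in_L2 (twisted_symbol lam phi) /\
    forall n, fourier (twisted_symbol lam phi) n = twisted_coef lam (fourier phi) n.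
  apply: (@xgetI _ _ [set psi | in_L2 psi /\
    forall n, fourier psi n = twisted_coef lam (fourier phi) n]
    (fun z => phi (lam^* * z))).
  split => // n; rewrite c0 /twisted_coef; case: ifPn => //.
  by rewrite -ltNge => n0; rewrite aphi// mulr0.
split => //; apply: fourier_eq_circle => // [|n].
  split => // n n0; rewrite cT /twisted_coef leNgt n0 /=.
  exact: aphi.
by rewrite cT c0 /twisted_coef.
Qed.

(** [T^k f z = orbit_prod k z * f (lam^k z)] for the weighted rotation [T]. *)
Definition orbit_prod k z : R[i] := \prod_(j < k) phi (lam ^+ j * z).

Lemma disc_alg_rotX f k : disc_alg f -> disc_alg (fun z => f (lam ^+ k * z)).
Proof. by rewrite cisX; exact: disc_alg_rot. Qed.

Lemma disc_alg_orbit_prod k : disc_alg (orbit_prod k).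
Proof.
by apply: (@disc_alg_prod _ k (fun j z => phi (lam ^+ j * z))) => j; exact: disc_alg_rotX.
Qed.

(** The factors run over the orbit of [z] under the inverse rotation, which is the
    orbit under the rotation read backwards because [lam^q = 1]. *)
Lemma gelfand_symbol_product w : cabs w < 1 ->
  gelfand (symbol_product lam q phi) w = gelfand (orbit_prod q) w.
Proof.
move=> w1; have [sT eT] := twisted_symbolP; have [sphi _] := phi_H2.
have cN : lam^* = cis (- th) by rewrite cisN.
have itE j z : iter j (fun v => lam^* * v) z = cis (- th *+ j) * z.
  by elim: j => [|j IH] /=; rewrite ?mulr0n ?cis0 ?mul1r// IH mulrA cN -cisD mulrS.
have ss : in_L2 (fun z => phi (lam^* * z)) by rewrite cN; exact: in_L2_rot.
have h N : [/\ cmeas (fun t => \prod_(j < N)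
        twisted_symbol lam phi (iter j (fun v => lam^* * v) (cis t))),
      cmeas (fun t => \prod_(j < N) phi (lam^* * (cis (- th *+ j) * cis t))) &
      eq_circle (fun z => \prod_(j < N)
        twisted_symbol lam phi (iter j (fun v => lam^* * v) z))
        (fun z => \prod_(j < N) phi (lam^* * (cis (- th *+ j) * z)))].
  elim: N => [|N [m1 m2 eN]].
    split; try by under eq_fun do rewrite big_ord0; exact: cmeas_cst.
    by apply: eq_circleP => t; rewrite !big_ord0.
  have r1 := @in_L2_rot R (twisted_symbol lam phi) (- th *+ N) sT.
  have r2 := @in_L2_rot R _ (- th *+ N) ss.
  split.
  - have := cmeasM m1 (sqint_meas r1).
    by congr cmeas; apply/funext => t; rewrite big_ord_recr /= itE.
  - have := cmeasM m2 (sqint_meas r2).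
    by congr cmeas; apply/funext => t; rewrite big_ord_recr.
  - have := eq_circle_rot (- th *+ N) sT ss eT.
    move: eN; apply: filterS2 => t /= h1 h2 At.
    by rewrite !big_ord_recr /= h1// itE h2.
have [m1 m2 e] := h q.
rewrite (ae_eq_gelfand w1 m1 m2 e); apply: eq_gelfand => t.
rewrite [RHS](reindex_inj rev_ord_inj); apply: eq_bigr => j _ /=.
congr phi; rewrite mulrA; congr (_ * _).
rewrite cN -cisD -mulrS -cisX cisN -[LHS]mul1r -lam_q -{1}(subnK (ltn_ord j)).
by rewrite exprD -mulrA -exprMn cis_mulC expr1n mulr1.
Qed.

End LambdaToeplitz.

(** * The resolvent *)

Section Resolvent.
Variables (R : realType) (th : R) (q : nat) (phi : R[i] -> R[i]).
Implicit Types (f g h b : R[i] -> R[i]) (t s : R) (z w : R[i]).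
Implicit Types (T S : (R[i] -> R[i]) -> (R[i] -> R[i])).
Local Notation lam := (cis th).
Hypotheses (q_ge1 : (1 <= q)%N) (lam_q : lam ^+ q = 1).
Hypothesis lam_prim : forall k, (0 < k < q)%N -> lam ^+ k != 1.
Hypothesis phi_H2 : in_H2 phi.
Hypothesis phi_da : disc_alg phi.
Local Notation W := (weighted_rot th phi).
Local Notation OP := (orbit_prod th phi).
Variable m : R[i].

Lemma orbit_prodSl k z : OP k.+1 z = phi z * OP k (lam * z).
Proof.
rewrite /orbit_prod big_ord_recl expr0 mul1r; congr (_ * _).
by apply: eq_bigr => j _; rewrite mulrA -exprSr.
Qed.

Lemma orbit_prodSr k z : OP k.+1 z = OP k z * phi (lam ^+ k * z).
Proof. by rewrite /orbit_prod big_ord_recr. Qed.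

Lemma orbit_prod_rot z : OP q (lam * z) = OP q z.
Proof.
case: q lam_q q_ge1 => [//|k] lk _.
by rewrite orbit_prodSr orbit_prodSl mulrA -exprSr lk mul1r mulrC.
Qed.

(** The sum of the [m^(q-1-k) T^k] over [k < q], for the weighted rotation [T]: the
    cofactor of [m - T] in [m^q - T^q]. *)
Definition resol f z : R[i] :=
  \sum_(k < q) m ^+ (q.-1 - k) * (OP k z * f (lam ^+ k * z)).

Lemma resol_linear (a : R[i]) f g :
  resol (fun z => a * f z + g z) = (fun z => a * resol f z + resol g z).
Proof.
apply/funext => z; rewrite /resol mulr_sumr -big_split; apply: eq_bigr => k _ /=.
by ring.
Qed.

Lemma resol_left f z : m * resol f z - W (resol f) z = (m ^+ q - OP q z) * f z.
Proof.
pose u k := m ^+ (q - k) * (OP k z * f (lam ^+ k * z)).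
have e1 : m * resol f z = \sum_(k < q) u k.
  rewrite /resol mulr_sumr; apply: eq_bigr => k _; rewrite /u mulrA -exprS.
  have kq : (k <= q.-1)%N by rewrite -ltnS prednK// ltn_ord.
  by rewrite -subSn// prednK.
have e2 : W (resol f) z = \sum_(k < q) u k.+1.
  rewrite /weighted_rot /resol mulr_sumr; apply: eq_bigr => k _.
  rewrite /u orbit_prodSl.
  have -> : lam ^+ k * (lam * z) = lam ^+ k.+1 * z by rewrite mulrA -exprSr.
  have -> : (q - k.+1 = q.-1 - k)%N by rewrite subnS -subn1 -subn1 subnAC.
  by ring.
have tel n : \sum_(k < n) u k - \sum_(k < n) u k.+1 = u 0%N - u n.
  elim: n => [|n IH]; first by rewrite !big_ord0 !subrr.
  by rewrite !big_ord_recr /= opprD addrACA IH addrA subrK.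
rewrite e1 e2 tel /u subn0 subnn !expr0 lam_q !mul1r /orbit_prod big_ord0.
by ring.
Qed.

Lemma resol_comm f : resol (W f) = W (resol f).
Proof.
apply/funext => z; rewrite /resol {2}/weighted_rot mulr_sumr.
apply: eq_bigr => k _; rewrite /weighted_rot.
have e : OP k z * phi (lam ^+ k * z) = phi z * OP k (lam * z).
  by rewrite -orbit_prodSr orbit_prodSl.
have -> : lam ^+ k * (lam * z) = lam * (lam ^+ k * z) by ring.
transitivity (m ^+ (q.-1 - k) *
  ((OP k z * phi (lam ^+ k * z)) * f (lam * (lam ^+ k * z)))); first by ring.
by rewrite e; ring.
Qed.

Lemma resol_invariant b f : (forall z, b (lam * z) = b z) ->
  resol (fun z => b z * f z) = (fun z => b z * resol f z).
Proof.
move=> hb; have hbX k z : b (lam ^+ k * z) = b z.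
  by elim: k => [|k IH]; rewrite ?expr0 ?mul1r// exprS -mulrA hb.
apply/funext => z; rewrite /resol mulr_sumr; apply: eq_bigr => k _.
by rewrite hbX; ring.
Qed.

Let term k f z := m ^+ (q.-1 - k) * (OP k z * f (lam ^+ k * z)).

Let term_H2 k f : in_H2 f -> in_H2 (term k f).
Proof.
move=> hf; apply: in_H2Z; apply: disc_algM_H2; first exact: disc_alg_orbit_prod.
by rewrite cisX; exact: in_H2_rot.
Qed.

Lemma resol_H2 f : in_H2 f -> in_H2 (resol f).
Proof.
move=> hf; suff : forall n, in_H2 (fun z => \sum_(k < n) term k f z) by exact.
elim=> [|n IH].
  by under eq_fun do rewrite big_ord0; exact: (hardy_cst 0).
have := in_H2D IH (term_H2 n hf).
by congr in_H2; apply/funext => z; rewrite big_ord_recr.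
Qed.

(** Each term is a bounded multiple of a rotation of [f]. *)
Lemma resol_bound : exists2 C : R, 0 <= C &
  forall f, in_H2 f -> norm2 (resol f) <= C * norm2 f.
Proof.
have key n : exists2 C : R, 0 <= C & forall f, in_H2 f ->
    in_H2 (fun z => \sum_(k < n) term k f z) /\
    norm2 (fun z => \sum_(k < n) term k f z) <= C * norm2 f.
  elim: n => [|n [C C0 IH]].
    exists 0 => // f hf; under eq_fun do rewrite big_ord0.
    rewrite mul0r; split; first exact: (hardy_cst 0).
    by rewrite norm2E nrm0.
  have [M M0 pM] := disc_alg_bounded (disc_alg_orbit_prod th phi_da n).
  exists (C + cabs (m ^+ (q.-1 - n)) * M).
    by rewrite addr_ge0// mulr_ge0// cabs_ge0.
  move=> f hf; have [hS nS] := IH f hf; have ht := term_H2 n hf.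
  have [sS _] := hS; have [st _] := ht; have [sf _] := hf.
  have -> : (fun z => \sum_(k < n.+1) term k f z) =
      (fun z => \sum_(k < n) term k f z + term n f z).
    by apply/funext => z; rewrite big_ord_recr.
  split; first exact: in_H2D.
  apply: le_trans (norm2D sS st) _; rewrite mulrDl lerD//.
  have sr : in_L2 (fun z => f (lam ^+ n * z)) by rewrite cisX; exact: in_L2_rot.
  have sb := disc_algM_L2 (disc_alg_orbit_prod th phi_da n) sr.
  have -> : norm2 (term n f) = cabs (m ^+ (q.-1 - n)) *
      norm2 (fun z => OP n z * f (lam ^+ n * z)) by exact: (nrmZ _ sb).
  rewrite -mulrA ler_wpM2l ?cabs_ge0//.
  have <- : norm2 (fun z => f (lam ^+ n * z)) = norm2 f.
    by rewrite cisX norm2_rot.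
  by apply: disc_algM_norm2 => //; exact: disc_alg_orbit_prod.
by have [C C0 h] := key q; exists C => // f hf; have [] := h f hf.
Qed.

Lemma gelfand_resol f w : cabs w < 1 -> in_H2 f -> gelfand (resol f) w =
  \sum_(k < q) m ^+ (q.-1 - k) * (gelfand (OP k) w * gelfand f (lam ^+ k * w)).
Proof.
move=> w1 hf; rewrite -[resol f]/(fun z => \sum_(k < q) term k f z).
have gt k : gelfand (term k f) w =
    m ^+ (q.-1 - k) * (gelfand (OP k) w * gelfand f (lam ^+ k * w)).
  have aO := disc_alg_orbit_prod th phi_da k.
  have hr : in_H2 (fun z => f (lam ^+ k * z)) by rewrite cisX; exact: in_H2_rot.
  have [sr _] := hr; have [sf _] := hf.
  rewrite gelfandZ//; last exact: disc_algM_L2.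
  by rewrite gelfandM//; congr (_ * (_ * _)); rewrite cisX gelfand_rot.
suff : forall n, in_H2 (fun z => \sum_(k < n) term k f z) /\
  gelfand (fun z => \sum_(k < n) term k f z) w =
  \sum_(k < n) m ^+ (q.-1 - k) * (gelfand (OP k) w * gelfand f (lam ^+ k * w)).
  by move=> /(_ q)[].
elim=> [|n [IH1 IH2]].
  split; first by under eq_fun do rewrite big_ord0; exact: (hardy_cst 0).
  by rewrite big_ord0 -[RHS](gelfand_cst w1 0); apply: eq_gelfand => t; rewrite big_ord0.
have -> : (fun z => \sum_(k < n.+1) term k f z) =
    (fun z => \sum_(k < n) term k f z + term n f z).
  by apply/funext => z; rewrite big_ord_recr.
have ht := term_H2 n hf; split; first exact: in_H2D.
have [s1 _] := IH1; have [s2 _] := ht.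
by rewrite gelfandD// IH2 gt big_ord_recr.
Qed.

Definition invertible_at T := exists S, [/\ bounded_operator S,
  (forall f, in_H2 f -> eq_circle (S (fun z => m * f z - T f z)) f) &
  (forall f, in_H2 f -> eq_circle (fun z => m * S f z - T (S f) z) f)].

Local Notation T := (lambda_toeplitz lam phi).

Lemma toeplitz_shift f : in_H2 f ->
  in_H2 (fun z => m * f z - T f z) /\
  eq_circle (fun z => m * f z - T f z) (fun z => m * f z - W f z).
Proof.
move=> hf; have [bT TW] := lambda_toeplitzP th phi_H2 phi_da; split.
  by apply: in_H2B; [exact: in_H2Z|exact: bounded_operator_H2 bT _ hf].
by apply: eq_circleD (eq_circle_refl _) (eq_circleN (TW f hf)).
Qed.

(** The inverse of [m - T] is the cofactor composed with the multiplication by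
    [1 / (m^q - orbit_prod q)], a function of the disc algebra invariant under
    the rotation. *)
Lemma invertible_of_bounded_below (d : R) : 0 < d ->
  (forall w, cabs w < 1 -> d <= cabs (m ^+ q - gelfand (OP q) w)) ->
  invertible_at T.
Proof.
move=> d0 hd; pose g z := m ^+ q - OP q z.
have aO := disc_alg_orbit_prod th phi_da q.
have ag : disc_alg g by apply: disc_algB => //; exact: disc_alg_cst.
have [ai gn0] : disc_alg (fun z => (g z)^-1) /\ forall t, g (cis t) != 0.
  apply: (disc_alg_inv ag d0) => w w1.
  rewrite gelfandB ?gelfand_cst//; [exact: hd| |]; apply: disc_alg_L2 => //.
  exact: disc_alg_cst.
pose S f := resol (fun z => (g z)^-1 * f z).
have [C C0 hC] := resol_bound; have [M M0 hM] := disc_alg_bounded ai.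
have SH f : in_H2 f -> in_H2 (S f).
  by move=> hf; apply: resol_H2; exact: disc_algM_H2.
have bS : bounded_operator S.
  apply: (@bounded_operator_intro _ _ (C * M)) => //.
  - move=> a f f'; rewrite /S -resol_linear; congr resol.
    by apply/funext => z; ring.
  - move=> f hf; apply: le_trans (hC _ (disc_algM_H2 ai hf)) _.
    have [sf _] := hf.
    by rewrite -mulrA ler_wpM2l// disc_algM_norm2.
have left_inv f t : m * S f (cis t) - W (S f) (cis t) = f (cis t).
  by rewrite resol_left -/(g (cis t)) mulrA divff ?mul1r ?gn0.
have right_inv f t : S (fun z => m * f z - W f z) (cis t) = f (cis t).
  have gl z : (g (lam * z))^-1 = (g z)^-1 by rewrite /g orbit_prod_rot.
  rewrite /S (resol_invariant _ gl).
  have -> : (fun z => m * f z - W f z) = (fun z => m * f z + (-1 * W f z + 0)).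
    by apply/funext => z; ring.
  rewrite !resol_linear resol_comm.
  have -> : resol (fun=> 0) (cis t) = 0.
    by rewrite /resol big1// => k _; rewrite !mulr0.
  rewrite addr0 mulN1r resol_left -/(g (cis t)) mulrA mulVf ?mul1r ?gn0//.
exists S; split => // f hf.
- have [h1 h2] := toeplitz_shift hf.
  apply: (@eq_circle_trans _ (S (fun z => m * f z - W f z))).
    apply: (bounded_operator_eq bS) => //.
    by apply: in_H2B; [exact: in_H2Z|exact: weighted_rot_H2].
  by apply: eq_circleP => t; exact: right_inv.
- have [_ h2] := toeplitz_shift (SH f hf).
  by apply: eq_circle_trans h2 _; apply: eq_circleP => t; exact: left_inv.
Qed.

End Resolvent.

(** * Necessity of the lower bound *)

Section Necessity.
Variables (R : realType) (th : R) (q : nat) (phi : R[i] -> R[i]).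
Implicit Types (f g h b : R[i] -> R[i]) (t s : R) (z w : R[i]).
Local Notation lam := (cis th).
Hypotheses (q_ge1 : (1 <= q)%N) (lam_q : lam ^+ q = 1).
Hypothesis lam_prim : forall k, (0 < k < q)%N -> lam ^+ k != 1.
Hypothesis phi_H2 : in_H2 phi.
Hypothesis phi_da : disc_alg phi.
Local Notation W := (weighted_rot th phi).
Local Notation OP := (orbit_prod th phi).
Local Notation T := (lambda_toeplitz lam phi).
Local Notation "'K' w" := (norm2 (kern w)) (at level 10).

Lemma K_gt0 w : cabs w < 1 -> 0 < K w.
Proof.
move=> w1; rewrite lt_def norm2_ge0 andbT -sqrf_eq0 norm2_kern// invr_eq0.
by rewrite subr_eq0 eq_sym lt_eqF// expr_lt1// cabs_ge0.
Qed.

Lemma gelfand_kern_self w : cabs w < 1 -> cabs (gelfand (kern w) w) = K w ^+ 2.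
Proof.
move=> w1; rewrite gelfand_kern// norm2_kern// mulrC mulC_conj.
rewrite -(rmorph1 (@real_complex_def R (Phant R))) -rmorphB cabsV cabs_real.
by rewrite ger0_norm// subr_ge0 ltW// expr_lt1// cabs_ge0.
Qed.

Lemma cabs_lamX k w : cabs (lam ^+ k * w) = cabs w.
Proof. by rewrite cabsM cabsX cabs_cis expr1n mul1r. Qed.

Lemma K_lam w : cabs w < 1 -> K (lam * w) = K w.
Proof.
move=> w1; have e : cabs (lam * w) = cabs w by rewrite cabsM cabs_cis mul1r.
apply/eqP; rewrite -(@eqrXn2 _ 2)// ?norm2_ge0// !norm2_kern ?e//.
Qed.

Lemma gelfand_orbit_prod k w : cabs w < 1 ->
  gelfand (OP k) w = \prod_(j < k) gelfand phi (lam ^+ j * w).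
Proof.
move=> w1; elim: k => [|k IH].
  by rewrite big_ord0 -[RHS](gelfand1 w1); apply: eq_gelfand => t; rewrite /orbit_prod big_ord0.
rewrite big_ord_recr /= -IH.
transitivity (gelfand (fun z => OP k z * phi (lam ^+ k * z)) w).
  by apply: eq_gelfand => t; rewrite orbit_prodSr.
have [sphi _] := phi_H2.
rewrite gelfandM//; first by congr (_ * _); rewrite cisX gelfand_rot.
  exact: disc_alg_orbit_prod.
by rewrite cisX; exact: in_H2_rot.
Qed.

Section Inverse.
Variables (m : R[i]) (S : (R[i] -> R[i]) -> (R[i] -> R[i])) (M : R).
Hypothesis SH : forall f, in_H2 f -> in_H2 (S f).
Hypothesis SM : forall f, in_H2 f -> norm2 (S f) <= M * norm2 f.
Hypothesis SI : forall f, in_H2 f -> eq_circle (fun z => m * S f z - T (S f) z) f.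
Hypothesis M0 : 0 < M.

Let SW f : in_H2 f -> eq_circle (fun z => m * S f z - W (S f) z) f.
Proof.
move=> hf; have [_ h] := toeplitz_shift th phi_H2 phi_da m (SH hf).
exact: eq_circle_trans (eq_circle_sym h) (SI hf).
Qed.

Let gelfand_S f v : cabs v < 1 -> in_H2 f ->
  cabs (gelfand (S f) v) <= M * norm2 f * K v.
Proof.
move=> v1 hf; have [sS _] := SH hf.
by rewrite (le_trans (gelfand_le _ sS))// ler_wpM2r ?norm2_ge0// SM.
Qed.

(** Testing the inverse at the kernel functions bounds [phi] below when [m = 0]. *)
Lemma invertible_phi_lower w : m = 0 -> cabs w < 1 -> 1 <= M * cabs (gelfand phi w).
Proof.
move=> m0 w1; have hk := disc_alg_H2 (disc_alg_kern w1).
have := SW hk; rewrite m0 => e; have hS := SH hk; have [sS _] := hS.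
have hW := weighted_rot_H2 th phi_da hS; have [sW _] := hW; have [sk _] := hk.
have h : gelfand (kern w) w = - (gelfand phi w * gelfand (S (kern w)) (lam * w)).
  rewrite -gelfand_rot// -gelfandM//; last exact: in_H2_rot.
  rewrite -mulN1r -gelfandZ//; apply/esym/ae_eq_gelfand => //.
  - exact: sqint_meas (in_L2Z (-1) sW).
  - exact: sqint_meas.
  - apply: eq_circle_trans e; apply: eq_circleP => t.
    by rewrite mul0r sub0r mulN1r.
have lw1 : cabs (lam * w) < 1 by rewrite cabsM cabs_cis mul1r.
have := gelfand_S lw1 hk; rewrite K_lam// => b.
have k2 : 0 < K w ^+ 2 by rewrite exprn_gt0// K_gt0.
rewrite -(ler_pM2r k2) mul1r -{1}gelfand_kern_self// h cabsN cabsM.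
have -> : M * cabs (gelfand phi w) * K w ^+ 2 =
  cabs (gelfand phi w) * (M * K w * K w) by ring.
by rewrite ler_wpM2l// cabs_ge0.
Qed.

Let P w : {poly R[i]} := \sum_(i < q) w ^+ (q.-1 - i) *: 'X^i.

Let PE w z : (P w).[z] = \sum_(i < q) w ^+ (q.-1 - i) * z ^+ i.
Proof.
rewrite /P horner_sum; apply: eq_bigr => i _.
by rewrite hornerZ hornerXn.
Qed.

Let P_bound w t : cabs w < 1 -> cabs (P w).[cis t] <= q%:R.
Proof.
move=> w1; rewrite PE (le_trans (cabs_sum _))//.
rewrite -[leRHS]mulr1 mulr_natl -[q in leRHS]card_ord -sumr_const.
apply: ler_sum => i _; rewrite cabsM !cabsX cabs_cis expr1n mulr1.
by rewrite exprn_ile1 ?cabs_ge0// ltW.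
Qed.

Let P_orbit w k : (k < q)%N ->
  (P w).[lam ^+ k * w] = if k == 0%N then q%:R * w ^+ q.-1 else 0.
Proof.
move=> kq.
have -> : (P w).[lam ^+ k * w] = w ^+ q.-1 * \sum_(i < q) (lam ^+ k) ^+ i.
  rewrite PE mulr_sumr; apply: eq_bigr => i _.
  have iq : (i <= q.-1)%N by rewrite -ltnS prednK// ltn_ord.
  by rewrite exprMn mulrCA -exprD subnK// mulrC.
case: eqP => [->|/eqP k0].
  under eq_bigr do rewrite expr0 expr1n.
  by rewrite sumr_const card_ord mulrC.
apply/eqP; rewrite mulf_eq0; apply/orP; right.
have n1 : lam ^+ k - 1 != 0 by rewrite subr_eq0 lam_prim// lt0n k0.
by rewrite -(mulrI_eq0 _ (mulfI n1)) -subrX1 -exprM mulnC exprM lam_q expr1n subrr.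
Qed.

(** The test function is the kernel at [w] times the polynomial vanishing on the
    rest of the orbit of [w], so that only the first term of [resol] survives. *)
Lemma invertible_lower w : cabs w < 1 ->
  cabs m ^+ q.-1 * cabs w ^+ q.-1 <= M * cabs (m ^+ q - gelfand (OP q) w).
Proof.
move=> w1; have hk := disc_alg_H2 (disc_alg_kern w1); have [sk _] := hk.
pose f z := (P w).[z] * kern w z.
have hf : in_H2 f by exact: hardy_hornerM.
have nf : norm2 f <= q%:R * K w.
  apply: disc_algM_norm2 => //; first exact: disc_alg_horner.
  by move=> t; exact: P_bound.
have hS := SH hf; have [sS _] := hS; have [sf _] := hf.
have aO := disc_alg_orbit_prod th phi_da q.
have ag : disc_alg (fun z => m ^+ q - OP q z).
  by apply: disc_algB => //; exact: disc_alg_cst.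
have hd : in_H2 (fun z => m * S f z - W (S f) z).
  by apply: in_H2B; [exact: in_H2Z|exact: weighted_rot_H2].
have e : eq_circle (resol th q phi m f) (fun z => (m ^+ q - OP q z) * S f z).
  have [C C0 hC] := resol_bound th q phi_da m.
  apply: (@eq_circle_trans _ (resol th q phi m (fun z => m * S f z - W (S f) z))).
    apply: eq_circle_sym.
    have bR : bounded_operator (resol th q phi m).
      apply: (@bounded_operator_intro _ _ C) => // [g hg|a g g'].
        exact: resol_H2.
      exact: resol_linear.
    by apply: (bounded_operator_eq bR) => //; exact: SW.
  apply: eq_circleP => t.
  have -> : (fun z => m * S f z - W (S f) z) =
      (fun z => m * S f z + (-1 * W (S f) z + 0)) by apply/funext => z; ring.
  rewrite !resol_linear resol_comm.
  have -> : resol th q phi m (fun=> 0) (cis t) = 0.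
    by rewrite /resol big1// => k _; rewrite !mulr0.
  by rewrite addr0 mulN1r resol_left.
have [sR _] := resol_H2 th q phi_da m hf.
have E : gelfand (resol th q phi m f) w = (m ^+ q - gelfand (OP q) w) * gelfand (S f) w.
  rewrite (ae_eq_gelfand w1 (sqint_meas sR) _ e); last first.
    exact: sqint_meas (disc_algM_L2 ag sS).
  rewrite gelfandM// gelfandB ?gelfand_cst//; apply: disc_alg_L2 => //.
  exact: disc_alg_cst.
have gf k : (k < q)%N -> gelfand f (lam ^+ k * w) =
    (if k == 0%N then q%:R * w ^+ q.-1 else 0) * gelfand (kern w) (lam ^+ k * w).
  by move=> kq; rewrite gelfand_hornerM ?cabs_lamX// P_orbit.
have E2 : gelfand (resol th q phi m f) w =
    m ^+ q.-1 * (q%:R * w ^+ q.-1 * gelfand (kern w) w).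
  rewrite gelfand_resol//.
  have gk0 : gelfand (OP 0) w = 1.
    by rewrite gelfand_orbit_prod// big_ord0.
  have [n qE] : exists n, q = n.+1 by exists q.-1; rewrite prednK.
  move: gf; rewrite qE => gf; rewrite big_ord_recl big1 ?addr0 => [|i _].
    by rewrite subn0 gk0 mul1r gf// expr0 mul1r.
  by rewrite gf ?lift0 ?ltnS// mul0r !mulr0.
have q0 : 0 < q%:R :> R by rewrite ltr0n.
have b := gelfand_S w1 hf.
have k2 : 0 < K w ^+ 2 by rewrite exprn_gt0// K_gt0.
rewrite -(ler_pM2r k2) -(ler_pM2r q0).
have -> : cabs m ^+ q.-1 * cabs w ^+ q.-1 * K w ^+ 2 * q%:R =
    cabs (gelfand (resol th q phi m f) w).
  rewrite E2 !cabsM !cabsX gelfand_kern_self//.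
  have -> : cabs (q%:R : R[i]) = q%:R.
    by rewrite -(rmorph_nat (@real_complex_def R (Phant R))) cabs_real ger0_norm.
  by ring.
rewrite E cabsM.
have -> : M * cabs (m ^+ q - gelfand (OP q) w) * K w ^+ 2 * q%:R =
    cabs (m ^+ q - gelfand (OP q) w) * (M * (q%:R * K w) * K w) by ring.
apply: ler_wpM2l; first exact: cabs_ge0.
apply: le_trans b _; rewrite ler_wpM2r ?norm2_ge0// ler_wpM2l//.
exact: ltW.
Qed.

End Inverse.

(** The symbol is invariant under the rotation of order [q], hence its
    coefficients of index strictly between [0] and [q] vanish. *)
Lemma orbit_prod_flat : exists2 C : R, 0 <= C &
  forall w, cabs w <= 1 / 2 ->
    cabs (gelfand (OP q) w - gelfand (OP q) 0) <= C * cabs w ^+ q.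
Proof.
have aO := disc_alg_orbit_prod th phi_da q.
have [sO cO] := disc_alg_H2 aO.
have c10 : cabs (0 : R[i]) < 1 by rewrite cabs0.
pose c := gelfand (OP q) 0.
have cE : c = fourier (OP q) 0.
  by apply: eq_mean => t _; rewrite /basis mul0r subr0 invr1 expr0z conjC1.
have flat (k : int) : 0 < k < q%:Z -> fourier (OP q) k = 0.
  case: k => [k|//] /andP[k0 kq].
  have h := fourier_rot th k%:Z sO.
  have : fourier (OP q) k%:Z = lam ^+ k * fourier (OP q) k%:Z.
    rewrite -exprnP in h; rewrite -h; apply: eq_mean => t _.
    by rewrite orbit_prod_rot.
  move/eqP; rewrite -subr_eq0 -{1}[fourier _ _]mul1r -mulrBl mulf_eq0 => /orP[|/eqP//].
  by rewrite subr_eq0 eq_sym (negPf (lam_prim _))// -!ltz_nat k0.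
(* By flatness, dividing by [z^q] stays in the Hardy space. *)
pose B z := z ^ (- q%:Z) * (OP q z - c).
have sc : sqint (fun t : R => cst c t) by exact: sqint_cst.
have sd := sqintB sO sc.
have hB : in_H2 B.
  split.
    apply: (@sqint_bounded _ _ 1) => //; first exact: cmeas_cisz.
    by move=> t _; rewrite cabs_cisz.
  move=> n n0; rewrite -[fourier _ _]/(coef (fun t => cis t ^ (- q%:Z) * (OP q (cis t) - c)) n).
  rewrite coef_shift opprK.
  have -> : coef (fun t => OP q (cis t) - c) (n + q%:Z) =
      fourier (OP q) (n + q%:Z) - coef (cst c) (n + q%:Z).
    exact: (ipBl sO sc (@sqint_cisz R _)).
  rewrite coef_cst; have [e|ne] := eqVneq (n + q%:Z) 0.
    by rewrite e -cE mulr1 subrr.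
  rewrite mulr0 subr0; have [l|g] := ltP (n + q%:Z) 0; first exact: cO.
  by apply: flat; rewrite lt_def ne g /= gtrDr.
have [sB _] := hB.
exists (norm2 B * 2); first by rewrite mulr_ge0// norm2_ge0.
move=> w w2; have w1 : cabs w < 1 by lra.
have -> : gelfand (OP q) w - gelfand (OP q) 0 = w ^+ q * gelfand B w.
  rewrite -[w ^+ q]hornerXn -gelfand_hornerM// -/c -{1}(gelfand_cst w1 c).
  rewrite -gelfandB//; apply: eq_gelfand => t; rewrite hornerXn /B mulrA.
  by rewrite exprnP -expfzDr ?cis_neq0// subrr expr0z mul1r.
have Kw : K w <= 2.
  rewrite -(@ler_pXn2r _ 2)// ?nnegrE ?norm2_ge0// norm2_kern//.
  have : cabs w ^+ 2 <= 1 / 4.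
    by rewrite (_ : 1 / 4 = (1 / 2) ^+ 2) ?lerXn2r ?nnegrE ?cabs_ge0//; field.
  move=> h; rewrite -[leRHS]invrK lef_pV2 ?posrE ?invr_gt0//; last by lra.
  by rewrite (_ : (2 ^+ 2)^-1 = 1 / 4 :> R); [lra|field].
rewrite cabsM cabsX mulrC ler_wpM2r ?exprn_ge0 ?cabs_ge0//.
by rewrite (le_trans (gelfand_le w1 sB))// ler_wpM2l ?norm2_ge0.
Qed.

(** For [m <> 0] let [D] be the distance from [m^q] to the value of the transform at
    [0]. The bound [invertible_lower] degenerates like [|w|^(q-1)] at the origin,
    where the transform is constant up to [|w|^q]; comparing the two rates
    excludes [D = 0], and [D > 0] gives a uniform bound near the origin. *)
Lemma bounded_below_of_invertible m : invertible_at m T ->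
  exists2 d : R, 0 < d &
    forall w, cabs w < 1 -> d <= cabs (m ^+ q - gelfand (OP q) w).
Proof.
move=> [S [bS _ SI]]; have SH := bounded_operator_H2 bS.
have [M' hM'] := bounded_operator_bound bS.
pose M := `|M'| + 1; have M0 : 0 < M by rewrite ltr_wpDl.
have SM f : in_H2 f -> norm2 (S f) <= M * norm2 f.
  move=> hf; rewrite (le_trans (hM' f hf))// ler_wpM2r ?norm2_ge0//.
  by rewrite (le_trans (ler_norm _))// lerDl.
have [m0|m0] := eqVneq m 0.
  exists (M^-1 ^+ q); first by rewrite exprn_gt0// invr_gt0.
  move=> w w1; rewrite m0 expr0n gtn_eqF// sub0r cabsN gelfand_orbit_prod//.
  rewrite cabs_prod -[q in leLHS]card_ord -prodr_const.
  apply: ler_prod => j _; rewrite invr_ge0 (ltW M0)/=.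
  have := invertible_phi_lower SH SM SI m0.
  move=> /(_ (lam ^+ j * w)); rewrite cabs_lamX => /(_ w1).
  by rewrite mulrC -ler_pdivrMr// mul1r.
have low w : cabs w < 1 -> _ := @invertible_lower m S M SH SM SI M0 w.
have [C C0 flat] := orbit_prod_flat.
pose a := cabs m ^+ q.-1; have a0 : 0 < a by rewrite exprn_gt0// cabs_gt0.
pose D := cabs (m ^+ q - gelfand (OP q) 0).
have D0 : 0 < D.
  rewrite lt_def cabs_ge0 andbT; apply/eqP => /eqP; rewrite cabs_eq0 subr_eq0 => /eqP e.
  (* At a point [x] this small, [a x^(q-1) <= M C x^q] is impossible. *)
  pose x := Num.min (1 / 2) (a / (2 * (M * C + 1))).
  have MC : 0 < M * C + 1 by rewrite ltr_wpDl// mulr_ge0// ltW.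
  have x0 : 0 < x by rewrite lt_min divr_gt0//= divr_gt0// mulr_gt0.
  have x2 : x <= 1 / 2 by rewrite ge_min lexx.
  have xa : x <= a / (2 * (M * C + 1)) by rewrite ge_min lexx orbT.
  have cx : cabs x%:C%C = x by rewrite cabs_real gtr0_norm.
  have := low x%:C%C; rewrite cx => /(_ ltac:(lra)) h1.
  have := flat x%:C%C; rewrite cx => /(_ x2); rewrite -e cabs_distC => h2.
  have h3 := le_trans h1 (ler_wpM2l (ltW M0) h2).
  have xq : x ^+ q = x * x ^+ q.-1 by rewrite -exprS prednK.
  have xq0 : 0 < x ^+ q.-1 by rewrite exprn_gt0.
  have h4 : a <= M * C * x.
    have e2 : M * C * x * x ^+ q.-1 = M * (C * x ^+ q) by rewrite xq; ring.
    by rewrite -(ler_pM2r xq0) e2.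
  move: h4; rewrite leNgt => /negP; apply.
  apply: (@le_lt_trans _ _ ((M * C + 1) * x)).
    by rewrite ler_wpM2r ?(ltW x0)// lerDl.
  apply: (@le_lt_trans _ _ ((M * C + 1) * (a / (2 * (M * C + 1))))).
    by rewrite ler_wpM2l// ltW.
  have -> : (M * C + 1) * (a / (2 * (M * C + 1))) = a / 2.
    by field; rewrite gt_eqF.
  by lra.
have CM : 0 < C * M + a by rewrite ltr_wpDl// mulr_ge0// ltW.
(* The first bound serves [|w| > 1/2]; the second one combines [a |w|^q <= M y]
   and [D <= y + C |w|^q] to eliminate [|w|^q]. *)
exists (Num.min (a * (1 / 2) ^+ q.-1 / M) (a * D / (C * M + a))).
  by rewrite lt_min !divr_gt0// ?mulr_gt0// exprn_gt0.
move=> w w1; set y := cabs (m ^+ q - _).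
have ly : a * cabs w ^+ q.-1 <= M * y := low w w1.
have [w2|w2] := leP (cabs w) (1 / 2); rewrite ge_min; apply/orP; [right|left].
  have fw := flat w w2.
  have wq : cabs w ^+ q <= cabs w ^+ q.-1.
    by rewrite -{1}(prednK q_ge1) exprS ler_piMl ?exprn_ge0 ?cabs_ge0// ltW.
  have Dy : D <= y + C * cabs w ^+ q.
    rewrite /D (_ : m ^+ q - gelfand (OP q) 0 =
      (m ^+ q - gelfand (OP q) w) + (gelfand (OP q) w - gelfand (OP q) 0)); last by ring.
    by rewrite (le_trans (cabsD _ _))// lerD2l.
  rewrite ler_pdivrMr//.
  have h1 := ler_wpM2l (ltW a0) Dy.
  have h2 := ler_wpM2l C0 (le_trans (ler_wpM2l (ltW a0) wq) ly).
  move: h1 h2; move: (cabs w ^+ q) => v h1 h2.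
  apply: le_trans h1 _.
  have -> : y * (C * M + a) = a * y + C * (M * y) by ring.
  have -> : a * (y + C * v) = a * y + C * (a * v) by ring.
  by rewrite lerD2l.
rewrite ler_pdivrMr// mulrC [leRHS]mulrC; apply: le_trans ly.
by rewrite mulrC ler_wpM2l ?(ltW a0)// lerXn2r ?nnegrE ?cabs_ge0// ltW.
Qed.

End Necessity.

(** * The spectrum *)

Lemma complex_closureP (R : realType) (A : set R[i]) (z : R[i]) :
  complex_closure A z <->
  (forall e : R, 0 < e -> exists2 a, A a & cabs (z - a) < e).
Proof.
split=> [Az e e0|h B /nbhs_ballP[e /= e0 eB]].
  have : nbhs (z : (R[i])^o) (ball (z : (R[i])^o) e%:C%C).
    by apply: nbhsx_ballx; rewrite ltcR.
  by move=> /Az[a [Aa]]; rewrite /ball /= normE ltcR => za; exists a.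
have eR : e = (complex.Re e)%:C%C by rewrite RRe_real// gtr0_real.
have e0' : 0 < complex.Re e by rewrite -ltcR -eR.
have [a Aa za] := h _ e0'; exists a; split => //.
by apply: eB; rewrite /ball /= normE eR ltcR.
Qed.

Unset Implicit Arguments.
Set Strict Implicit.
Set Printing Implicit Defensive.

Theorem theorem3p1 (R : realType) (p : int) (q : nat) (phi : R[i] -> R[i])
    (q_ge1 : (1 <= q)%N) (pq_coprime : coprime `|p|%N q)
    (phi_H2 : in_H2 phi) (phi_C1 : C1_circle phi) :
  let lam : R[i] := cis (pi *+ 2 * (p%:~R / q%:R)) in
  spectrum (lambda_toeplitz lam phi) =
  [set mu : R[i] |
    complex_closure (gelfand (symbol_product lam q phi) @` @unit_disc R)
      (mu ^+ q)].
Proof.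
move=> lam; rewrite {}/lam; set th := pi *+ 2 * _.
have lam_q : cis th ^+ q = 1 by exact: root_exp_order.
have lam_prim k : (0 < k < q)%N -> cis th ^+ k != 1 by exact: root_exp_neq1.
have phi_da := C1_disc_alg phi_H2 phi_C1.
have gE w : unit_disc w ->
    gelfand (symbol_product (cis th) q phi) w = gelfand (orbit_prod th phi q) w.
  by rewrite /unit_disc /= normE (ltcR _ 1) => w1; exact: gelfand_symbol_product.
have discP (w : R[i]) : unit_disc w <-> cabs w < 1 by rewrite /unit_disc /= normE (ltcR _ 1).
apply/seteqP; split => m /=; last first.
  move/complex_closureP => clm /(bounded_below_of_invertible q_ge1 lam_q lam_prim
    phi_H2 phi_da)[d d0 low].
  have [_ [w Dw <-]] := clm d d0.
  by rewrite gE// ltNge low//; exact/discP.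
move=> sm; apply/complex_closureP => e e0; apply: contrapT => no; apply: sm.
apply: (invertible_of_bounded_below q_ge1 lam_q phi_H2 phi_da e0) => w w1.
rewrite leNgt; apply/negP => lt_e; apply: no; have Dw := (discP w).2 w1.
exists (gelfand (symbol_product (cis th) q phi) w); first by exists w.
by rewrite gE.
Qed.
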